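(* (Average BER of the direct link and its diversity order.) Let $h$ be the fading coefficient of a single direct link with turbulence/pointing-error parameters $\psi,\phi,P,\zeta_l,C_l,a_{l,w},b_{l,w},m,n,p,q$ of one of the models $\mathcal{GG},\mathcal M,\mathcal F$ and fog parameters $v>0$, $k$ a positive integer, as described in the context. Let $t\in\{1,2\}$, $\gamma_0>0$, and let $\gamma=\gamma_0h^t$ be the SNR, with CDF $F_\gamma$. For modulation parameters $\mathsf p,\mathsf q>0$ let $\bar P_e^{\rm DL}=\frac{\mathsf q^{\mathsf p}}{2\Gamma(\mathsf p)}\int_0^\infty x^{\mathsf p-1}e^{-\mathsf qx}F_\gamma(x)\,dx$. Then $$\bar P_e^{\rm DL}=\frac{\psi v^k}{2\Gamma(\mathsf p)}\sum_{l=1}^P\zeta_lC_l^{-\phi}\,H^{m+k,n+2}_{p+k+2,q+k+1}\left[C_l\Big(\frac1{\mathsf q\gamma_0}\Big)^{1/t}\middle|\begin{array}{c} \{(\phi+a_{l,w},1)\}_{w=1}^n,(1,1),(1-\mathsf p,\frac1t),\{(\phi+a_{l,w},1)\}_{w=n+1}^p,\{(v+1,1)\}_1^k \\ \{(\phi+b_{l,w},1)\}_{w=1}^m,\{(v,1)\}_1^k,\{(\phi+b_{l,w},1)\}_{w=m+1}^q,(0,1) \end{array}\right],$$ and the diversity order $G^{\rm DL}_{\rm BER}=-\lim_{\gamma_0\to\infty}\frac{\ln\bar P_e^{\rm DL}}{\ln\gamma_0}$ (all other parameters fixed) equals $$G^{\rm DL}_{\rm BER}=\min\left\{\frac{\phi+b_{l,i}}t,\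 \frac vt\ :\ 1\le l\le P,\ 1\le i\le m\right\}.$$
   Context: Notation: $\{c\}_1^k$ denotes $c$ repeated $k$ times. Fox's H-function: $H_{p,q}^{m,n}\left[x\middle|\begin{array}{c} (a_1,A_1),\dots,(a_p,A_p) \\ (b_1,B_1),\dots,(b_q,B_q) \end{array}\right]=\frac1{2\pi\jmath}\int_{\mathcal L}\frac{\prod_{j=1}^m\Gamma(b_j-B_js)\prod_{j=1}^n\Gamma(1-a_j+A_js)}{\prod_{j=n+1}^p\Gamma(a_j-A_js)\prod_{j=m+1}^q\Gamma(1-b_j+B_js)}x^s\,ds$, where $\jmath$ is the imaginary unit and $\mathcal L$ runs from $-\jmath\infty$ to $+\jmath\infty$ with the poles of $\Gamma(b_j-B_js)$ ($j\le m$) on its right and those of $\Gamma(1-a_j+A_js)$ ($j\le n$) on its left. Meijer's G-function $G^{m,n}_{p,q}\left(x\middle|\begin{array}{c} a_1,\dots,a_p \\ b_1,\dots,b_q \end{array}\right)$ is the case in which all $A_j=B_j=1$. Fading coefficient of a link: $h=h^{(tp)}h^{(f)}$ with $h^{(tp)}$, $h^{(f)}$ independent. The fog gain $h^{(f)}$ has density $\frac{v^k}{\Gamma(k)}[\ln(1/x)]^{k-1}x^{v-1}$ on $(0,1]$, $v>0$, $k$ a positive integer. The turbulence/pointing-error gain $h^{(tp)}$ has density $\psi x^{\phi-1}\sum_{l=1}^{P}\zeta_lG_{p,q}^{m,n}\left(C_lx\middle|\begin{array}{c} \{a_{l,w}\}_{w=1}^p \\ \{b_{l,w}\}_{w=1}^q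 \end{array}\right)$, $x>0$, with parameters of one of the following models ($\rho>0$, $A_0>0$ pointing-error parameters): $\mathcal{GG}$ (Gamma-Gamma), $\alpha,\beta>0$: $\psi=\frac{\alpha\beta\rho^2}{A_0\Gamma(\alpha)\Gamma(\beta)}$, $\phi=1$, $P=1$, $\zeta_1=1$, $C_1=\frac{\alpha\beta}{A_0}$, $(m,n,p,q)=(3,0,1,3)$, $a=\{\rho^2\}$, $b=\{\rho^2-1,\alpha-1,\beta-1\}$. $\mathcal{M}$ (Málaga), $\alpha>0$, $\beta$ a positive integer, $g,\Omega'>0$: $\psi=\frac{\rho^2A_{mg}}{2}$, $\phi=0$, $P=\beta$, $\zeta_l=b_l$, $C_l=\frac{\alpha\beta}{(g\beta+\Omega')A_0}$, $(m,n,p,q)=(3,0,1,3)$, $a_l=\{\rho^2+1\}$, $\{b_{l,w}\}=\{\rho^2,\alpha,l\}$, where $A_{mg}=\frac{2\alpha^{\alpha/2}}{g^{1+\alpha/2}\Gamma(\alpha)}\left(\frac{g\beta}{g\beta+\Omega'}\right)^{\beta+\alpha/2}$ and $b_l=\binom{\beta-1}{l-1}\frac{(g\beta+\Omega')^{1-l/2}}{(l-1)!}\left(\frac{\Omega'}{g}\right)^{l-1}\left(\frac{\alpha}{\beta}\right)^{l/2}\left(\frac{\alpha\beta}{g\beta+\Omega'}\right)^{-(\alpha+l)/2}$. $\mathcal{F}$ (Fisher–Snedecor), $\alpha>0$, $\beta>1$: $\psi=\frac{\alpha\rho^2}{(\beta-1)A_0\Gamma(\alpha)\Gamma(\beta)}$,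 $\phi=1$, $P=1$, $\zeta_1=1$, $C_1=\frac{\alpha}{(\beta-1)A_0}$, $(m,n,p,q)=(2,1,2,2)$, $a=\{-\beta,\rho^2\}$, $b=\{\alpha-1,\rho^2-1\}$. *)

(* Defs.v *)
From HB Require Import structures.
From mathcomp Require Import all_boot all_order all_algebra.
From mathcomp Require Import complex.
From mathcomp Require Import all_classical all_reals all_analysis.
From mathcomp Require Import measurable_realfun.

Set Implicit Arguments.
Unset Strict Implicit.
Unset Printing Implicit Defensive.

Import Order.TTheory GRing.Theory Num.Theory.
Import numFieldNormedType.Exports.

Local Open Scope classical_set_scope.
Local Open Scope ring_scope.
Local Open Scope complex_scope.

Section ComplexAnalysis.
Context {R : realType}.
Implicit Types (D : set R) (f : R -> R[i]) (s z : R[i]) (x : R).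
Local Notation mu := (@lebesgue_measure R).

(* Complex-valued functions of a real variable are integrated componentwise. *)
Definition cintegrable D f : Prop :=
  mu.-integrable D (EFin \o (fun x => complex.Re (f x))) /\
  mu.-integrable D (EFin \o (fun x => complex.Im (f x))).

Definition cintegral D f : R[i] :=
  (\int[mu]_(x in D) complex.Re (f x)) +i* (\int[mu]_(x in D) complex.Im (f x)).

(* The principal power x^s = exp (s ln x); meaningful for x > 0. *)
Definition cpow x s : R[i] :=
  (expR (complex.Re s * ln x) * cos (complex.Im s * ln x)) +i*
  (expR (complex.Re s * ln x) * sin (complex.Im s * ln x)).

(* Euler's integral, which converges for Re z > 0. *)
Definition euler_integral z : R[i] :=
  cintegral `]0, +oo[ (fun u => (expR (- u))%:C * cpow u (z - 1)).

(* The Gamma function: Euler's integral on Re z > 0, extended to the left by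
   Gamma z = Gamma (z + n) / (z (z + 1) ... (z + n - 1)), n being the least
   integer with Re z + n > 0.  At the poles 0, -1, -2, ... the product vanishes
   and the value is 0, hence (Gamma z)^-1 is there the value 0 of the entire
   function 1/Gamma, as needed in the denominators below. *)
Definition cGamma z : R[i] :=
  let n := if 0 < complex.Re z then 0%N
           else (Num.truncn (- complex.Re z)).+1 in
  euler_integral (z + n%:R) / \prod_(0 <= j < n) (z + j%:R).

Definition rGamma x : R := complex.Re (cGamma x%:C).

(* A contour from -i oo to +i oo is given by its abscissa c as a function of
   the ordinate: s(tau) = c(tau) + i tau.  The parameters of the H-functions
   being real, all the poles lie on the real axis; two contours of this kind
   which separate them in the same way are then homotopic off the poles. *)
Definition contour (c : R -> R) : Prop :=
  [/\ forall tau, derivable c tau 1,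
      continuous (derive1 c)
    & exists M : R, forall tau, `|c tau| <= M].

Definition contour_point (c : R -> R) (tau : R) : R[i] := c tau +i* tau.

Definition left_of (c : R -> R) z : Prop := complex.Re z < c (complex.Im z).

Definition right_of (c : R -> R) z : Prop := c (complex.Im z) < complex.Re z.

(* In what follows A = [:: (a_1, A_1); ...; (a_p, A_p)] and
   B = [:: (b_1, B_1); ...; (b_q, B_q)]; p and q are the sizes of A and B. *)
Definition separates (m n : nat) (A B : seq (R * R)) (c : R -> R) : Prop :=
  (forall b, b \in take m B -> forall nu : nat,
     right_of c ((b.1 + nu%:R) / b.2)%:C) /\
  (forall a, a \in take n A -> forall nu : nat,
     left_of c ((a.1 - 1 - nu%:R) / a.2)%:C).

Definition foxH_integrand (m n : nat) (A B : seq (R * R)) x s : R[i] :=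
  (\prod_(b <- take m B) cGamma (b.1%:C - b.2%:C * s)) *
  (\prod_(a <- take n A) cGamma (1 - a.1%:C + a.2%:C * s)) /
  ((\prod_(a <- drop n A) cGamma (a.1%:C - a.2%:C * s)) *
   (\prod_(b <- drop m B) cGamma (1 - b.1%:C + b.2%:C * s))) *
  cpow x s.

(* w is the value of the Mellin-Barnes integral along some admissible contour,
   ds being (c'(tau) + i) dtau. *)
Definition is_foxH (m n : nat) (A B : seq (R * R)) x (w : R[i]) : Prop :=
  exists c : R -> R,
    let g tau := foxH_integrand m n A B x (contour_point c tau) *
                 (derive1 c tau +i* 1) in
    [/\ contour c, separates m n A B c, cintegrable setT g
      & w = ((2 * pi)%:C * (0 +i* 1))^-1 * cintegral setT g].

Definition foxH (m n : nat) (A B : seq (R * R)) x : R[i] :=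
  xget 0 [set w | is_foxH m n A B x w].

Definition meijerG (m n : nat) (a b : seq R) x : R[i] :=
  foxH m n [seq (y, 1) | y <- a] [seq (y, 1) | y <- b] x.

End ComplexAnalysis.

Section Probability.
Context {R : realType} {d : measure_display} {T : measurableType d}.
Variable P : probability T R.

Definition independent_RV (X Y : {RV P >-> R}) : Prop :=
  forall A B : set R, measurable A -> measurable B ->
    P ((X @^-1` A) `&` (Y @^-1` B)) = (P (X @^-1` A) * P (Y @^-1` B))%E.

Definition has_density (X : {RV P >-> R}) (f : R -> R) : Prop :=
  [/\ measurable_fun setT f, forall x, 0 <= f x
    & forall A : set R, measurable A ->
        distribution P X A = (\int[lebesgue_measure]_(x in A) (f x)%:E)%E].

Definition fading (htp hf : {mfun T >-> R}) : T -> R := fun w => htp w * hf w.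

Lemma measurable_fading (htp hf : {mfun T >-> R}) :
  measurable_fun setT (fading htp hf).
Proof. by apply: measurable_funM. Qed.

HB.instance Definition _ (htp hf : {mfun T >-> R}) :=
  isMeasurableFun.Build _ _ _ _ (fading htp hf) (measurable_fading htp hf).

Definition snr (t : nat) (h : {mfun T >-> R}) (gamma0 : R) : T -> R :=
  fun w => gamma0 * h w ^+ t.

Lemma measurable_snr (t : nat) (h : {mfun T >-> R}) (gamma0 : R) :
  measurable_fun setT (snr t h gamma0).
Proof. by apply: measurable_funM => //; apply: measurable_funX. Qed.

HB.instance Definition _ (t : nat) (h : {mfun T >-> R}) (gamma0 : R) :=
  isMeasurableFun.Build _ _ _ _ (snr t h gamma0) (measurable_snr t h gamma0).

(* pm and qm are the modulation parameters. *)
Definition average_BER (pm qm : R) (X : {RV P >-> R}) : R :=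
  qm `^ pm / (2 * rGamma pm) *
  \int[lebesgue_measure]_(x in `]0, +oo[)
    (x `^ (pm - 1) * expR (- (qm * x)) * fine (cdf X x)).

End Probability.
Arguments independent_RV {R d T} P X Y.
Arguments has_density {R d T} P X f.
Arguments average_BER {R d T} P pm qm X.

Section Channel.
Context {R : realType}.

Definition fog_density (v : R) (k : nat) (x : R) : R :=
  if (0 < x) && (x <= 1)
  then v ^+ k / rGamma k%:R * ln (x^-1) ^+ k.-1 * x `^ (v - 1)
  else 0.

(* tp_a l and tp_b l list the a_{l,w} and b_{l,w}, for 1 <= l <= tp_P; their
   lengths are the p and q of the model. *)
Record tp_params := TPParams {
  tp_psi : R; tp_phi : R; tp_P : nat;
  tp_zeta : nat -> R; tp_C : nat -> R;
  tp_m : nat; tp_n : nat;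
  tp_a : nat -> seq R; tp_b : nat -> seq R }.

Definition gamma_gamma (rho A0 alpha beta : R) : tp_params := {|
  tp_psi := alpha * beta * rho ^+ 2 / (A0 * rGamma alpha * rGamma beta);
  tp_phi := 1;
  tp_P := 1;
  tp_zeta := fun=> 1;
  tp_C := fun=> alpha * beta / A0;
  tp_m := 3; tp_n := 0;
  tp_a := fun=> [:: rho ^+ 2];
  tp_b := fun=> [:: rho ^+ 2 - 1; alpha - 1; beta - 1] |}.

Definition malaga_A (alpha : R) (beta : nat) (g Omega : R) : R :=
  2 * alpha `^ (alpha / 2) / (g `^ (1 + alpha / 2) * rGamma alpha) *
  (g * beta%:R / (g * beta%:R + Omega)) `^ (beta%:R + alpha / 2).

Definition malaga_b (alpha : R) (beta : nat) (g Omega : R) (l : nat) : R :=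
  'C(beta.-1, l.-1)%:R *
  ((g * beta%:R + Omega) `^ (1 - l%:R / 2) / (l.-1)`!%:R) *
  (Omega / g) ^+ l.-1 *
  (alpha / beta%:R) `^ (l%:R / 2) *
  (alpha * beta%:R / (g * beta%:R + Omega)) `^ (- ((alpha + l%:R) / 2)).

Definition malaga (rho A0 alpha : R) (beta : nat) (g Omega : R) : tp_params := {|
  tp_psi := rho ^+ 2 * malaga_A alpha beta g Omega / 2;
  tp_phi := 0;
  tp_P := beta;
  tp_zeta := malaga_b alpha beta g Omega;
  tp_C := fun=> alpha * beta%:R / ((g * beta%:R + Omega) * A0);
  tp_m := 3; tp_n := 0;
  tp_a := fun=> [:: rho ^+ 2 + 1];
  tp_b := fun l => [:: rho ^+ 2; alpha; l%:R] |}.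

Definition fisher_snedecor (rho A0 alpha beta : R) : tp_params := {|
  tp_psi := alpha * rho ^+ 2 /
            ((beta - 1) * A0 * rGamma alpha * rGamma beta);
  tp_phi := 1;
  tp_P := 1;
  tp_zeta := fun=> 1;
  tp_C := fun=> alpha / ((beta - 1) * A0);
  tp_m := 2; tp_n := 1;
  tp_a := fun=> [:: - beta; rho ^+ 2];
  tp_b := fun=> [:: alpha - 1; rho ^+ 2 - 1] |}.

Inductive tp_model : tp_params -> Prop :=
| GammaGamma (rho A0 alpha beta : R) :
    0 < rho -> 0 < A0 -> 0 < alpha -> 0 < beta ->
    tp_model (gamma_gamma rho A0 alpha beta)
| Malaga (rho A0 alpha : R) (beta : nat) (g Omega : R) :
    0 < rho -> 0 < A0 -> 0 < alpha -> (0 < beta)%N -> 0 < g -> 0 < Omega ->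
    tp_model (malaga rho A0 alpha beta g Omega)
| FisherSnedecor (rho A0 alpha beta : R) :
    0 < rho -> 0 < A0 -> 0 < alpha -> 1 < beta ->
    tp_model (fisher_snedecor rho A0 alpha beta).

(* The sum of G-functions is real; Re only casts it from R[i] to R. *)
Definition tp_density (M : tp_params) (x : R) : R :=
  if 0 < x then
    tp_psi M * x `^ (tp_phi M - 1) *
    complex.Re (\sum_(1 <= l < (tp_P M).+1)
      (tp_zeta M l)%:C *
      meijerG (tp_m M) (tp_n M) (tp_a M l) (tp_b M l) (tp_C M l * x))
  else 0.

(* Upper and lower parameters of the l-th H-function of the average BER. *)
Definition ber_upper (M : tp_params) (v : R) (k t : nat) (pm : R) (l : nat) :
    seq (R * R) :=
  [seq (tp_phi M + y, 1) | y <- take (tp_n M) (tp_a M l)] ++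
  [:: (1, 1); (1 - pm, t%:R^-1)] ++
  [seq (tp_phi M + y, 1) | y <- drop (tp_n M) (tp_a M l)] ++
  nseq k (v + 1, 1).

Definition ber_lower (M : tp_params) (v : R) (k : nat) (l : nat) :
    seq (R * R) :=
  [seq (tp_phi M + y, 1) | y <- take (tp_m M) (tp_b M l)] ++
  nseq k (v, 1) ++
  [seq (tp_phi M + y, 1) | y <- drop (tp_m M) (tp_b M l)] ++
  [:: (0, 1)].

End Channel.
Arguments tp_params R : clear implicits.

(* Main.v *)
Require Import Defs.
From HB Require Import structures.
From mathcomp Require Import all_boot all_order all_algebra.
From mathcomp Require Import complex.
From mathcomp Require Import all_classical all_reals all_analysis.
From mathcomp Require Import measurable_realfun.
From mathcomp Require Import ring lra.

Set Implicit Arguments.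
Unset Strict Implicit.
Unset Printing Implicit Defensive.

Import Order.TTheory GRing.Theory Num.Theory.
Import numFieldNormedType.Exports.
Import Normc.

Local Open Scope classical_set_scope.
Local Open Scope ring_scope.
Local Open Scope complex_scope.

(* The density of h^(tp) and the cdf's of h^(tp), of h and of the SNR, as well as
   the average BER, are all Mellin-Barnes integrals over the same vertical line
   Re s = c in the fundamental strip (after the shift s -> s + phi): by Fubini,
   integrating against a weight w multiplies the kernel by the Mellin transform
   of w, namely by 1/s for the cdf, by (v/(v-s))^k for the fog, and by
   Gamma(p + s/t) for the BER.  Since Gamma(b-s)/Gamma(b+1-s) = 1/(b-s), the
   resulting kernel is the integrand of the H-function; its value does not depend
   on the contour, by a homotopy argument on the plane slit along the real axis
   outside the strip, Gamma decaying rapidly on vertical lines.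

   Moving c through the strip ]0, t D[, where D is the claimed diversity order,
   bounds the BER by a multiple of gamma0^(-c/t).  For the matching lower bound,
   the kernel Gamma(al-s) Gamma(be - e s)/(rho^2-s) common to the three models is
   the Mellin transform of an explicit positive function, whose behaviour at 0 is
   bounded below by every power x^b, b in {phi + b_{l,i}}; the fog contributes x^v
   in the same way, and the BER dominates the cdf of h at gamma0^(-1/t). *)

(** * Complex powers and differentiability *)

(** The homotopy uses no Cauchy theorem: integrating f along the horizontal segments that join the
    line to the contour gives a function of the ordinate whose derivative is the difference of the
    two integrands and which vanishes at both ends. To support this, complex differentiability is
    carried as a Taylor bound with quadratic remainder, uniform on rectangles; such bounds are
    stable under products and under composition with paths.

    Cancelling Gamma(z) / Gamma(z+1) into 1/z requires that Gamma have no zero off the real axis,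
    since a zero in the denominator would make the quotient 0. This is proved far to the right from
    Euler's integral, by an estimate of variance type, and carried back by the recurrence. Decay on
    vertical lines also comes from the recurrence, to every polynomial order, without Stirling's
    formula.

    The lower bound computes no residue: all functions being nonnegative, a single box of points of
    comparable size already contributes the right power. Coinciding exponents, which would merge
    poles, therefore need no separate treatment. *)

Section ComplexBasics.
Context {R : realType}.
Implicit Types (x y : R) (z w h a : R[i]).

Lemma cReM z w : complex.Re (z * w) =
  complex.Re z * complex.Re w - complex.Im z * complex.Im w.
Proof. by case: z w => a b [c d]. Qed.

Lemma cImM z w : complex.Im (z * w) =
  complex.Re z * complex.Im w + complex.Im z * complex.Re w.
Proof. by case: z w => a b [c d]. Qed.

Lemma cReD z w : complex.Re (z + w) = complex.Re z + complex.Re w.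
Proof. by case: z w => a b [c d]. Qed.

Lemma cImD z w : complex.Im (z + w) = complex.Im z + complex.Im w.
Proof. by case: z w => a b [c d]. Qed.

Lemma cReN z : complex.Re (- z) = - complex.Re z.
Proof. by case: z. Qed.

Lemma cImN z : complex.Im (- z) = - complex.Im z.
Proof. by case: z. Qed.

Lemma cRe_nat n : complex.Re (n%:R : R[i]) = n%:R.
Proof. by elim: n => // n IH; rewrite -addn1 !natrD cReD IH. Qed.

Lemma cIm_nat n : complex.Im (n%:R : R[i]) = 0.
Proof. by elim: n => // n IH; rewrite -addn1 !natrD cImD IH addr0. Qed.

Definition cReImE := (cReM, cImM, cReD, cImD, cReN, cImN, cRe_nat, cIm_nat).

Lemma complex_eq z w : complex.Re z = complex.Re w ->
  complex.Im z = complex.Im w -> z = w.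
Proof. by case: z w => a b [c d] /= -> ->. Qed.

Lemma natC n : (n%:R : R[i]) = (n%:R)%:C.
Proof. by apply: complex_eq; rewrite ?cRe_nat ?cIm_nat. Qed.

Lemma realCD x y : (x + y)%:C = x%:C + y%:C :> R[i].
Proof. exact: rmorphD. Qed.

Lemma realCN x : (- x)%:C = - x%:C :> R[i].
Proof. exact: rmorphN. Qed.

Lemma realCM x y : (x * y)%:C = x%:C * y%:C :> R[i].
Proof. exact: rmorphM. Qed.

Lemma realCV x : (x^-1)%:C = (x%:C)^-1 :> R[i].
Proof. exact: fmorphV. Qed.

Lemma realCX x n : (x ^+ n)%:C = (x%:C) ^+ n :> R[i].
Proof. exact: rmorphXn. Qed.

Lemma normc_ge0 z : 0 <= normc z.
Proof. by case: z => a b; rewrite /normc sqrtr_ge0. Qed.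

Lemma normc_real x : normc (x%:C) = `|x|.
Proof. by rewrite /normc /= expr0n/= addr0 sqrtr_sqr. Qed.

Lemma normcN z : normc (- z) = normc z.
Proof. by case: z => a b; rewrite /normc /= !sqrrN. Qed.

Lemma ler_normcD z w : normc (z + w) <= normc z + normc w.
Proof. exact: le_normcD. Qed.

Lemma ler_normcB z w : normc (z - w) <= normc z + normc w.
Proof. by rewrite -(normcN w); exact: le_normcD. Qed.

Lemma normcBC z w : normc (z - w) = normc (w - z).
Proof. by rewrite -normcN opprB. Qed.

Lemma normcX z n : normc (z ^+ n) = normc z ^+ n.
Proof. by elim: n => [|n IH]; rewrite ?expr0 ?normc1 // !exprS normcM IH. Qed.

Lemma sqr_normc z : normc z ^+ 2 = complex.Re z ^+ 2 + complex.Im z ^+ 2.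
Proof. by case: z => a b; rewrite sqr_sqrtr // addr_ge0 ?sqr_ge0. Qed.

Lemma ler_Re_normc z : `|complex.Re z| <= normc z.
Proof.
case: z => a b; rewrite -sqrtr_sqr ler_sqrt ?lerDl ?sqr_ge0//.
by rewrite addr_ge0 ?sqr_ge0.
Qed.

Lemma ler_Im_normc z : `|complex.Im z| <= normc z.
Proof.
case: z => a b; rewrite -sqrtr_sqr ler_sqrt ?lerDr ?sqr_ge0//.
by rewrite addr_ge0 ?sqr_ge0.
Qed.

Lemma ler_normc_ReIm z : normc z <= `|complex.Re z| + `|complex.Im z|.
Proof.
rewrite -(@ler_pXn2r _ 2%N) ?nnegrE ?addr_ge0 ?normc_ge0//.
rewrite sqr_normc sqrrD !real_normK ?num_real//.
by rewrite addrAC lerDl mulrn_wge0 ?mulr_ge0.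
Qed.

Lemma normc_gt0 z : (0 < normc z) = (z != 0).
Proof.
rewrite lt_def normc_ge0 andbT; congr (~~ _).
apply/eqP/eqP => [/eq0_normc //|->]; exact: normc0.
Qed.

Lemma normci : normc ('i : R[i]) = 1.
Proof. by rewrite /normc /= expr0n expr1n /= add0r sqrtr1. Qed.

Definition cexp z : R[i] :=
  (expR (complex.Re z) * cos (complex.Im z)) +i*
  (expR (complex.Re z) * sin (complex.Im z)).

Lemma cexpD z w : cexp (z + w) = cexp z * cexp w.
Proof.
by apply: complex_eq; rewrite !cReImE /= !cReImE expRD ?cosD ?sinD; ring.
Qed.

Lemma cexp0 : cexp 0 = 1.
Proof. by rewrite /cexp /= expR0 cos0 sin0 !mul1r. Qed.

Lemma normc_cexp z : normc (cexp z) = expR (complex.Re z).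
Proof.
rewrite /normc /= !exprMn -mulrDr cos2Dsin2 mulr1 sqrtr_sqr.
by rewrite ger0_norm // expR_ge0.
Qed.

Lemma cexp_real x : cexp x%:C = (expR x)%:C.
Proof. by rewrite /cexp /= cos0 sin0 mulr1 mulr0. Qed.

Lemma cpowE x z : cpow x z = cexp (z * (ln x)%:C).
Proof. by rewrite /cexp /cpow !cReImE /= !mulr0 subr0 add0r. Qed.

Lemma normc_cpow x z : normc (cpow x z) = expR (complex.Re z * ln x).
Proof. by rewrite cpowE normc_cexp !cReImE /= mulr0 subr0. Qed.

Lemma cpowD x z w : cpow x (z + w) = cpow x z * cpow x w.
Proof. by rewrite !cpowE mulrDl cexpD. Qed.

Lemma cpowM x y z : 0 < x -> 0 < y -> cpow (x * y) z = cpow x z * cpow y z.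
Proof.
by move=> x0 y0; rewrite !cpowE lnM ?posrE// realCD mulrDr cexpD.
Qed.

Lemma cpow_real x y : 0 < x -> cpow x y%:C = (x `^ y)%:C.
Proof.
move=> x0; rewrite cpowE -realCM cexp_real /powR.
by rewrite gt_eqF.
Qed.

(** The factor [a] lets one real derivative serve both components: [a] = 1 gives the real part, [a]
    = i or -i the imaginary part up to sign. *)
Lemma is_derive_Recexp a z h (t : R) :
  is_derive t 1 (fun s : R => complex.Re (a * cexp (z + s%:C * h)))
    (complex.Re (a * (h * cexp (z + t%:C * h)))).
Proof.
rewrite (_ : (fun s : R => _) = fun s : R =>
  complex.Re a * (expR (complex.Re z + s * complex.Re h) *
                  cos (complex.Im z + s * complex.Im h)) -
  complex.Im a * (expR (complex.Re z + s * complex.Re h) *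
                  sin (complex.Im z + s * complex.Im h))); last first.
  by apply/funext => s; rewrite !cReImE /= !cReImE /= !mul0r subr0 addr0.
apply: is_derive_eq.
by rewrite !cReImE /= !cReImE /= !mul0r subr0 addr0 /GRing.scale /=; ring.
Qed.

Lemma is_derive_continuous_within (f df : R -> R) (u v : R) :
  (forall x, is_derive x 1 f (df x)) -> {within `[u, v], continuous f}.
Proof.
move=> fd; apply: continuous_subspaceT => x.
apply: differentiable_continuous; apply/derivable1_diffP.
by case: (fd x).
Qed.

(** Mean value theorem along the segment from z to z + h. The modulus of the exponential is monotone
    along it, so the bound [M] at the two ends holds throughout. *)
Lemma Recexp_diff a z h (M : R) :
  expR (complex.Re z) <= M -> expR (complex.Re (z + h)) <= M ->
  `|complex.Re (a * (cexp (z + h) - cexp z))| <= normc a * normc h * M.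
Proof.
move=> zM hM.
pose f (s : R) := complex.Re (a * cexp (z + s%:C * h)).
have fd (s : R) := is_derive_Recexp a z h s.
have [s /itvP s01 fE] := MVT (@ltr01 R) (fun x _ => fd x)
  (is_derive_continuous_within (u:=0) (v:=1) fd).
have -> : complex.Re (a * (cexp (z + h) - cexp z)) = f 1 - f 0.
  by rewrite /f mulrBr mul1r mul0r addr0 cReD cReN.
rewrite /f fE subr0 mulr1 (le_trans (ler_Re_normc _))// !normcM mulrA.
rewrite ler_wpM2l ?mulr_ge0 ?normc_ge0// normc_cexp.
have [hz|hz] := leP 0 (complex.Re h).
  apply: le_trans hM; rewrite ler_expR !cReImE /= mul0r subr0 lerD2l.
  by rewrite ler_piMl ?s01.
apply: le_trans zM; rewrite ler_expR !cReImE /= mul0r subr0 gerDl.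
by rewrite mulr_ge0_le0 ?s01 // ltW.
Qed.

Lemma cexp_diff z h (M : R) :
  expR (complex.Re z) <= M -> expR (complex.Re (z + h)) <= M ->
  normc (cexp (z + h) - cexp z) <= 2 * normc h * M.
Proof.
move=> zM hM; rewrite (le_trans (ler_normc_ReIm _))//.
have := Recexp_diff 1 zM hM; have := Recexp_diff 'i zM hM.
rewrite normc1 normci !mul1r.
set w := cexp _ - _; rewrite !cReImE /= mul0r mul1r sub0r normrN.
by move=> h1 h2; rewrite -mulrA mulr_natl mulr2n; apply: lerD.
Qed.

(** Once the linear term is subtracted, the derivative along the segment is a first-order
    difference, which [cexp_diff] bounds; its factor 2 and the passage to the two components make
    the 4. *)
Lemma cexp_diff2 z h (M : R) :
  expR (complex.Re z) <= M -> expR (complex.Re (z + h)) <= M ->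
  normc (cexp (z + h) - cexp z - h * cexp z) <= 4 * M * normc h ^+ 2.
Proof.
move=> zM hM.
have M0 : 0 <= M by apply: le_trans zM; rewrite expR_ge0.
have key a : normc a = 1 ->
  `|complex.Re (a * (cexp (z + h) - cexp z - h * cexp z))| <=
    2 * normc h ^+ 2 * M.
  move=> a1.
  pose f (s : R) := complex.Re (a * cexp (z + s%:C * h)) -
     s * complex.Re (a * (h * cexp z)).
  have fd (s : R) : is_derive s 1 f
      (complex.Re (a * (h * cexp (z + s%:C * h)))
       - complex.Re (a * (h * cexp z))).
    have fd' := is_derive_Recexp a z h s.
    by apply: is_derive_eq; rewrite /GRing.scale /=; ring.
  have [s /itvP s01 fE] := MVT (@ltr01 R) (fun x _ => fd x)
    (is_derive_continuous_within (u:=0) (v:=1) fd).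
  have -> : complex.Re (a * (cexp (z + h) - cexp z - h * cexp z)) = f 1 - f 0.
    rewrite /f !mulrBr !mul1r !mul0r addr0 !(cReD, cReN); ring.
  rewrite fE subr0 mulr1 -cReN -cReD -mulrBr -mulrBr.
  rewrite (le_trans (ler_Re_normc _))// !normcM a1 mul1r.
  have -> : 2 * normc h ^+ 2 * M = normc h * (2 * normc h * M) by ring.
  rewrite ler_wpM2l ?normc_ge0//.
  apply: (@le_trans _ _ (2 * normc (s%:C * h) * M)); last first.
    rewrite ler_wpM2r// ler_wpM2l// normcM normc_real ler_piMl ?normc_ge0//.
    by rewrite ger0_norm ?s01.
  apply: cexp_diff => //.
  have [hz|hz] := leP 0 (complex.Re h).
    apply: le_trans hM; rewrite ler_expR !cReImE /= mul0r subr0 lerD2l.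
    by rewrite ler_piMl ?s01.
  apply: le_trans zM; rewrite ler_expR !cReImE /= mul0r subr0 gerDl.
  by rewrite mulr_ge0_le0 ?s01 // ltW.
rewrite (le_trans (ler_normc_ReIm _))//.
have := key 1 (normc1 R).
have := key 'i normci.
set w := cexp _ - _ - _; rewrite mul1r [complex.Re ('i * _)]cReM /= mul0r mul1r sub0r normrN => h1 h2.
have -> : 4 * M * normc h ^+ 2 = 2 * normc h ^+ 2 * M + 2 * normc h ^+ 2 * M by ring.
exact: lerD.
Qed.

End ComplexBasics.

Section QuadraticDifferentiability.
Context {R : realType}.
Implicit Types (D : R[i] -> Prop) (f df g dg : R[i] -> R[i]) (K : R).

(* Complex differentiability with a quadratic remainder, uniformly on D. *)
Definition C11 D f df K : Prop := forall z w, D z -> D w ->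
  [/\ normc (f z) <= K, normc (df z) <= K &
      normc (f w - f z - (w - z) * df z) <= K * normc (w - z) ^+ 2].

Definition is_C11 D f : Prop := exists df K, C11 D f df K.

(** No segment has to lie in [D]: when |w - z| >= 1 the bound on the values suffices, and when it is
    smaller the quadratic remainder is at most K |w - z|. *)
Lemma C11_lip D f df K z w : C11 D f df K -> D z -> D w ->
  normc (f w - f z) <= 2 * K * normc (w - z).
Proof.
move=> fK Dz Dw; have [fz dfz fzw] := fK _ _ Dz Dw; have [fw _ _] := fK _ _ Dw Dz.
have K0 : 0 <= K := le_trans (normc_ge0 _) fz.
have [zw|zw] := leP 1 (normc (w - z)).
  apply: le_trans (ler_normcB _ _) _.
  apply: (@le_trans _ _ (2 * K * 1)); last by rewrite ler_wpM2l ?mulr_ge0.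
  by rewrite mulr1 mulr_natl mulr2n lerD.
have -> : f w - f z = (f w - f z - (w - z) * df z) + (w - z) * df z by ring.
apply: le_trans (ler_normcD _ _) _; rewrite normcM.
have -> : 2 * K * normc (w - z) = K * normc (w - z) + normc (w - z) * K by ring.
apply: lerD; last by rewrite ler_wpM2l ?normc_ge0.
apply: le_trans fzw _; rewrite ler_wpM2l// expr2 ler_piMl ?normc_ge0//.
exact: ltW.
Qed.

(** Adding the expansions at z and at w cancels the values of f and isolates (w - z) (df w - df
    z). *)
Lemma C11_lip_d D f df K z w : C11 D f df K -> D z -> D w ->
  normc (df w - df z) <= 2 * K * normc (w - z).
Proof.
move=> fK Dz Dw; have [fz dfz fzw] := fK _ _ Dz Dw; have [_ _ fwz] := fK _ _ Dw Dz.
have [->|zw] := eqVneq w z; first by rewrite !subrr normc0 mulr0.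
have n0 : 0 < normc (w - z) by rewrite normc_gt0 subr_eq0.
rewrite -(ler_pM2l n0) -normcM.
have -> : (w - z) * (df w - df z) = (f w - f z - (w - z) * df z) +
   (f z - f w - (z - w) * df w) by ring.
rewrite (le_trans (ler_normcD _ _))//.
have -> : normc (w - z) * (2 * K * normc (w - z)) =
  K * normc (w - z) ^+ 2 + K * normc (w - z) ^+ 2 by ring.
by apply: lerD => //; rewrite (normcBC w z).
Qed.

Lemma is_C11_eq D f g : (forall z, D z -> f z = g z) -> is_C11 D g -> is_C11 D f.
Proof.
move=> fg [df [K h]]; exists df, K => z w Dz Dw.
by rewrite !fg//; exact: h.
Qed.

Lemma is_C11_cst D (a : R[i]) : is_C11 D (fun=> a).
Proof.
exists (fun=> 0), (normc a) => z w _ _; split=> //; first by rewrite normc0 normc_ge0.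
by rewrite subrr sub0r mulr0 normcN normc0 mulr_ge0 ?exprn_ge0 ?normc_ge0.
Qed.

Lemma is_C11M D f g : is_C11 D f -> is_C11 D g -> is_C11 D (fun z => f z * g z).
Proof.
move=> [df [K fK]] [dg [L gL]].
exists (fun z => df z * g z + f z * dg z), (4 * K * L) => z w Dz Dw.
have [fz dfz fzw] := fK _ _ Dz Dw; have [gz dgz gzw] := gL _ _ Dz Dw.
have [gw _ _] := gL _ _ Dw Dz.
have lip := C11_lip gL Dz Dw.
have K0 : 0 <= K := le_trans (normc_ge0 _) fz.
have L0 : 0 <= L := le_trans (normc_ge0 _) gz.
have KL0 : 0 <= K * L by rewrite mulr_ge0.
split.
- rewrite normcM (le_trans (ler_pM _ _ fz gz)) ?normc_ge0//.
  by rewrite -mulrA ler_peMl// ler1n.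
- rewrite (le_trans (ler_normcD _ _))// !normcM.
  have -> : 4 * K * L = K * L + K * L + 2 * (K * L) by ring.
  rewrite (@le_trans _ _ (K * L + K * L))//; last by rewrite lerDl mulr_ge0.
  by apply: lerD; apply: ler_pM; rewrite ?normc_ge0.
- have -> : f w * g w - f z * g z - (w - z) * (df z * g z + f z * dg z) =
    (f w - f z - (w - z) * df z) * g w + f z * (g w - g z - (w - z) * dg z)
    + (w - z) * df z * (g w - g z) by ring.
  have -> : 4 * K * L * normc (w - z) ^+ 2 =
     (K * normc (w - z) ^+ 2) * L + K * (L * normc (w - z) ^+ 2)
    + normc (w - z) * K * (2 * L * normc (w - z)) by ring.
  rewrite (le_trans (ler_normcD _ _))// lerD//.
    rewrite (le_trans (ler_normcD _ _))// !normcM lerD//.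
      by apply: ler_pM; rewrite ?normc_ge0.
    by apply: ler_pM; rewrite ?normc_ge0.
  rewrite !normcM; apply: ler_pM; rewrite ?mulr_ge0 ?normc_ge0//.
  by rewrite ler_wpM2l ?normc_ge0.
Qed.

Lemma is_C11_prod D (I : Type) (s : seq I) (F : I -> R[i] -> R[i]) :
  (forall i, is_C11 D (F i)) -> is_C11 D (fun z => \prod_(i <- s) F i z).
Proof.
move=> h; elim: s => [|i s IH].
  by apply: (is_C11_eq (g := fun=> 1)) (is_C11_cst _ _) => z _; rewrite big_nil.
apply: (is_C11_eq (g := fun z => F i z * \prod_(j <- s) F j z)).
  by move=> z _; rewrite big_cons.
exact: is_C11M.
Qed.

Lemma is_C11X D f n : is_C11 D f -> is_C11 D (fun z => f z ^+ n).
Proof.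
move=> h; elim: n => [|n IH]; first exact: is_C11_cst.
by apply: (is_C11_eq (g := fun z => f z * f z ^+ n)); [by move=> z _; rewrite exprS|exact: is_C11M].
Qed.

Lemma is_C11_affine D D' f (a b : R[i]) : (forall z, D z -> D' (a + b * z)) ->
  is_C11 D' f -> is_C11 D (fun z => f (a + b * z)).
Proof.
move=> DD' [df [K fK]].
exists (fun z => b * df (a + b * z)), (K * (1 + normc b + normc b ^+ 2)) => z w Dz Dw.
have [fz dfz fzw] := fK _ _ (DD' _ Dz) (DD' _ Dw).
have K0 : 0 <= K := le_trans (normc_ge0 _) fz.
have b0 := normc_ge0 b; have b20 : 0 <= normc b ^+ 2 by rewrite exprn_ge0.
split.
- by rewrite (le_trans fz)// ler_peMr// -addrA lerDl addr_ge0.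
- rewrite normcM mulrC ler_pM ?normc_ge0//.
  by rewrite [1 + _]addrC -addrA lerDl addr_ge0.
- have -> : f (a + b * w) - f (a + b * z) - (w - z) * (b * df (a + b * z)) =
     f (a + b * w) - f (a + b * z) -
       ((a + b * w) - (a + b * z)) * df (a + b * z) by ring.
  apply: le_trans fzw _.
  have -> : a + b * w - (a + b * z) = b * (w - z) by ring.
  rewrite normcM exprMn mulrA ler_wpM2r ?exprn_ge0 ?normc_ge0//.
  by rewrite ler_wpM2l// lerDr addr_ge0.
Qed.

(** The remainder is exactly (w - z)^2 / ((w - p) (z - p)^2), of modulus at most e^-3 |w - z|^2. *)
Lemma is_C11_inv D (p : R[i]) (e : R) : 0 < e ->
  (forall z, D z -> e <= normc (z - p)) -> is_C11 D (fun z => (z - p)^-1).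
Proof.
move=> e0 De.
exists (fun z => - (z - p) ^- 2), (e^-1 + e ^- 2 + e ^- 3) => z w Dz Dw.
have ez := De _ Dz; have ew := De _ Dw.
have nz0 : 0 < normc (z - p) := lt_le_trans e0 ez.
have nw0 : 0 < normc (w - p) := lt_le_trans e0 ew.
have z0 : z - p != 0 by rewrite -normc_gt0.
have w0 : w - p != 0 by rewrite -normc_gt0.
have [i1 i2 i3] : [/\ 0 <= e^-1, 0 <= e ^- 2 & 0 <= e ^- 3].
  by rewrite !invr_ge0 !exprn_ge0 ?ltW.
have e0' := ltW e0.
have inv_z : (normc (z - p))^-1 <= e^-1 by rewrite lef_pV2 ?posrE.
have inv_w : (normc (w - p))^-1 <= e^-1 by rewrite lef_pV2 ?posrE.
split.
- by rewrite normcV (le_trans inv_z)// -addrA lerDl addr_ge0.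
- rewrite normcN normcV normcX -exprVn (@le_trans _ _ (e ^- 2))//.
    by rewrite -[X in _ <= X]exprVn ler_pXn2r ?nnegrE ?invr_ge0 ?normc_ge0.
  by rewrite [e^-1 + _]addrC -addrA lerDl addr_ge0.
- have -> : (w - p)^-1 - (z - p)^-1 - (w - z) * - (z - p) ^- 2 =
     (w - z) ^+ 2 * ((w - p)^-1 * (z - p) ^- 2).
    by field; rewrite z0 w0.
  rewrite normcM normcX mulrC ler_wpM2r ?exprn_ge0 ?normc_ge0//.
  rewrite normcM !normcV normcX -exprVn (@le_trans _ _ (e ^- 3))//.
    rewrite -[X in _ <= X]exprVn [X in _ <= X]exprS ler_pM ?exprn_ge0 ?invr_ge0 ?normc_ge0//.
    by rewrite ler_pXn2r ?nnegrE ?invr_ge0 ?normc_ge0.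
  by rewrite lerDr addr_ge0.
Qed.

Lemma is_C11_cpow D (x x1 x2 : R) :
  (forall z, D z -> x1 <= complex.Re z <= x2) -> is_C11 D (cpow x).
Proof.
move=> Dx.
(* The modulus is monotone in Re z, in a direction given by the sign of [ln x]; the sum of both end
   values covers either case. *)
pose M := expR (x1 * ln x) + expR (x2 * ln x).
have DM z : D z -> expR (complex.Re (z * (ln x)%:C)) <= M.
  move=> /Dx /andP[z1 z2]. rewrite cReM /= mulr0 subr0.
  have [l0|l0] := leP 0 (ln x).
    by rewrite (@le_trans _ _ (expR (x2 * ln x))) ?lerDr ?expR_ge0// ler_expR ler_wpM2r.
  by rewrite (@le_trans _ _ (expR (x1 * ln x))) ?lerDl ?expR_ge0// ler_expR ler_wnM2r// ltW.
have M0 : 0 <= M by rewrite addr_ge0 ?expR_ge0.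
have l0 : 0 <= `|ln x| by [].
have l20 : 0 <= `|ln x| ^+ 2 by rewrite exprn_ge0.
exists (fun z => (ln x)%:C * cpow x z), (4 * M * (1 + `|ln x| + `|ln x| ^+ 2)).
have M4 : M <= 4 * M by rewrite ler_peMl// ler1n.
move=> z w Dz Dw; have Mz := DM _ Dz; have Mw := DM _ Dw; split.
- rewrite cpowE normc_cexp (le_trans Mz)// (le_trans M4)// ler_peMr ?mulr_ge0//.
  by rewrite -addrA lerDl addr_ge0.
- rewrite normcM normc_real cpowE normc_cexp mulrC ler_pM ?expR_ge0//.
    exact: le_trans M4.
  by rewrite [1 + _]addrC -addrA lerDl addr_ge0.
- rewrite !cpowE.
  have -> : w * (ln x)%:C = z * (ln x)%:C + (w - z) * (ln x)%:C by ring.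
  rewrite [X in _ - _ - X]mulrA.
  apply: le_trans (cexp_diff2 Mz _) _.
    by rewrite (_ : _ + _ = w * (ln x)%:C)//; ring.
  rewrite normcM normc_real exprMn [normc _ ^+ 2 * _]mulrC mulrA.
  rewrite ler_wpM2r ?exprn_ge0 ?normc_ge0//.
  by rewrite ler_wpM2l ?mulr_ge0// lerDr addr_ge0.
Qed.

End QuadraticDifferentiability.

(** * Integrals of complex-valued functions of a real variable *)

Section ComplexIntegral.
Context {R : realType}.
Local Notation mu := (@lebesgue_measure R).
Implicit Types (D : set R) (f g : R -> R[i]).

Definition cmeasurable D f : Prop :=
  measurable_fun D (fun x => complex.Re (f x)) /\
  measurable_fun D (fun x => complex.Im (f x)).

Lemma cmeasurableM D f g : cmeasurable D f -> cmeasurable D g ->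
  cmeasurable D (fun x => f x * g x).
Proof.
move=> [f1 f2] [g1 g2]; split.
  under eq_fun do rewrite cReM.
  by apply: measurable_funB; apply: measurable_funM.
under eq_fun do rewrite cImM.
by apply: measurable_funD; apply: measurable_funM.
Qed.

Lemma cmeasurable_real D (h : R -> R) : measurable_fun D h ->
  cmeasurable D (fun x => (h x)%:C).
Proof. by move=> mh; split => //=; exact: measurable_cst. Qed.

Lemma cmeasurable_cst D (a : R[i]) : cmeasurable D (fun=> a).
Proof. by split; exact: measurable_cst. Qed.

Lemma cmeasurable_cpow D (h : R -> R) (s : R[i]) : measurable_fun D h ->
  cmeasurable D (fun x => cpow (h x) s).
Proof.
move=> mh.
have ml : measurable_fun D (fun x => ln (h x)).
  by apply: measurableT_comp mh => //; exact: measurable_ln.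
have mk (c : R) : measurable_fun D (fun x => c * ln (h x)).
  by apply: measurable_funM => //; exact: measurable_cst.
split; rewrite /cpow /=; apply: measurable_funM.
- by apply: measurableT_comp (mk _) => //; exact: measurable_expR.
- apply: measurableT_comp (mk _).
  by apply: continuous_measurable_fun; exact: continuous_cos.
- by apply: measurableT_comp (mk _) => //; exact: measurable_expR.
- apply: measurableT_comp (mk _).
  by apply: continuous_measurable_fun; exact: continuous_sin.
Qed.

Lemma eq_cintegral D f g : (forall x, D x -> f x = g x) ->
  cintegral D f = cintegral D g.
Proof.
move=> fg; apply: complex_eq; rewrite /cintegral /=;
  by apply: eq_Rintegral => x /[!inE] Dx; rewrite fg.
Qed.

Lemma eq_cintegrable D f g : measurable D -> (forall x, D x -> f x = g x) ->
  cintegrable D f -> cintegrable D g.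
Proof.
move=> mD fg [h1 h2]; split.
  by apply: eq_integrable h1 => // x /[!inE] Dx /=; rewrite fg.
by apply: eq_integrable h2 => // x /[!inE] Dx /=; rewrite fg.
Qed.

Lemma integrable_le D (h g : R -> R) : measurable D -> measurable_fun D h ->
  (forall x, D x -> `|h x| <= g x) -> mu.-integrable D (EFin \o g) ->
  mu.-integrable D (EFin \o h).
Proof.
move=> mD mh hg; apply: le_integrable => //.
  exact/measurable_EFinP.
by move=> x Dx /=; rewrite lee_fin (le_trans (hg _ Dx))// ler_norm.
Qed.

Lemma cintegrable_le D f (g : R -> R) : measurable D -> cmeasurable D f ->
  (forall x, D x -> normc (f x) <= g x) -> mu.-integrable D (EFin \o g) ->
  cintegrable D f.
Proof.
move=> mD [m1 m2] fg ig; split; apply: integrable_le ig => // x Dx.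
  exact: le_trans (ler_Re_normc _) (fg _ Dx).
exact: le_trans (ler_Im_normc _) (fg _ Dx).
Qed.

Lemma cintegrable_measurable D f : cintegrable D f -> cmeasurable D f.
Proof.
move=> [/integrableP[m1 _] /integrableP[m2 _]].
by split; apply/measurable_EFinP.
Qed.

Lemma cintegrable_normc D f : measurable D -> cintegrable D f ->
  mu.-integrable D (EFin \o (fun x => normc (f x))).
Proof.
move=> mD cf; have [m1 m2] := cintegrable_measurable cf; case: cf => [i1 i2].
apply: (@integrable_le _ _ (fun x => `|complex.Re (f x)| + `|complex.Im (f x)|)) => //.
- have -> : (fun x => normc (f x)) = (fun x =>
    Num.sqrt (complex.Re (f x) ^+ 2 + complex.Im (f x) ^+ 2)).
    by apply/funext => x; case: (f x).
  apply: (@measurableT_comp _ _ _ R R R (Num.sqrt : R -> R)).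
    by apply: continuous_measurable_fun; exact: sqrt_continuous.
  by apply: measurable_funD; exact: measurable_funX.
- by move=> x Dx; rewrite ger0_norm ?normc_ge0// ler_normc_ReIm.
- have -> : EFin \o (fun x => `|complex.Re (f x)| + `|complex.Im (f x)|) =
     (EFin \o (fun x => `|complex.Re (f x)|)) \+ (EFin \o (fun x => `|complex.Im (f x)|)).
    by [].
  by apply: integrableD => //; apply: integrable_norm.
Qed.

(** The factor 2 is the price of estimating the two components separately; none of the constants
    derived from it has to be sharp. *)
Lemma normc_cintegral_le D f (g : R -> R) : measurable D -> cintegrable D f ->
  (forall x, D x -> normc (f x) <= g x) -> mu.-integrable D (EFin \o g) ->
  normc (cintegral D f) <= 2 * \int[mu]_(x in D) g x.
Proof.
move=> mD [i1 i2] fg ig; apply: le_trans (ler_normc_ReIm _) _.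
rewrite mulr_natl mulr2n /cintegral /=.
apply: lerD; apply: le_trans (le_normr_Rintegral _ _) _ => //;
  apply: le_Rintegral => //; do ?exact: integrable_norm; move=> x Dx.
  exact: le_trans (ler_Re_normc _) (fg _ Dx).
exact: le_trans (ler_Im_normc _) (fg _ Dx).
Qed.

Lemma cintegrableD D f g : measurable D -> cintegrable D f -> cintegrable D g ->
  cintegrable D (fun x => f x + g x).
Proof.
move=> mD [f1 f2] [g1 g2]; split.
  rewrite (_ : _ \o _ = (EFin \o (fun x => complex.Re (f x))) \+
    (EFin \o (fun x => complex.Re (g x)))); first exact: integrableD.
  by apply/funext => x /=; rewrite cReD.
rewrite (_ : _ \o _ = (EFin \o (fun x => complex.Im (f x))) \+
    (EFin \o (fun x => complex.Im (g x)))); first exact: integrableD.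
by apply/funext => x /=; rewrite cImD.
Qed.

Lemma integrableZl_fin D (k : R) (h : R -> R) : measurable D ->
  mu.-integrable D (EFin \o h) -> mu.-integrable D (EFin \o (fun x => k * h x)).
Proof.
move=> mD ih; rewrite (_ : _ \o _ = (fun x => k%:E * (EFin \o h) x)%E)//.
exact: integrableZl.
Qed.

Lemma cintegrableZ D (a : R[i]) f : measurable D -> cintegrable D f ->
  cintegrable D (fun x => a * f x).
Proof.
move=> mD if_; apply: (@cintegrable_le _ _ (fun x => normc a * normc (f x))) => //.
- by apply: cmeasurableM; [exact: cmeasurable_cst|exact: cintegrable_measurable].
- by move=> x _; rewrite normcM.
- exact/integrableZl_fin/cintegrable_normc.
Qed.

Lemma cintegralD D f g : measurable D -> cintegrable D f -> cintegrable D g ->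
  cintegral D (fun x => f x + g x) = cintegral D f + cintegral D g.
Proof.
move=> mD [f1 f2] [g1 g2]; apply: complex_eq; rewrite /cintegral /=.
  by rewrite -RintegralD//; apply: eq_Rintegral => x _; rewrite cReD.
by rewrite -RintegralD//; apply: eq_Rintegral => x _; rewrite cImD.
Qed.

Lemma cintegralZ D (a : R[i]) f : measurable D -> cintegrable D f ->
  cintegral D (fun x => a * f x) = a * cintegral D f.
Proof.
move=> mD [f1 f2]; apply: complex_eq; rewrite ?(cReM, cImM) /cintegral /=.
  rewrite -!RintegralZl// -RintegralB//; try exact: integrableZl_fin.
  by apply: eq_Rintegral => x _; rewrite cReM.
rewrite -!RintegralZl// -RintegralD//; try exact: integrableZl_fin.
by apply: eq_Rintegral => x _; rewrite cImM.
Qed.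

Lemma cintegralZr D (a : R[i]) f : measurable D -> cintegrable D f ->
  cintegral D (fun x => f x * a) = cintegral D f * a.
Proof.
move=> mD h; rewrite mulrC -cintegralZ//.
by apply: eq_cintegral => x _; rewrite mulrC.
Qed.

Lemma cintegralB D f g : measurable D -> cintegrable D f -> cintegrable D g ->
  cintegral D (fun x => f x - g x) = cintegral D f - cintegral D g.
Proof.
move=> mD h1 h2; rewrite -[in RHS]mulN1r -cintegralZ// -cintegralD//.
  by apply: eq_cintegral => x _; rewrite mulN1r.
exact: cintegrableZ.
Qed.

Lemma cintegrableB D f g : measurable D -> cintegrable D f -> cintegrable D g ->
  cintegrable D (fun x => f x - g x).
Proof.
move=> mD h1 h2.
apply: (@eq_cintegrable _ (fun x => f x + (-1) * g x)) => //.
  by move=> x _; rewrite mulN1r.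
by apply: cintegrableD => //; exact: cintegrableZ.
Qed.

Lemma cintegral_real D (h : R -> R) :
  cintegral D (fun x => (h x)%:C) = (\int[mu]_(x in D) h x)%:C.
Proof.
by rewrite /cintegral /=; congr (_ +i* _); rewrite /Rintegral integral0.
Qed.

Lemma cintegral_mkcond D f :
  cintegral D f = cintegral setT (fun x => (\1_D x)%:C * f x).
Proof.
apply: complex_eq; rewrite /cintegral /= Rintegral_mkcond;
  apply: eq_Rintegral => x _; rewrite ?cReM ?cImM indicE /patch /=;
  by case: ifP => _; rewrite /= ?(mul0r, mul1r, subr0, addr0).
Qed.

End ComplexIntegral.

(** * Improper integrals and the fundamental theorem of calculus *)

Section Calculus.
Context {R : realType}.
Local Notation mu := (@lebesgue_measure R).
Implicit Types (f F : R -> R[i]) (h H : R -> R).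

Lemma FTC_segment (H h : R -> R) (a b : R) : a < b ->
  (forall x, a <= x <= b -> is_derive x 1 H (h x)) ->
  (forall x, a <= x <= b -> {for x, continuous h}) ->
  mu.-integrable `[a, b] (EFin \o h) /\
  \int[mu]_(x in `[a, b]) h x = H b - H a.
Proof.
move=> ab dH ch.
have wh : {within `[a, b], continuous h}.
  apply: continuous_in_subspaceT => x /[!inE] /=; rewrite in_itv/=; exact: ch.
have cH x : a <= x <= b -> H @ x --> H x.
  move=> /dH Hx; apply: differentiable_continuous; apply/derivable1_diffP.
  by case: Hx.
split; first by apply: continuous_compact_integrable => //; exact: segment_compact.
rewrite /Rintegral (@continuous_FTC2 _ h H)//.
  split.
  - move=> x; rewrite in_itv/= => /andP[ax xb].
    by have [] : is_derive x 1 H (h x) by apply: dH; rewrite !ltW.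
  - by apply: cvg_at_right_filter; apply: cH; rewrite lexx ltW.
  - by apply: cvg_at_left_filter; apply: cH; rewrite lexx ltW.
move=> x; rewrite in_itv/= => /andP[ax xb].
have Hx : is_derive x 1 H (h x) by apply: dH; rewrite !ltW.
by rewrite derive1E derive_val.
Qed.

Lemma EFin_Rintegral (D : set R) h : measurable D -> mu.-integrable D (EFin \o h) ->
  (\int[mu]_(x in D) (h x)%:E)%E = (\int[mu]_(x in D) h x)%:E.
Proof.
move=> mD ih; rewrite /Rintegral fineK//.
by apply: (@integrable_fin_num _ _ _ mu D).
Qed.

Lemma cvg_integral_exhaustion (A : (set R)^nat) (D : set R) (h : R -> R) :
  nondecreasing_seq A -> (forall n, measurable (A n)) ->
  \bigcup_n A n = D -> mu.-integrable D (EFin \o h) ->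
  \int[mu]_(x in A n) h x @[n --> \oo] --> \int[mu]_(x in D) h x.
Proof.
move=> ndA mA AD ih.
have mD : measurable D by rewrite -AD; exact: bigcup_measurable.
have mh : measurable_fun D h by apply/measurable_EFinP; case/integrableP : ih.
have sAD n : A n `<=` D by rewrite -AD; exact: bigcup_sup.
have [| | | | |_ _ cv] := @dominated_convergence _ _ R mu D mD
  (fun n x => (h x * \1_(A n) x)%:E) (EFin \o h) (EFin \o (fun x => `|h x|)).
- move=> n; apply/measurable_EFinP; apply: measurable_funM => //.
  by apply: measurable_indic; exact: mA.
- exact/measurable_EFinP.
- apply: aeW => x /=; rewrite -AD => -[m _ Am].
  apply: cvg_near_cst; exists m => // n /= mn.
  by rewrite indicE mem_set ?mulr1//; move/subsetPset : (ndA _ _ mn); apply.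
- exact: integrable_norm.
- apply: aeW => x n Dx /=; rewrite lee_fin normrM indicE.
  by case: (x \in A n); rewrite /= ?normr1 ?normr0 ?mulr1 ?mulr0.
have e n : (\int[mu]_(x in D) (h x * \1_(A n) x)%:E)%E =
           (\int[mu]_(x in A n) h x)%:E.
  rewrite -EFin_Rintegral; [|exact: mA|]; last first.
    by apply: (@integrableS _ _ _ mu D (A n)) => //; exact: mA.
  rewrite -[in RHS](setIidr (sAD n)) integral_mkcondr.
  apply: eq_integral => x _; rewrite /patch indicE.
  by case: (x \in A n); rewrite ?mulr1 ?mulr0.
have fD : (\int[mu]_(x in D) (h x)%:E)%E \is a fin_num by exact: integrable_fin_num.
move: cv; rewrite -(fineK fD); under eq_fun do rewrite e.
by move/fine_cvgP => [_].
Qed.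

(** Monotone convergence turns a bound uniform in n into integrability on the union. *)
Lemma integrable_exhaustion (A : (set R)^nat) (D : set R) (h : R -> R) (B : R) :
  nondecreasing_seq A -> (forall n, measurable (A n)) ->
  \bigcup_n A n = D -> measurable_fun D h -> (forall x, D x -> 0 <= h x) ->
  (forall n, mu.-integrable (A n) (EFin \o h) /\ \int[mu]_(x in A n) h x <= B) ->
  mu.-integrable D (EFin \o h) /\ \int[mu]_(x in D) h x <= B.
Proof.
move=> ndA mA AD mh h0 hB.
have mD : measurable D by rewrite -AD; exact: bigcup_measurable.
have sAD n : A n `<=` D by rewrite -AD; exact: bigcup_sup.
have := @ge0_nondecreasing_set_cvg_integral _ (measurableTypeR R) R A (EFin \o h) mu ndA mA.
have mhA i : measurable_fun (A i) (EFin \o h).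
  by apply/measurable_EFinP; apply: measurable_funS mh.
have h0A i x : A i x -> (0 <= (EFin \o h) x)%E.
  by move=> Ax; rewrite lee_fin h0//; exact: sAD Ax.
move=> /(_ mhA h0A); rewrite AD => cv.
have le : (\int[mu]_(x in D) (h x)%:E <= B%:E)%E.
  apply: (cvge_le _ cv); apply: nearW => n.
  have [i1 i2] := hB n; rewrite -lee_fin in i2.
  by apply: le_trans i2; rewrite -EFin_Rintegral//; exact: mA.
have ih : mu.-integrable D (EFin \o h).
  apply/integrableP; split; first exact/measurable_EFinP.
  apply: le_lt_trans (ltry B); apply: le_trans le.
  rewrite le_eqVlt; apply/orP; left; apply/eqP; apply: eq_integral => x /[!inE] Dx.
  by rewrite /= ger0_norm ?h0.
by split=> //; rewrite -lee_fin -EFin_Rintegral.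
Qed.

Definition cderive F (x : R) (d : R[i]) : Prop :=
  is_derive x 1 (fun u => complex.Re (F u)) (complex.Re d) /\
  is_derive x 1 (fun u => complex.Im (F u)) (complex.Im d).

Definition ccontinuous_at f (x : R) : Prop :=
  {for x, continuous (fun u => complex.Re (f u))} /\
  {for x, continuous (fun u => complex.Im (f u))}.

Lemma cderive_eq F x d d' : cderive F x d -> d = d' -> cderive F x d'.
Proof. by move=> h <-. Qed.

Lemma is_derive_continuous_at (h : R -> R) (x d : R) :
  is_derive x 1 h d -> {for x, continuous h}.
Proof.
move=> hd; apply: differentiable_continuous; apply/derivable1_diffP.
by case: hd.
Qed.

Lemma cderive_continuous F x d : cderive F x d -> ccontinuous_at F x.
Proof. by move=> [h1 h2]; split; exact: is_derive_continuous_at. Qed.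

Lemma cderive_cst (a : R[i]) (x : R) : cderive (fun=> a) x 0.
Proof. by split; exact: is_derive_cst. Qed.

Lemma cderive_real h (x d : R) : is_derive x 1 h d -> cderive (fun u => (h u)%:C) x d%:C.
Proof. by move=> hd; split => //=; exact: is_derive_cst. Qed.

Lemma cderiveM F G x d e : cderive F x d -> cderive G x e ->
  cderive (fun u => F u * G u) x (F x * e + d * G x).
Proof.
move=> [F1 F2] [G1 G2]; split.
  rewrite (_ : (fun u => _) = (fun u => complex.Re (F u)) * (fun u => complex.Re (G u))
    - (fun u => complex.Im (F u)) * (fun u => complex.Im (G u))); last first.
    by apply/funext => u; rewrite cReM.
  by apply: is_derive_eq; rewrite !cReImE /GRing.scale /=; ring.
rewrite (_ : (fun u => _) = (fun u => complex.Re (F u)) * (fun u => complex.Im (G u))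
    + (fun u => complex.Im (F u)) * (fun u => complex.Re (G u))); last first.
  by apply/funext => u; rewrite cImM.
by apply: is_derive_eq; rewrite !cReImE /GRing.scale /=; ring.
Qed.

Lemma cderiveD F G x d e : cderive F x d -> cderive G x e ->
  cderive (fun u => F u + G u) x (d + e).
Proof.
move=> [F1 F2] [G1 G2]; split.
  rewrite (_ : (fun u => _) = (fun u => complex.Re (F u)) + (fun u => complex.Re (G u))).
    by apply: is_derive_eq; rewrite !cReImE.
  by apply/funext => u; rewrite cReD.
rewrite (_ : (fun u => _) = (fun u => complex.Im (F u)) + (fun u => complex.Im (G u))).
  by apply: is_derive_eq; rewrite !cReImE.
by apply/funext => u; rewrite cImD.
Qed.

Lemma cderiveZ F x d (a : R[i]) : cderive F x d -> cderive (fun u => a * F u) x (a * d).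
Proof.
move=> Fd; apply: cderive_eq (cderiveM (cderive_cst a x) Fd) _.
by rewrite mul0r addr0.
Qed.

Lemma cderive_cpow (s : R[i]) (x : R) : 0 < x ->
  cderive (fun u => cpow u s) x (s * cpow x (s - 1)).
Proof.
move=> x0.
have -> : s * cpow x (s - 1) = (s * cpow x s) * (x^-1)%:C.
  have -> : (x^-1)%:C = cpow x (- 1).
    by rewrite -realCN cpow_real// powR_inv1 ?ltW.
  by rewrite cpowD mulrA.
have ln_x : is_derive x 1 (@ln R) (x^-1) by exact: is_derive1_ln.
have key a : is_derive x 1 (fun u => complex.Re (a * cpow u s))
    (complex.Re (a * (s * cpow x s * (x^-1)%:C))).
  have -> : (fun u => complex.Re (a * cpow u s)) =
     (fun v : R => complex.Re (a * cexp (0 + v%:C * s))) \o (@ln R).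
    by apply/funext => u /=; rewrite add0r cpowE mulrC [_%:C * s]mulrC [a * _]mulrC.
  have d1 := is_derive_Recexp a 0 s (ln x).
  have := @is_derive1_comp R _ _ x _ _ d1 ln_x.
  move=> h; apply: (@is_derive_eq _ _ _ _ _ _ _ _ h).
  by rewrite add0r cpowE [_%:C * s]mulrC !mulrA [RHS]cReM /= mulr0 subr0.
split; first by have := key 1; under eq_fun do rewrite mul1r; rewrite mul1r.
have := key (- 'i).
have e z : complex.Re (- 'i * z) = complex.Im z :> R.
  by rewrite cReM /= oppr0 mul0r sub0r mulNr mul1r opprK.
by under eq_fun do rewrite e; rewrite e.
Qed.

Lemma cFTC_segment F f (a b : R) : a < b ->
  (forall x, a <= x <= b -> cderive F x (f x)) ->
  (forall x, a <= x <= b -> ccontinuous_at f x) ->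
  cintegrable `[a, b] f /\ cintegral `[a, b] f = F b - F a.
Proof.
move=> ab dF cf.
have [i1 e1] := @FTC_segment _ (fun x => complex.Re (f x)) a b ab
  (fun x xab => proj1 (dF x xab)) (fun x xab => proj1 (cf x xab)).
have [i2 e2] := @FTC_segment _ (fun x => complex.Im (f x)) a b ab
  (fun x xab => proj2 (dF x xab)) (fun x xab => proj2 (cf x xab)).
split=> //; apply: complex_eq; rewrite !cReImE /cintegral/=.
  exact: e1.
exact: e2.
Qed.

Definition ccvg (u : nat -> R[i]) (l : R[i]) : Prop :=
  (fun n => normc (u n - l)) @ \oo --> (0 : R).

Lemma ccvg_unique u l l' : ccvg u l -> ccvg u l' -> l = l'.
Proof.
move=> ul ul'; apply/eqP; rewrite -subr_eq0 -[_ == 0]negbK -normc_gt0 -leNgt.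
have h : (fun n => normc (u n - l') + normc (u n - l)) @ \oo --> (0 + 0 : R).
  exact: cvgD.
rewrite -[X in _ <= X](addr0 0); apply: (cvgr_to_ge h).
apply: nearW => n; rewrite (_ : l - l' = (u n - l') - (u n - l)); last by ring.
exact: ler_normcB.
Qed.

Lemma ccvg_of_ReIm (u : nat -> R[i]) l :
  (fun n => complex.Re (u n)) @ \oo --> complex.Re l ->
  (fun n => complex.Im (u n)) @ \oo --> complex.Im l -> ccvg u l.
Proof.
move=> h1 h2; rewrite /ccvg.
apply: (@squeeze_cvgr _ _ _ _ (fun=> 0) (fun n => `|complex.Re (u n) - complex.Re l| +
   `|complex.Im (u n) - complex.Im l|)).
- apply: nearW => n; rewrite normc_ge0 /=.
  by apply: le_trans (ler_normc_ReIm _) _; rewrite !cReImE.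
- exact: cvg_cst.
- rewrite -[X in _ --> X](addr0 0); apply: cvgD.
    rewrite -(normr0 R); apply: cvg_norm; rewrite -(subrr (complex.Re l)).
    by apply: cvgB => //; exact: cvg_cst.
  rewrite -(normr0 R); apply: cvg_norm; rewrite -(subrr (complex.Im l)).
  by apply: cvgB => //; exact: cvg_cst.
Qed.

Lemma ccvgB u w l m : ccvg u l -> ccvg w m -> ccvg (fun n => u n - w n) (l - m).
Proof.
move=> ul wm; rewrite /ccvg.
apply: (@squeeze_cvgr _ _ _ _ (fun=> 0) (fun n => normc (u n - l) + normc (w n - m))).
- apply: nearW => n; rewrite normc_ge0 /=.
  rewrite (_ : u n - w n - (l - m) = (u n - l) - (w n - m)); last by ring.
  exact: ler_normcB.
- exact: cvg_cst.
- by rewrite -[X in _ --> X](addr0 0); apply: cvgD.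
Qed.

Lemma ccvg0 (u : nat -> R[i]) : (fun n => normc (u n)) @ \oo --> (0 : R) -> ccvg u 0.
Proof. by rewrite /ccvg; under [in X in _ -> X]eq_fun do rewrite subr0. Qed.

Lemma ccvg_cst (a : R[i]) : ccvg (fun=> a) a.
Proof. by rewrite /ccvg; under eq_fun do rewrite subrr normc0; exact: cvg_cst. Qed.

Lemma ccvg_exhaustion (A : (set R)^nat) (D : set R) f :
  nondecreasing_seq A -> (forall n, measurable (A n)) ->
  \bigcup_n A n = D -> cintegrable D f ->
  ccvg (fun n => cintegral (A n) f) (cintegral D f).
Proof.
move=> ndA mA AD [i1 i2]; apply: ccvg_of_ReIm; rewrite /cintegral /=.
  exact: cvg_integral_exhaustion i1.
exact: cvg_integral_exhaustion i2.
Qed.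

(** The primitive may be singular at the ends of [D]: the theorem is applied on the segments
    [a n, b n] only, and just the limits of [F] along the two sequences enter. *)
Lemma improper_cFTC (a b : nat -> R) (D : set R) F f (l0 l1 : R[i]) :
  (forall n, a n < b n) -> {homo a : n m / (n <= m)%N >-> m <= n} ->
  {homo b : n m / (n <= m)%N >-> n <= m} -> \bigcup_n `[a n, b n]%classic = D ->
  (forall x, D x -> cderive F x (f x)) -> (forall x, D x -> ccontinuous_at f x) ->
  cintegrable D f -> ccvg (F \o a) l0 -> ccvg (F \o b) l1 ->
  cintegral D f = l1 - l0.
Proof.
move=> ab ha hb abD dF cf if_ F0 F1.
apply: (@ccvg_unique (fun n => cintegral `[a n, b n]%classic f)).
  apply: ccvg_exhaustion => //.
  move=> n m nm; apply/subsetPset => x /=; rewrite !in_itv/= => /andP[h1 h2].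
  by rewrite (le_trans (ha _ _ nm) h1) (le_trans h2 (hb _ _ nm)).
have sD n x : a n <= x <= b n -> D x by rewrite -abD => xab; exists n.
under [X in ccvg X]funext => n do
  rewrite (proj2 (cFTC_segment (ab n) (fun x xab => dF x (sD n x xab))
    (fun x xab => cf x (sD n x xab)))).
exact: ccvgB.
Qed.

(** For a nonnegative integrand a primitive of bounded oscillation is enough; its limits at the ends
    need not be known. *)
Lemma improper_integrable (a b : nat -> R) (D : set R) H h (B : R) :
  (forall n, a n < b n) -> {homo a : n m / (n <= m)%N >-> m <= n} ->
  {homo b : n m / (n <= m)%N >-> n <= m} -> \bigcup_n `[a n, b n]%classic = D ->
  (forall x, D x -> is_derive x 1 H (h x)) ->
  (forall x, D x -> {for x, continuous h}) ->
  measurable_fun D h -> (forall x, D x -> 0 <= h x) ->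
  (forall x y, D x -> D y -> H x - H y <= B) ->
  mu.-integrable D (EFin \o h) /\ \int[mu]_(x in D) h x <= B.
Proof.
move=> ab ha hb abD dH ch mh h0 HB.
have sD n x : a n <= x <= b n -> D x by rewrite -abD => xab; exists n.
apply: (@integrable_exhaustion (fun n => `[a n, b n]%classic)) => //.
  move=> n m nm; apply/subsetPset => x /=; rewrite !in_itv/= => /andP[h1 h2].
  by rewrite (le_trans (ha _ _ nm) h1) (le_trans h2 (hb _ _ nm)).
move=> n.
have [ih ->] := FTC_segment (ab n) (fun x xab => dH x (sD n x xab))
  (fun x xab => ch x (sD n x xab)).
split=> //; apply: HB; apply: (sD n); by rewrite lexx ltW.
Qed.

(** Starting from 2 keeps every segment nondegenerate: the one for n = 0 is [1/2, 2]. *)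
Lemma bigcup_itv0y : \bigcup_n `[(n.+2%:R)^-1, n.+2%:R]%classic = `]0, +oo[%classic :> set R.
Proof.
apply/seteqP; split => x /=.
  move=> [n _] /=; rewrite !in_itv/= andbT => /andP[h _].
  by apply: lt_le_trans h; rewrite invr_gt0 ltr0n.
rewrite in_itv/= andbT => x0.
exists (maxn (Num.truncn x) (Num.truncn x^-1)) => //=; rewrite in_itv/=.
apply/andP; split.
  rewrite -[leRHS]invrK lef_pV2 ?posrE ?invr_gt0 ?ltr0n//.
  rewrite (le_trans (ltW (truncnS_gt _)))// ler_nat ltnS.
  exact: leq_trans (leq_maxr _ _) (leqnSn _).
rewrite (le_trans (ltW (truncnS_gt _)))// ler_nat ltnS.
exact: leq_trans (leq_maxl _ _) (leqnSn _).
Qed.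

Lemma bigcup_itv0c (X : R) : 0 < X ->
  \bigcup_n `[X / n.+2%:R, X]%classic = `]0, X]%classic :> set R.
Proof.
move=> X0; apply/seteqP; split => x /=.
  move=> [n _] /=; rewrite !in_itv/= => /andP[h ->]; rewrite andbT.
  by apply: lt_le_trans h; rewrite divr_gt0 ?ltr0n.
rewrite in_itv/= => /andP[x0 xX].
exists (Num.truncn (X / x)) => //=; rewrite in_itv/= xX andbT.
rewrite ler_pdivrMr ?ltr0n// mulrC -ler_pdivrMr//.
by rewrite (le_trans (ltW (truncnS_gt _)))// ler_nat ltnS.
Qed.

Lemma homo_invS2 : {homo (fun n => (n.+2%:R : R)^-1) : n m / (n <= m)%N >-> m <= n}.
Proof. by move=> n m nm; rewrite lef_pV2 ?posrE ?ltr0n// ler_nat !ltnS. Qed.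

Lemma cvg_divS2 (X : R) : (fun n => X / n.+2%:R) @ \oo --> (0 : R).
Proof.
rewrite -[X in _ --> X](mulr0 X); apply: cvgM; first exact: cvg_cst.
by have := @cvg_harmonic R; rewrite -(cvg_shiftS (@harmonic R)).
Qed.

End Calculus.

Lemma is_derive1_ext (R : realType) (f g : R -> R) (x a b : R) :
  is_derive x 1 f a -> f =1 g -> a = b -> is_derive x 1 g b.
Proof. by move=> h /funext <- <-. Qed.

Lemma ltr_invS2 (R : realType) n : (n.+2%:R^-1 : R) < n.+2%:R.
Proof.
by apply: (@lt_trans _ _ 1); rewrite ?invf_lt1 ?ltr0n ?ltr1n.
Qed.

Lemma homo_S2 (R : realType) :
  {homo (fun n => n.+2%:R : R) : n m / (n <= m)%N >-> n <= m}.
Proof. by move=> n m nm; rewrite ler_nat !ltnS. Qed.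

(** * Convergence of Euler's integral *)

Section EulerIntegral.
Context {R : realType}.
Local Notation mu := (@lebesgue_measure R).
Local Notation Dp := (`]0, +oo[%classic : set R).
Implicit Types (u x y s : R) (z w : R[i]).

Lemma measurable_Dp : measurable (`]0, +oo[%classic : set R).
Proof. exact: measurable_itv. Qed.

Lemma DpP u : Dp u <-> 0 < u.
Proof. by rewrite /= in_itv/= andbT. Qed.

(** The exponential series of u / 2 has a term of integer degree n > s, which dominates u^s for u >=
    1. *)
Lemma expR_mul_ln_le (s : R) : exists2 K : R, 0 <= K &
  forall u, 1 <= u -> expR (s * ln u) <= K * expR (u / 2).
Proof.
pose n := (Num.truncn s).+1.
exists (n`!%:R * 2 ^+ n); first by rewrite mulr_ge0// exprn_ge0.
move=> u u1; have u0 : 0 < u by apply: lt_le_trans u1.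
apply: (@le_trans _ _ (u ^+ n)).
  rewrite -powR_mulrn ?(ltW u0)// /powR gt_eqF// ler_expR ler_wpM2r ?ln_ge0//.
  exact/ltW/truncnS_gt.
have u20 : 0 <= u / 2 by rewrite divr_ge0// ltW.
have := expR_ge1Dxn (Num.truncn s) u20; rewrite -/n => h.
have -> : u ^+ n = n`!%:R * 2 ^+ n * ((u / 2) ^+ n / n`!%:R).
  rewrite expr_div_n; field.
  by rewrite pnatr_eq0 -lt0n fact_gt0 expf_neq0.
by rewrite ler_wpM2l ?mulr_ge0 ?exprn_ge0//; apply: le_trans h; rewrite lerDr.
Qed.

(** Modulus of the integrand of Gamma at points of real part s. Powers are written with [expR] and
    [ln] so that exponents combine additively. *)
Definition gker s u : R := expR (- u) * expR ((s - 1) * ln u).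

Lemma gker_ge0 s u : 0 <= gker s u.
Proof. by rewrite mulr_ge0 ?expR_ge0. Qed.

Lemma measurable_gker s D : measurable_fun D (gker s).
Proof.
apply: (@measurable_funS _ _ _ _ setT) => //.
apply: measurable_funM.
  by apply: measurableT_comp => //.
apply: measurableT_comp; first exact: measurable_expR.
exact: measurable_funM.
Qed.

Lemma gker_mul s u (n : nat) : 0 < u -> gker s u * u ^+ n = gker (s + n%:R) u.
Proof.
move=> u0; rewrite /gker -mulrA; congr (_ * _).
have -> : u ^+ n = expR (n%:R * ln u) by rewrite expRM_natl lnK.
by rewrite -expRD; congr expR; ring.
Qed.

Lemma gker_add s u : 0 < u -> gker (s + 1) u = gker s u * u.
Proof. by move=> u0; rewrite -(gker_mul s 1 u0) expr1. Qed.

(** Comparison with [h], the derivative of the bounded function -1 / (s (1 + u^s)). Near 0 it has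
    the order u^(s-1) of the integrand; at infinity it decays only like u^(-s-1), which the
    exponential beats. Both ends are settled by one primitive. *)
Lemma integrable_gker s : 0 < s -> mu.-integrable Dp (EFin \o gker s).
Proof.
move=> s0.
pose W u := expR (s * ln u).
pose h u := W u / u / (1 + W u) ^+ 2.
pose H u := - (s^-1 * (1 + W u)^-1).
have W0 u : 0 < W u by exact: expR_gt0.
have W10 u : 0 < 1 + W u by rewrite addr_gt0.
have dW u : 0 < u -> is_derive u 1 W (s * (W u / u)).
  move=> u0; have l : is_derive u 1 (@ln R) (u^-1) by exact: is_derive1_ln.
  have e := is_derive_expR (s * ln u).
  have l2 : is_derive u 1 (fun v => s * ln v) (s * u^-1).
    by apply: is_derive1_ext (is_deriveZ s l) _ _.
  by apply: is_derive1_ext (is_derive1_comp (g := fun v => s * ln v) e l2) _ _;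
    rewrite // /W; ring.
have dH u : Dp u -> is_derive u 1 H (h u).
  move=> /DpP u0; have dw := dW u u0.
  have d1 : is_derive u 1 (fun v => (1 + W v)^-1) (- (1 + W u) ^- 2 * (s * (W u / u))).
    have d2 : is_derive u 1 (fun v => 1 + W v) (s * (W u / u)).
      by apply: is_derive1_ext (is_deriveD (is_derive_cst (1 : R) u 1) dw) _ _; rewrite ?add0r.
    by apply: is_derive1_ext (is_deriveV (f := fun v => 1 + W v) (lt0r_neq0 (W10 u)) d2) _ _.
  apply: is_derive1_ext (is_deriveZ (- s^-1) d1) _ _.
    by move=> v; rewrite /H -mulNr.
  rewrite /h /GRing.scale/=; field.
  by rewrite gt_eqF// gt_eqF// gt_eqF.
have mW D : measurable_fun D W.
  apply: (@measurable_funS _ _ _ _ setT) => //.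
  apply: measurableT_comp; first exact: measurable_expR.
  exact: measurable_funM.
have cW u : Dp u -> {for u, continuous W}.
  by move=> /DpP /dW; exact: is_derive_continuous_at.
have ch u : Dp u -> {for u, continuous h}.
  move=> Du; have /DpP u0 := Du.
  apply: cvgM.
    by apply: cvgM; [exact: cW|apply: cvgV; rewrite ?gt_eqF//; exact: cvg_id].
  apply: cvgV; first by rewrite expf_neq0// gt_eqF.
  apply: (@continuous_comp _ _ _ (fun v => 1 + W v) (fun t => t ^+ 2)).
    by apply: cvgD; [exact: cvg_cst|exact: cW].
  exact: exprn_continuous.
have h0 u : Dp u -> 0 <= h u.
  move=> /DpP u0; rewrite /h !mulr_ge0 ?invr_ge0 ?exprn_ge0//; exact: ltW.
have mh : measurable_fun Dp h.
  apply: (@open_continuous_measurable_fun R Dp); first exact: interval_open.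
  by move=> u /[!inE] Du; exact: ch.
have HB x y : Dp x -> Dp y -> H x - H y <= 2 / s.
  move=> Dx Dy; rewrite /H opprK.
  have i1 t : 0 <= s^-1 * (1 + W t)^-1 <= s^-1.
    rewrite mulr_ge0 ?invr_ge0 ?(ltW s0) ?(ltW (W10 _))//= ler_piMr ?invr_ge0 ?(ltW s0)//.
    by rewrite invf_le1// lerDl ltW.
  have /andP[a1 a2] := i1 x; have /andP[b1 b2] := i1 y.
  lra.
have [ih _] := improper_integrable (@ltr_invS2 R) (@homo_invS2 R) (@homo_S2 R)
  bigcup_itv0y dH ch mh h0 HB.
(* The exponent is 2 s because the quotient of [gker] by [h] contains the square of 1 + u^s. *)
have [K K0 HK] := expR_mul_ln_le (2 * s).
apply: (@integrable_le _ _ _ (fun u => (4 + 4 * K) * h u)) => //.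
- exact: measurable_gker.
- move=> u /DpP u0; rewrite ger0_norm ?gker_ge0//.
  have -> : gker s u = (expR (- u) * (1 + W u) ^+ 2) * h u.
    rewrite /gker /h (_ : (s - 1) * ln u = s * ln u - ln u); last by ring.
    rewrite expRD [expR (- ln u)]expRN lnK ?posrE// -/(W u); field.
    by rewrite !gt_eqF.
  rewrite ler_wpM2r ?h0 ?DpP//.
  have [u1|u1] := leP u 1.
    apply: (@le_trans _ _ (1 * 2 ^+ 2)).
      have W1 : W u <= 1 by rewrite -expR0 ler_expR mulr_ge0_le0 ?(ltW s0)// ln_le0.
      apply: ler_pM; rewrite ?expR_ge0 ?exprn_ge0 ?(ltW (W10 u))//.
        by rewrite -expR0 ler_expR oppr_le0 ltW.
      rewrite lerXn2r ?nnegrE ?(ltW (W10 u))//; lra.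
    by rewrite mul1r -natrX lerDl mulr_ge0.
  have W1 : 1 <= W u by rewrite -expR0 ler_expR mulr_ge0 ?(ltW s0)// ln_ge0 ?(ltW u1).
  have h1 : (1 + W u) ^+ 2 <= 4 * (K * expR (u / 2)).
    apply: (@le_trans _ _ (4 * W u ^+ 2)); first nra.
    rewrite ler_wpM2l//; apply: le_trans (HK u (ltW u1)).
    by rewrite /W -expRM_natl mulrA.
  apply: (@le_trans _ _ (expR (- u) * (4 * (K * expR (u / 2))))).
    by rewrite ler_wpM2l ?expR_ge0.
  have -> : expR (- u) * (4 * (K * expR (u / 2))) = 4 * K * expR (- (u / 2)).
    rewrite (_ : - u = - (u / 2) + - (u / 2)); last by field.
    have e : expR (- (u / 2)) * expR (u / 2) = 1 by rewrite -expRD addNr expR0.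
    by rewrite expRD; ring: e.
  have : expR (- (u / 2)) <= 1 by rewrite -expR0 ler_expR oppr_le0 divr_ge0 ?(ltW u0).
  have : 0 <= 4 * K by rewrite mulr_ge0.
  nra.
- exact: integrableZl_fin.
Qed.

End EulerIntegral.

(** * The Gamma function *)

Section EulerIntegralTheory.
Context {R : realType}.
Local Notation mu := (@lebesgue_measure R).
Local Notation Dp := (`]0, +oo[%classic : set R).
Local Notation mDp := (@measurable_Dp R).
Implicit Types (u x y s : R) (z w : R[i]).

Lemma sqr_le_expR x : x ^+ 2 <= 2 * (expR x + expR (- x)).
Proof.
wlog x0 : x / 0 <= x.
  move=> h; have [/h//|x0] := leP 0 x.
  by have := h (- x); rewrite opprK oppr_ge0 sqrrN (ltW x0) addrC; exact.
have := expR_ge1Dxn 1 x0; rewrite (_ : 2`! = 2)%N// => h.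
have := expR_ge0 (- x); lra.
Qed.

Lemma gker_shift s (e : R) u : gker s u * expR (e * ln u) = gker (s + e) u.
Proof. by rewrite /gker -mulrA -expRD; congr (_ * expR _); ring. Qed.

(** A squared logarithm is paid for by an arbitrarily small power on either side, u^e + u^-e. It is
    the quadratic remainder in z of Euler's integrand that brings in this logarithm. *)
Lemma gker_ln2 s (e : R) u : 0 < e ->
  gker s u * ln u ^+ 2 <= 2 / e ^+ 2 * (gker (s + e) u + gker (s - e) u).
Proof.
move=> e0; rewrite -!gker_shift.
rewrite (_ : 2 / e ^+ 2 * _ = gker s u *
  (2 / e ^+ 2 * (expR (e * ln u) + expR (- e * ln u)))); last by ring.
rewrite ler_wpM2l ?gker_ge0//.
have := sqr_le_expR (e * ln u); rewrite -mulNr exprMn => h.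
by rewrite mulrAC ler_pdivlMr ?exprn_gt0// mulrC.
Qed.

Lemma gker_le s x y u : x <= s <= y -> gker s u <= gker x u + gker y u.
Proof.
move=> /andP[xs sy]; rewrite /gker -mulrDr ler_wpM2l ?expR_ge0//.
have [l0|l0] := leP 0 (ln u).
  apply: (@le_trans _ _ (expR ((y - 1) * ln u))); last by rewrite lerDr expR_ge0.
  by rewrite ler_expR ler_wpM2r// lerD2r.
apply: (@le_trans _ _ (expR ((x - 1) * ln u))); last by rewrite lerDl expR_ge0.
by rewrite ler_expR ler_wnM2r ?(ltW l0)// lerD2r.
Qed.

Definition Eker z u : R[i] := (expR (- u))%:C * cpow u (z - 1).

Lemma normc_Eker z u : normc (Eker z u) = gker (complex.Re z) u.
Proof.
rewrite /Eker normcM normc_real ger0_norm ?expR_ge0// normc_cpow.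
by rewrite !cReImE.
Qed.

Lemma cmeasurable_Eker z (D : set R) : cmeasurable D (Eker z).
Proof.
apply: cmeasurableM.
  apply: cmeasurable_real; apply: (@measurable_funS _ _ _ _ setT) => //.
  exact: measurableT_comp.
exact: cmeasurable_cpow.
Qed.

Lemma cintegrable_Eker z : 0 < complex.Re z -> cintegrable Dp (Eker z).
Proof.
move=> z0; apply: (cintegrable_le mDp (cmeasurable_Eker z _) _ (integrable_gker z0)).
by move=> u _; rewrite normc_Eker.
Qed.

Lemma integrable_gkerD s (e : R) : 0 < s - e -> 0 < s + e ->
  mu.-integrable Dp (EFin \o (fun u => gker (s + e) u + gker (s - e) u)).
Proof.
move=> h1 h2.
rewrite (_ : _ \o _ = (EFin \o gker (s + e)) \+ (EFin \o gker (s - e)))//.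
by apply: integrableD => //; exact: integrable_gker.
Qed.

Lemma integrable_gker_ln2 s : 0 < s ->
  mu.-integrable Dp (EFin \o (fun u => gker s u * ln u ^+ 2)).
Proof.
move=> s0; pose e := s / 2.
have e0 : 0 < e by rewrite /e divr_gt0.
apply: (@integrable_le _ _ _ (fun u => 2 / e ^+ 2 * (gker (s + e) u + gker (s - e) u)) mDp).
- apply: measurable_funM; first exact: measurable_gker.
  by apply: measurable_funX; apply: measurable_funTS; exact: measurable_ln.
- move=> u _; rewrite ger0_norm ?gker_ln2//.
  by rewrite mulr_ge0 ?gker_ge0 ?sqr_ge0.
- apply: (integrableZl_fin _ mDp); apply: integrable_gkerD; rewrite /e; lra.
Qed.

Definition gint s : R := \int[mu]_(u in Dp) gker s u.

Lemma gint_ge0 s : 0 <= gint s.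
Proof. by apply: Rintegral_ge0 => u _; exact: gker_ge0. Qed.

Lemma normc_euler z x y : 0 < x -> x <= complex.Re z <= y ->
  normc (euler_integral z) <= 2 * (gint x + gint y).
Proof.
move=> x0 /[dup] /andP[xz zy] xzy.
have y0 : 0 < y by rewrite (lt_le_trans x0)// (le_trans xz).
have z0 : 0 < complex.Re z by rewrite (lt_le_trans x0).
have ixy : mu.-integrable Dp (EFin \o (fun u => gker x u + gker y u)).
  rewrite (_ : _ \o _ = (EFin \o gker x) \+ (EFin \o gker y))//.
  by apply: integrableD => //; exact: integrable_gker.
apply: le_trans (normc_cintegral_le mDp (cintegrable_Eker z0) _ ixy) _.
  by move=> u _; rewrite normc_Eker gker_le.
by rewrite ler_wpM2l// RintegralD//; exact: integrable_gker.
Qed.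

Lemma euler_integral_real s : euler_integral s%:C = (gint s)%:C.
Proof.
rewrite /euler_integral -cintegral_real; apply: eq_cintegral => u /DpP u0.
have -> : s%:C - 1 = (s - 1)%:C :> R[i] by rewrite realCD realCN.
by rewrite cpowE -realCM cexp_real -realCM.
Qed.

Lemma ccvg0_le (u : nat -> R[i]) (v : nat -> R) :
  (forall n, normc (u n) <= v n) -> v @ \oo --> (0 : R) -> ccvg u 0.
Proof.
move=> uv v0; apply: ccvg0.
apply: (@squeeze_cvgr _ _ _ _ (fun=> 0) v) => //; last exact: cvg_cst.
by apply: nearW => n; rewrite normc_ge0 uv.
Qed.

Lemma cvg_expR_ln_0 s (X : R) : 0 < s -> 0 < X ->
  (fun n => expR (s * ln (X / n.+2%:R))) @ \oo --> (0 : R).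
Proof.
move=> s0 X0; apply/cvgrPdist_lt => e e0.
have d0 : 0 < expR (ln e / s) by exact: expR_gt0.
have := @cvg_divS2 R X => /cvgrPdist_lt /(_ _ d0); apply: filterS => n.
have x0 : 0 < X / n.+2%:R by rewrite divr_gt0 ?ltr0n.
rewrite !sub0r !normrN !ger0_norm ?expR_ge0 ?(ltW x0)// => h.
rewrite -[ltRHS](lnK (x := e)) ?posrE// ltr_expR mulrC -ltr_pdivlMr//.
by rewrite -ltr_expR lnK ?posrE.
Qed.

(** Integration by parts: e^-u u^z has derivative z e^-u u^(z-1) - e^-u u^z and tends to 0 at both
    ends. *)
Lemma euler_integralS z : 0 < complex.Re z ->
  euler_integral (z + 1) = z * euler_integral z.
Proof.
move=> z0.
have z10 : 0 < complex.Re (z + 1) by rewrite cReD addr_gt0.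
apply/eqP; rewrite eq_sym -subr_eq0; apply/eqP.
rewrite /euler_integral -/(Eker z) -/(Eker (z + 1)).
have iz := cintegrable_Eker z0; have iz1 := cintegrable_Eker z10.
have izz := cintegrableZ z mDp iz.
rewrite -cintegralZ// -cintegralB//.
rewrite -[RHS](subrr 0).
pose F u : R[i] := (expR (- u))%:C * cpow u z.
have dE u : is_derive u 1 (fun v : R => expR (- v)) (- expR (- u)).
  by apply: is_derive1_ext (is_derive1_comp (g := -%R) (is_derive_expR (- u))
     (is_deriveNid u 1)) _ _ => //; rewrite mulrN1.
have dF u : Dp u -> cderive F u (z * Eker z u - Eker (z + 1) u).
  move=> /DpP u0.
  have := cderiveM (cderive_real (dE u)) (cderive_cpow z u0).
  move/cderive_eq; apply; rewrite /Eker addrK realCN; ring.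
apply: (@improper_cFTC R (fun n => n.+2%:R^-1) (fun n => n.+2%:R) Dp F).
- exact: ltr_invS2.
- exact: homo_invS2.
- exact: homo_S2.
- exact: bigcup_itv0y.
- exact: dF.
- move=> u /DpP u0; apply: (@cderive_continuous _ _ _ _); last first.
    apply: cderiveD.
      apply: cderiveZ; apply: cderiveM; first exact: cderive_real (dE u).
      exact: cderive_cpow.
    rewrite (_ : (fun v => - Eker (z + 1) v) = (fun v => -1 * Eker (z + 1) v)).
      apply: cderiveZ; apply: cderiveM; first exact: cderive_real (dE u).
      exact: cderive_cpow.
    by apply/funext => v; rewrite mulN1r.
- exact: cintegrableB.
- apply: (@ccvg0_le _ (fun n => expR (complex.Re z * ln (1 / n.+2%:R)))); last first.
    exact: cvg_expR_ln_0.
  move=> n; rewrite -[(F \o _) n]/(F (n.+2%:R^-1)) /F normcM normc_real normc_cpow div1r ger0_norm ?expR_ge0//.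
  by rewrite ler_piMl ?expR_ge0// -expR0 ler_expR oppr_le0 invr_ge0.
- have [K K0 HK] := expR_mul_ln_le (complex.Re z).
  apply: (@ccvg0_le _ (fun n => K * (2 / n.+2%:R))); last first.
    rewrite -[X in _ --> X](mulr0 K); apply: cvgM; first exact: cvg_cst.
    exact: cvg_divS2.
  move=> n; rewrite -[(F \o _) n]/(F n.+2%:R) /F normcM normc_real normc_cpow ger0_norm ?expR_ge0//.
  have n1 : 1 <= n.+2%:R :> R by rewrite ler1n.
  have n0 : 0 < n.+2%:R :> R by rewrite ltr0n.
  apply: (@le_trans _ _ (expR (- n.+2%:R) * (K * expR (n.+2%:R / 2)))).
    by rewrite ler_wpM2l ?expR_ge0 ?HK.
  rewrite mulrCA ler_wpM2l// -expRD.
  have -> : - n.+2%:R + n.+2%:R / 2 = - (n.+2%:R / 2) :> R by field.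
  rewrite expRN -[leRHS]invrK lef_pV2 ?posrE ?expR_gt0 ?invr_gt0 ?divr_gt0//.
  rewrite invfM invrK mulrC.
  by apply: le_trans (expR_ge1Dx _); rewrite lerDr.
Qed.

Lemma gintS s : 0 < s -> gint (s + 1) = s * gint s.
Proof.
by move=> s0; apply: complexI; rewrite realCM -!euler_integral_real realCD euler_integralS.
Qed.

Lemma gint_gt0 s : 0 < s -> 0 < gint s.
Proof.
move=> s0.
pose c := expR (-2) * expR (- `|s - 1| * ln 2).
have c0 : 0 < c by rewrite mulr_gt0 ?expR_gt0.
have m12 : measurable (`[1, 2]%classic : set R) by exact: measurable_itv.
have i12 : mu.-integrable `[1, 2] (EFin \o (fun=> c)).
  by apply: continuous_compact_integrable;
    [exact: segment_compact|apply: continuous_subspaceT => x; exact: cvg_cst].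
have s12 : `[1, 2]%classic `<=` Dp.
  by move=> u /=; rewrite !in_itv/= andbT => /andP[h _]; apply: lt_le_trans h.
have is12 : mu.-integrable `[1, 2] (EFin \o gker s).
  by apply: (@integrableS _ _ _ mu Dp) => //; exact: integrable_gker.
apply: (@lt_le_trans _ _ (\int[mu]_(u in `[1, 2]) gker s u)).
  apply: (@lt_le_trans _ _ (\int[mu]_(u in `[1, 2]) c)).
    suff -> : \int[mu]_(u in `[1, 2]) c = c * (2 - 1) by rewrite mulr_gt0// subr_gt0 ltr1n.
    transitivity (c * fine (mu `[1, 2]%classic)); first exact: Rintegral_cst.
    by rewrite lebesgue_measure_itv/= lte_fin ltr1n.
  apply: le_Rintegral => // u; rewrite /= in_itv/= => /andP[u1 u2].
  have u0 : 0 < u by apply: lt_le_trans u1.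
  have lu0 : 0 <= ln u by rewrite ln_ge0.
  apply: ler_pM; rewrite ?expR_ge0 ?ler_expR ?lerN2//.
  apply: (@le_trans _ _ (- `|s - 1| * ln u)).
    by rewrite !mulNr lerN2 ler_wpM2l// ler_ln ?posrE.
  by rewrite ler_wpM2r// lerNl -normrN ler_norm.
rewrite /gint -lee_fin -!EFin_Rintegral//; try exact: integrable_gker.
apply: ge0_subset_integral => //.
  apply/measurable_EFinP; exact: measurable_gker.
by move=> u _; rewrite lee_fin gker_ge0.
Qed.

(** Differentiation under the integral sign, the error being the quadratic remainder of the
    exponential. It costs ln^2 u, and the two edges of the strip dominate the rest uniformly. *)
Lemma is_C11_euler (D : R[i] -> Prop) x1 x2 : 0 < x1 ->
  (forall z, D z -> x1 <= complex.Re z <= x2) -> is_C11 D euler_integral.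
Proof.
move=> x10 Dx.
(* If x2 <= 0 then [D] is empty. *)
have [x20|x20] := ltP 0 x2; last first.
  exists (fun=> 0), 0 => z w /Dx /andP[h1 h2].
  by have := lt_le_trans x10 (le_trans h1 (le_trans h2 x20)); rewrite ltxx.
pose dEk z u : R[i] := (ln u)%:C * Eker z u.
pose g u := gker x1 u * ln u ^+ 2 + gker x2 u * ln u ^+ 2.
pose g1 u := gker x1 u + gker x2 u.
have ig : mu.-integrable Dp (EFin \o g).
  rewrite (_ : _ \o _ = (EFin \o (fun u => gker x1 u * ln u ^+ 2)) \+
    (EFin \o (fun u => gker x2 u * ln u ^+ 2)))//.
  by apply: integrableD => //; exact: integrable_gker_ln2.
have ig1 : mu.-integrable Dp (EFin \o g1).
  rewrite (_ : _ \o _ = (EFin \o gker x1) \+ (EFin \o gker x2))//.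
  by apply: integrableD => //; exact: integrable_gker.
have igg : mu.-integrable Dp (EFin \o (fun u => g u + g1 u)).
  rewrite (_ : _ \o _ = (EFin \o g) \+ (EFin \o g1))//.
  by apply: integrableD.
have Dz0 z : D z -> 0 < complex.Re z by move=> /Dx /andP[h _]; apply: lt_le_trans h.
have bd z u : D z -> normc (dEk z u) <= g u + g1 u.
  move=> /Dx zx; rewrite normcM normc_real normc_Eker.
  have h := gker_le u zx.
  have l1 : `|ln u| <= ln u ^+ 2 + 1.
    rewrite -[ln u ^+ 2]real_normK ?num_real//; nra.
  rewrite /g /g1 -mulrDl -/(g1 u).
  have -> : g1 u * ln u ^+ 2 + g1 u = (ln u ^+ 2 + 1) * g1 u by ring.
  by apply: ler_pM; rewrite ?gker_ge0.
have idEk z : D z -> cintegrable Dp (dEk z).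
  move=> Dz; apply: (cintegrable_le mDp _ (fun u _ => bd z u Dz) igg).
  apply: cmeasurableM; last exact: cmeasurable_Eker.
  apply: cmeasurable_real; by apply: measurable_funTS; exact: measurable_ln.
pose K := 2 * (gint x1 + gint x2) + 2 * \int[mu]_(u in Dp) (g u + g1 u)
   + 2 * \int[mu]_(u in Dp) (4 * g u).
have g0 u : 0 <= g u by rewrite /g addr_ge0// mulr_ge0 ?gker_ge0 ?sqr_ge0.
have g10 u : 0 <= g1 u by rewrite /g1 addr_ge0// ?gker_ge0.
have k1 : 0 <= 2 * (gint x1 + gint x2) by rewrite mulr_ge0 ?addr_ge0 ?gint_ge0.
have k2 : 0 <= 2 * \int[mu]_(u in Dp) (g u + g1 u).
  by rewrite mulr_ge0//; apply: Rintegral_ge0 => u _; rewrite addr_ge0.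
have k3 : 0 <= 2 * \int[mu]_(u in Dp) (4 * g u).
  by rewrite mulr_ge0//; apply: Rintegral_ge0 => u _; rewrite mulr_ge0.
exists (fun z => cintegral Dp (dEk z)), K => z w Dz Dw; split.
- apply: le_trans (normc_euler x10 (Dx _ Dz)) _.
  by rewrite /K -addrA lerDl addr_ge0.
- apply: le_trans (normc_cintegral_le mDp (idEk _ Dz) (fun u _ => bd z u Dz) igg) _.
  by rewrite /K addrAC lerDr addr_ge0.
- pose rk u := Eker w u - Eker z u - (w - z) * dEk z u.
  have iw := cintegrable_Eker (Dz0 _ Dw); have iz := cintegrable_Eker (Dz0 _ Dz).
  have -> : euler_integral w - euler_integral z - (w - z) * cintegral Dp (dEk z) =
     cintegral Dp rk.
    have izd := cintegrableZ (w - z) mDp (idEk _ Dz).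
    rewrite /rk (cintegralB mDp (cintegrableB mDp iw iz) izd).
    by rewrite (cintegralB mDp iw iz) (cintegralZ _ mDp (idEk _ Dz)).
  have irk : cintegrable Dp rk.
    apply: (cintegrableB mDp); first exact: (cintegrableB mDp).
    exact: (cintegrableZ _ mDp (idEk _ Dz)).
  pose N := normc (w - z) ^+ 2.
  have bdr u : Dp u -> normc (rk u) <= N * (4 * g u).
    move=> _.
    have -> : rk u = (expR (- u))%:C * (cexp ((z - 1) * (ln u)%:C + (w - z) * (ln u)%:C)
      - cexp ((z - 1) * (ln u)%:C) - (w - z) * (ln u)%:C * cexp ((z - 1) * (ln u)%:C)).
      rewrite /rk /dEk /Eker !cpowE.
      have -> : (w - 1) * (ln u)%:C = (z - 1) * (ln u)%:C + (w - z) * (ln u)%:C by ring.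
      ring.
    rewrite normcM normc_real ger0_norm ?expR_ge0//.
    pose M := expR ((x1 - 1) * ln u) + expR ((x2 - 1) * ln u).
    have Mb v : D v -> expR (complex.Re ((v - 1) * (ln u)%:C)) <= M.
      move=> /Dx vx; have := gker_le u vx; rewrite /gker -mulrDr ler_pM2l ?expR_gt0//.
      by rewrite cReM /= mulr0 subr0 cReD cReN /=.
    have h1 := Mb _ Dz.
    have h2 : expR (complex.Re ((z - 1) * (ln u)%:C + (w - z) * (ln u)%:C)) <= M.
      by rewrite -mulrDl (_ : z - 1 + (w - z) = w - 1) ?Mb//; ring.
    apply: le_trans (ler_wpM2l (expR_ge0 _) (cexp_diff2 h1 h2)) _.
    rewrite normcM normc_real exprMn real_normK ?num_real//.
    rewrite le_eqVlt; apply/orP; left; apply/eqP.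
    by rewrite /N /g /gker /M; ring.
  have i4 : mu.-integrable Dp (EFin \o (fun u => 4 * g u)).
    exact: (integrableZl_fin _ mDp).
  apply: le_trans (normc_cintegral_le mDp irk bdr (integrableZl_fin N mDp i4)) _.
  rewrite RintegralZl//.
  rewrite mulrCA mulrC ler_wpM2r ?exprn_ge0 ?normc_ge0//.
  by rewrite /K lerDr addr_ge0.
Qed.

End EulerIntegralTheory.

Section GammaFunction.
Context {R : realType}.
Local Notation mu := (@lebesgue_measure R).
Local Notation Dp := (`]0, +oo[%classic : set R).
Local Notation mDp := (@measurable_Dp R).
Implicit Types (u x y s : R) (z w : R[i]).

Lemma euler_shift z (n m : nat) : 0 < complex.Re z + n%:R -> (n <= m)%N ->
  euler_integral (z + m%:R) =
  (\prod_(n <= j < m) (z + j%:R)) * euler_integral (z + n%:R).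
Proof.
move=> zn; elim: m => [|m IH].
  by rewrite leqn0 => /eqP ->; rewrite big_geq// mul1r.
rewrite leq_eqVlt => /predU1P[->|]; first by rewrite big_geq// mul1r.
rewrite ltnS => nm.
rewrite -[in LHS](addn1 m) natrD addrA euler_integralS; last first.
  rewrite cReD cRe_nat; apply: lt_le_trans zn _.
  by rewrite lerD2l ler_nat.
rewrite IH// mulrA; congr (_ * _).
by rewrite big_nat_recr//= mulrC.
Qed.

(** Any shift that reaches the right half-plane computes Gamma, not only the least one of the
    definition, so a single shift can serve a whole region. *)
Lemma cGammaE z (N : nat) : 0 < complex.Re z + N%:R ->
  cGamma z = euler_integral (z + N%:R) / \prod_(0 <= j < N) (z + j%:R).
Proof.
move=> zN; rewrite /cGamma; set n := (if _ then _ else _).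
have nN : (n <= N)%N.
  rewrite /n; case: ifPn => //; rewrite -leNgt => z0.
  have : (Num.truncn (- complex.Re z))%:R < N%:R :> R.
    apply: (@le_lt_trans _ _ (- complex.Re z)); last by rewrite ltrNl; lra.
    by rewrite truncn_le// oppr_ge0.
  by rewrite ltr_nat.
have zn : 0 < complex.Re z + n%:R.
  rewrite /n; case: ifPn => [|_]; first by rewrite addr0.
  have := truncnS_gt (- complex.Re z); lra.
rewrite (euler_shift zn nN).
have -> : \prod_(0 <= j < N) (z + j%:R) = \prod_(0 <= j < n) (z + j%:R) *
    \prod_(n <= j < N) (z + j%:R) by rewrite (@big_cat_nat _ _ _ n).
have p0 : \prod_(n <= j < N) (z + j%:R) != 0.
  rewrite prodf_seq_neq0; apply/allP => j; rewrite mem_index_iota => /andP[nj _].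
  apply/implyP => _; apply/eqP => /(congr1 (@complex.Re R)).
  rewrite cReD cRe_nat /= => zj.
  have : (n%:R : R) <= j%:R by rewrite ler_nat.
  move: zn zj; lra.
by rewrite [X in _ = _ / X]mulrC -mulf_div divff ?mul1r.
Qed.

Lemma cGamma_euler z : 0 < complex.Re z -> cGamma z = euler_integral z.
Proof.
move=> z0; rewrite (@cGammaE _ 0%N); last by rewrite mulr0n addr0.
by rewrite big_geq// divr1 mulr0n addr0.
Qed.

Lemma rGammaE s : 0 < s -> rGamma s = gint s.
Proof. by move=> s0; rewrite /rGamma cGamma_euler// euler_integral_real. Qed.

Lemma rGamma_gt0 s : 0 < s -> 0 < rGamma s.
Proof. by move=> s0; rewrite rGammaE// gint_gt0. Qed.

Lemma ex_shift (x : R) : exists N : nat, 0 < x + N%:R.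
Proof.
exists (Num.truncn (- x)).+1; have := truncnS_gt (- x); lra.
Qed.

(** No exception at the poles: both sides are 0 there, the inverse of 0 being 0. *)
Lemma cGamma_rec z : cGamma z = cGamma (z + 1) / z.
Proof.
have [N zN] := ex_shift (complex.Re z).
rewrite (@cGammaE z N.+1); last by rewrite -addn1 natrD addrA addr_gt0.
rewrite (@cGammaE (z + 1) N); last by rewrite cReD /= -addrA (addrC 1) addrA addr_gt0.
rewrite -mulrA; congr (_ * _); first by rewrite -addn1 natrD addrAC addrA.
rewrite big_nat_recl//= addr0 invfM mulrC; congr (_ ^-1 * _).
by apply: eq_bigr => j _; rewrite -addn1 natrD (addrC j%:R) addrA.
Qed.

Lemma sin_le_norm x : `|sin x| <= `|x|.
Proof.
wlog x0 : x / 0 <= x.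
  move=> h; have [/h//|x0] := leP 0 x.
  by have := h (- x); rewrite sinN !normrN oppr_ge0 (ltW x0); exact.
have [->|xn0] := eqVneq x 0; first by rewrite sin0.
have {}x0 : 0 < x by rewrite lt_def xn0.
have [c _] := MVT x0 (fun t _ => is_derive_sin t) (is_derive_continuous_within
  (u := 0) (v := x) (@is_derive_sin R)).
rewrite sin0 !subr0 => ->; rewrite normrM ler_piMl//.
by rewrite cos_max.
Qed.

Lemma cos_ge x : 1 - x ^+ 2 / 2 <= cos x.
Proof.
have e : cos x = 1 - 2 * sin (x / 2) ^+ 2.
  have -> : x = x / 2 + x / 2 by field.
  rewrite cosD -!expr2 cos2sin2; have -> : (x / 2 + x / 2) / 2 = x / 2 by field.
  ring.
have h : sin (x / 2) ^+ 2 <= (x / 2) ^+ 2.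
  rewrite -(real_normK (num_real (sin _))) -(real_normK (num_real (x / 2))).
  by rewrite lerXn2r ?nnegrE// sin_le_norm.
rewrite e; have -> : x ^+ 2 / 2 = 2 * (x / 2) ^+ 2 by field.
lra.
Qed.

(** The right-hand side is the square of 2 sinh(x/2), which is at least x for x >= 0. At x = ln(u/s)
    it becomes (u - s)^2 / (u s). *)
Lemma sqr_le_cosh x : x ^+ 2 <= expR x + expR (- x) - 2.
Proof.
wlog x0 : x / 0 <= x.
  move=> h; have [/h//|x0] := leP 0 x.
  by have := h (- x); rewrite opprK sqrrN oppr_ge0 (ltW x0) (addrC (expR _)); exact.
pose f (t : R) := expR (t / 2) - expR (- (t / 2)).
have E (t : R) : expR t * expR (- t) = 1 by rewrite -expRD subrr expR0.
have df (t : R) : is_derive t 1 f ((expR (t / 2) + expR (- (t / 2))) / 2).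
  have d1 : is_derive t 1 (fun v : R => v / 2) (2^-1).
    by apply: is_derive1_ext (is_deriveZ (2^-1) (is_derive_id t 1)) _ _ => [v|];
      rewrite /GRing.scale/= ?mulr1// mulrC.
  have d2 : is_derive t 1 (fun v : R => - (v / 2)) (- 2^-1).
    exact: is_deriveN.
  have e1 := is_derive1_comp (g := fun v : R => v / 2) (is_derive_expR (t / 2)) d1.
  have e2 := is_derive1_comp (g := fun v : R => - (v / 2)) (is_derive_expR (- (t / 2))) d2.
  by apply: is_derive1_ext (is_deriveB e1 e2) _ _ => //; ring.
have fx : x <= f x.
  have [->|xn0] := eqVneq x 0; first by rewrite /f mul0r oppr0 expR0 subrr.
  have {}x0 : 0 < x by rewrite lt_def xn0.
  have [c _ fE] := MVT x0 (fun t _ => df t) (is_derive_continuous_within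
    (u := 0) (v := x) df).
  have f0 : f 0 = 0 by rewrite /f mul0r oppr0 expR0 subrr.
  rewrite f0 !subr0 in fE; rewrite fE.
  rewrite ler_peMl ?(ltW x0)//.
  set p := expR (c / 2); set q := expR (- (c / 2)).
  have pq : p * q = 1 by exact: E.
  have : 0 <= p * (1 - q) ^+ 2 by rewrite mulr_ge0 ?expR_ge0 ?sqr_ge0.
  have -> : p * (1 - q) ^+ 2 = p - 2 * (p * q) + p * q * q by ring.
  rewrite pq; lra.
have -> : expR x + expR (- x) - 2 = f x ^+ 2.
  rewrite /f sqrrB -!expRM_natl E.
  have -> : 2 * (x / 2) = x by field.
  have -> : 2 * (- (x / 2)) = - x by field.
  by ring.
by rewrite lerXn2r ?nnegrE// (le_trans x0).
Qed.

(* Re (E(s + iy) e^{-iy ln s}) >= E(s) - y^2/2 E[ln^2(u/s)], and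
   ln^2(u/s) <= (u - s)^2 / (us) is integrated in closed form. *)
Lemma euler_neq0 z : 1 + complex.Im z ^+ 2 / 2 < complex.Re z ->
  euler_integral z != 0.
Proof.
set y := complex.Im z; set s := complex.Re z => hs.
have s1 : 1 < s by apply: le_lt_trans hs; rewrite lerDl divr_ge0 ?sqr_ge0.
have s0 : 0 < s by apply: lt_trans s1.
have sm1 : 0 < s - 1 by rewrite subr_gt0.
have sp1 : 0 < s + 1 by rewrite addr_gt0.
apply/eqP => E0.
(* This rotation centres the oscillating factor u^(iy) at u = s. *)
pose a : R[i] := cexp (0 +i* (- (y * ln s))).
have iz := @cintegrable_Eker R z s0.
have eqa : cintegral Dp (fun u => a * Eker z u) = 0.
  by rewrite (cintegralZ _ mDp iz) -/(euler_integral z) E0 mulr0.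
pose q u := (1 + y ^+ 2) * gker s u - y ^+ 2 / 2 * (s^-1 * gker (s + 1) u + s * gker (s - 1) u).
have ig t : 0 < t -> mu.-integrable Dp (EFin \o gker t) by exact: integrable_gker.
have i1 : mu.-integrable Dp (EFin \o (fun u => s^-1 * gker (s + 1) u + s * gker (s - 1) u)).
  rewrite (_ : _ \o _ = (EFin \o (fun u => s^-1 * gker (s + 1) u)) \+
    (EFin \o (fun u => s * gker (s - 1) u)))//.
  by apply: integrableD => //; apply: integrableZl_fin => //; exact: ig.
have i2 : mu.-integrable Dp (EFin \o (fun u =>
    y ^+ 2 / 2 * (s^-1 * gker (s + 1) u + s * gker (s - 1) u))).
  exact: integrableZl_fin.
have i3 : mu.-integrable Dp (EFin \o (fun u => (1 + y ^+ 2) * gker s u)).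
  by apply: integrableZl_fin => //; exact: ig.
have iq : mu.-integrable Dp (EFin \o q).
  rewrite (_ : _ \o _ = ((EFin \o (fun u => (1 + y ^+ 2) * gker s u)%R) \- (EFin \o (fun u =>
    y ^+ 2 / 2 * (s^-1 * gker (s + 1) u + s * gker (s - 1) u))%R))%E)//.
  by apply: integrableB.
have le : \int[mu]_(u in Dp) q u <= complex.Re (cintegral Dp (fun u => a * Eker z u)).
  rewrite -[leRHS]/(\int[mu]_(u in Dp) complex.Re (a * Eker z u)).
  apply: le_Rintegral => //; first exact: (proj1 (cintegrableZ a mDp iz)).
  move=> u /DpP u0.
  have -> : complex.Re (a * Eker z u) = gker s u * cos (y * (ln u - ln s)).
    rewrite /Eker /a cpowE mulrCA -cexpD cReM /= mul0r subr0 /gker -mulrA.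
    by congr (_ * (expR _ * cos _)); rewrite !cReImE /= -/s -/y; ring.
  have h1 := cos_ge (y * (ln u - ln s)).
  apply: le_trans (ler_wpM2l (gker_ge0 s u) h1).
  have h2 := sqr_le_cosh (ln u - ln s).
  have e1 : expR (ln u - ln s) = u / s by rewrite expRD expRN !lnK ?posrE.
  have e2 : expR (- (ln u - ln s)) = s / u by rewrite opprB expRD expRN !lnK ?posrE.
  rewrite e1 e2 in h2.
  have g1 : gker (s + 1) u = gker s u * u by rewrite gker_add.
  have g2 : gker (s - 1) u = gker s u / u.
    by rewrite -[in RHS](subrK 1 s) gker_add// mulfK// gt_eqF.
  have -> : q u = gker s u * (1 - y ^+ 2 / 2 * (u / s + s / u - 2)).
    by rewrite /q g1 g2; field; rewrite !gt_eqF.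
  rewrite ler_wpM2l ?gker_ge0// lerD2l lerN2 exprMn -mulrA mulrCA [leRHS]mulrAC.
  rewrite mulrC; have y2 := sqr_ge0 y; nra.
have iZ c t : 0 < t -> mu.-integrable Dp (EFin \o (fun u => c * gker t u)).
  by move=> t0; apply: integrableZl_fin => //; exact: ig.
move: le; rewrite eqa /= /q RintegralB// RintegralZl//; last exact: ig.
rewrite [X in _ - X]RintegralZl// RintegralD//; try exact: iZ.
rewrite !RintegralZl//; try exact: ig.
rewrite -/(gint s) -/(gint (s + 1)) -/(gint (s - 1)) gintS//.
have gs : gint s = (s - 1) * gint (s - 1) by rewrite -gintS// subrK.
rewrite gs.
have g0 := gint_gt0 sm1.
rewrite mulKf ?gt_eqF//.
move: hs g0; set g := gint _ => hs g0 h.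
(* The product is the integral of [q]; it is positive exactly under the hypothesis on z. *)
have : 0 < g * (s - 1 - y ^+ 2 / 2) by rewrite mulr_gt0//; lra.
nra.
Qed.

Definition off_poles z : Prop := complex.Im z <> 0 \/ 0 < complex.Re z.

Lemma off_poles_neq z (j : nat) : off_poles z -> z + j%:R != 0.
Proof.
move=> h; apply/eqP => e; case: h => [|zp].
  by apply; move/(congr1 (@complex.Im R)): e; rewrite cImD cIm_nat addr0.
move/(congr1 (@complex.Re R)): e; rewrite cReD cRe_nat /= => e.
have := ler0n R j; lra.
Qed.

(** A shift leaves the imaginary part alone, so a large one brings z into the parabolic region of
    [euler_neq0]; the product formula transfers the conclusion back. *)
Lemma cGamma_neq0 z : off_poles z -> cGamma z != 0.
Proof.
move=> zp.
have [N hN] := ex_shift (complex.Re z - (1 + complex.Im z ^+ 2 / 2)).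
have i0 : 0 <= complex.Im z ^+ 2 / 2 by rewrite divr_ge0 ?sqr_ge0.
rewrite (@cGammaE z N); last by lra.
rewrite mulf_neq0 ?invr_neq0//.
  by apply: euler_neq0; rewrite !cReImE addr0; lra.
rewrite prodf_seq_neq0; apply/allP => j _; apply/implyP => _.
exact: off_poles_neq.
Qed.

(** Rests on Gamma(z+1) being nonzero. By this cancellation the quotients of Gamma functions in the
    H-integrands become rational factors. *)
Lemma cGamma_ratio z : off_poles z -> cGamma z / cGamma (z + 1) = z^-1.
Proof.
move=> zp; rewrite [X in X / _]cGamma_rec mulrAC divff ?mul1r//.
apply: cGamma_neq0; case: zp => h; [left|right]; rewrite !cReImE /= ?addr0//.
by rewrite addr_gt0.
Qed.

Lemma is_C11_cGamma (D : R[i] -> Prop) (x1 x2 e : R) : 0 < e ->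
  (forall z, D z -> x1 <= complex.Re z <= x2 /\ (e <= complex.Re z \/ e <= `|complex.Im z|)) ->
  is_C11 D cGamma.
Proof.
move=> e0 De; have [N xN] := ex_shift x1.
apply: (is_C11_eq (g := fun z => euler_integral (N%:R + 1 * z) *
   \prod_(j <- iota 0 N) (z - (- j%:R))^-1)).
  move=> z /De [/andP[z1 _] _]; rewrite (@cGammaE _ N); last by lra.
  rewrite mul1r addrC /index_iota subn0 -prodfV; congr (_ * _).
  by apply: eq_bigr => j _; rewrite opprK.
apply: is_C11M.
  apply: (@is_C11_affine _ _ (fun w => x1 + N%:R <= complex.Re w <= x2 + N%:R)).
    by move=> z /De [/andP[z1 z2] _]; rewrite mul1r cReD cRe_nat; lra.
  exact: (@is_C11_euler _ _ (x1 + N%:R) (x2 + N%:R)).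
apply: is_C11_prod => j; apply: (is_C11_inv e0) => z /De[_ h].
rewrite opprK; case: h => h; apply: (le_trans h).
  apply: le_trans (ler_Re_normc _); rewrite cReD cRe_nat.
  by apply: le_trans (ler_norm _); rewrite lerDl.
by apply: le_trans (ler_Im_normc _); rewrite cImD cIm_nat addr0.
Qed.

(** After a shift by n the numerator is bounded on the strip, while each of the n factors of the
    denominator has modulus at least |Im z|. *)
Lemma cGamma_decay (M : R) (N : nat) : exists (n : nat) (K : R), [/\ (N <= n)%N, 0 <= K &
  forall z, `|complex.Re z| <= M -> 0 < `|complex.Im z| ->
    normc (cGamma z) <= K / `|complex.Im z| ^+ n].
Proof.
have [L hL] := ex_shift (- M).
pose n := (N + L)%N.
exists n, (2 * (gint (n%:R - M) + gint (n%:R + M))).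
split; first exact: leq_addr.
  by rewrite mulr_ge0// addr_ge0 ?gint_ge0.
move=> z; rewrite ler_norml => /andP[z1 z2] i0.
have n1 : 0 < n%:R - M by rewrite /n natrD; have := ler0n R N; lra.
rewrite (@cGammaE _ n); last by lra.
rewrite normcM normcV ler_pM ?normc_ge0 ?invr_ge0 ?normc_ge0//.
  by apply: normc_euler => //; rewrite cReD cRe_nat; lra.
have h : `|complex.Im z| ^+ n <= normc (\prod_(0 <= j < n) (z + j%:R)).
  elim: n {n1} => [|n IH]; first by rewrite expr0 big_geq// normc1.
  rewrite exprSr big_nat_recr//= normcM ler_pM ?exprn_ge0//.
  by apply: le_trans (ler_Im_normc _); rewrite cImD cIm_nat addr0.
rewrite lef_pV2 ?posrE ?exprn_gt0//.
by apply: lt_le_trans h; rewrite exprn_gt0.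
Qed.

Lemma conjc_cintegral (D : set R) (f : R -> R[i]) : measurable D -> cintegrable D f ->
  cintegral D (fun u => conjc (f u)) = conjc (cintegral D f).
Proof.
move=> mD [i1 i2]; rewrite /cintegral /=; congr (_ +i* _).
  by apply: eq_Rintegral => u _; case: (f u).
rewrite -mulN1r -RintegralZl//; apply: eq_Rintegral => u _.
by case: (f u) => a b /=; rewrite mulN1r.
Qed.

Lemma conjc_cpow (x : R) z : cpow x (conjc z) = conjc (cpow x z).
Proof. by case: z => a b; rewrite /cpow /= mulNr cosN sinN mulrN. Qed.

Lemma conjcM z w : conjc (z * w) = conjc z * conjc w.
Proof. exact: rmorphM. Qed.

Lemma conjcD z w : conjc (z + w) = conjc z + conjc w.
Proof. exact: rmorphD. Qed.

Lemma conjc_euler z : 0 < complex.Re z ->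
  euler_integral (conjc z) = conjc (euler_integral z).
Proof.
move=> z0; rewrite /euler_integral -(conjc_cintegral mDp (cintegrable_Eker z0)).
apply: eq_cintegral => u _; rewrite /Eker conjcM -conjc_cpow conjc_real.
by rewrite conjcD -realCN conjc_real realCN.
Qed.

End GammaFunction.

(** * Independence of the contour *)

Section ChainRule.
Context {R : realType}.

Lemma is_derive_eps (g : R -> R) (t d : R) :
  (forall e : R, 0 < e -> exists2 del : R, 0 < del & forall s : R, `|s - t| < del ->
     `|g s - g t - (s - t) * d| <= e * `|s - t|) -> is_derive t 1 g d.
Proof.
move=> hg.
have cv : (fun h : R => h^-1 *: ((g \o shift t) (h *: (1 : R)) - g t)) @ 0^' --> d.
  apply/cvgrPdist_le => e e0; have [del del0 hdel] := hg e e0.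
  near=> h.
  have hn : h != 0 by near: h; exact: nbhs_dnbhs_neq.
  have hd : `|h| < del by near: h; exact: dnbhs0_lt.
  have := hdel (h + t); rewrite addrK => /(_ hd).
  rewrite /= /GRing.scale /= mulr1.
  have -> : d - h^-1 * (g (h + t) - g t) = - (h^-1 * (g (h + t) - g t - h * d)).
    by field.
  rewrite normrN normrM normfV => hh.
  by rewrite mulrC ler_pdivrMr ?normr_gt0.
by apply: DeriveDef; [apply/cvg_ex; exists d|apply/cvg_lim].
Unshelve. all: by end_near. Qed.

Lemma is_derive_epsE (g : R -> R) (t d : R) : is_derive t 1 g d ->
  forall e : R, 0 < e -> exists2 del : R, 0 < del & forall s : R, `|s - t| < del ->
     `|g s - g t - (s - t) * d| <= e * `|s - t|.
Proof.
case=> dg dE e e0.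
have cv : (fun h : R => h^-1 *: ((g \o shift t) (h *: (1 : R)) - g t)) @ 0^' --> d.
  by rewrite -dE; exact: dg.
have /cvgrPdist_le /(_ _ e0) := cv.
rewrite near_withinE => /nbhs_ballP[del /= del0 hdel].
exists del => // s sd.
have [->|st] := eqVneq s t; first by rewrite !subrr mul0r subrr !normr0 mulr0.
have h0 : s - t != 0 by rewrite subr_eq0.
have := hdel (s - t); rewrite /ball /= sub0r normrN => /(_ sd h0).
rewrite /= /GRing.scale /= mulr1 subrK => hh.
have -> : g s - g t - (s - t) * d = - ((s - t) * (d - (s - t)^-1 * (g s - g t))).
  by field.
by rewrite normrN normrM mulrC ler_wpM2r.
Qed.

Lemma cderive_eps (g : R -> R[i]) (t : R) (d : R[i]) :
  (forall e : R, 0 < e -> exists2 del : R, 0 < del & forall s : R, `|s - t| < del ->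
     normc (g s - g t - (s - t)%:C * d) <= e * `|s - t|) -> cderive g t d.
Proof.
move=> hg; split; apply: is_derive_eps => e e0; have [del del0 hdel] := hg e e0;
  exists del => // s sd; apply: le_trans (hdel s sd).
  by apply: le_trans (ler_Re_normc _); rewrite !cReImE /= mul0r subr0.
by apply: le_trans (ler_Im_normc _); rewrite !cReImE /= mul0r addr0.
Qed.

Lemma cderive_epsE (g : R -> R[i]) (t : R) (d : R[i]) : cderive g t d ->
  forall e : R, 0 < e -> exists2 del : R, 0 < del & forall s : R, `|s - t| < del ->
     normc (g s - g t - (s - t)%:C * d) <= e * `|s - t|.
Proof.
move=> [g1 g2] e e0; have e20 : 0 < e / 2 by rewrite divr_gt0.
have [d1 d10 h1] := is_derive_epsE g1 e20; have [d2 d20 h2] := is_derive_epsE g2 e20.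
exists (Num.min d1 d2); first by rewrite lt_min d10.
move=> s; rewrite lt_min => /andP[/h1 s1 /h2 s2].
apply: le_trans (ler_normc_ReIm _) _; rewrite !cReImE /= !mul0r subr0 addr0.
by rewrite (splitr e) [leRHS]mulrDl lerD.
Qed.

Lemma ccontinuous_eps (g : R -> R[i]) (t : R) :
  (forall e : R, 0 < e -> exists2 del : R, 0 < del & forall s : R, `|s - t| < del ->
     normc (g s - g t) <= e) -> ccontinuous_at g t.
Proof.
move=> hg; split; apply/cvgrPdist_le => e e0; have [del del0 hdel] := hg e e0;
  apply/nbhs_ballP; exists del => //= s; rewrite /ball /= distrC => sd.
  by rewrite distrC -cReN -cReD (le_trans (ler_Re_normc _))// hdel.
by rewrite distrC -cImN -cImD (le_trans (ler_Im_normc _))// hdel.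
Qed.

Lemma ccontinuous_epsE (g : R -> R[i]) (t : R) : ccontinuous_at g t ->
  forall e : R, 0 < e -> exists2 del : R, 0 < del & forall s : R, `|s - t| < del ->
     normc (g s - g t) <= e.
Proof.
move=> [/cvgrPdist_le g1 /cvgrPdist_le g2] e e0.
have e20 : 0 < e / 2 by rewrite divr_gt0.
have /nbhs_ballP[d1 /= d10 h1] := g1 _ e20.
have /nbhs_ballP[d2 /= d20 h2] := g2 _ e20.
exists (Num.min d1 d2); first by rewrite lt_min d10.
move=> s; rewrite lt_min => /andP[s1 s2].
apply: le_trans (ler_normc_ReIm _) _; rewrite !cReImE (splitr e) lerD//.
  by rewrite distrC; apply: h1; rewrite /ball /= distrC.
by rewrite distrC; apply: h2; rewrite /ball /= distrC.
Qed.

Lemma continuous_at_ext (f g : R -> R) (t : R) : f =1 g ->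
  {for t, continuous f} -> {for t, continuous g}.
Proof. by move=> /funext ->. Qed.

Lemma ccontinuousM (f g : R -> R[i]) (t : R) : ccontinuous_at f t ->
  ccontinuous_at g t -> ccontinuous_at (fun x => f x * g x) t.
Proof.
move=> [f1 f2] [g1 g2]; split.
  apply: (continuous_at_ext (fun u => esym (cReM _ _))).
  by apply: cvgB; apply: cvgM; assumption.
apply: (continuous_at_ext (fun u => esym (cImM _ _))).
by apply: cvgD; apply: cvgM; assumption.
Qed.

Lemma ccontinuousB (f g : R -> R[i]) (t : R) : ccontinuous_at f t ->
  ccontinuous_at g t -> ccontinuous_at (fun x => f x - g x) t.
Proof.
move=> [f1 f2] [g1 g2]; split.
  apply: (@continuous_at_ext (fun u => complex.Re (f u) - complex.Re (g u))).
    by move=> u; rewrite cReD cReN.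
  by apply: cvgB; assumption.
apply: (@continuous_at_ext (fun u => complex.Im (f u) - complex.Im (g u))).
  by move=> u; rewrite cImD cImN.
by apply: cvgB; assumption.
Qed.

Lemma ccontinuousD (f g : R -> R[i]) (t : R) : ccontinuous_at f t ->
  ccontinuous_at g t -> ccontinuous_at (fun x => f x + g x) t.
Proof.
move=> [f1 f2] [g1 g2]; split.
  apply: (continuous_at_ext (fun u => esym (cReD _ _))).
  by apply: cvgD; assumption.
apply: (continuous_at_ext (fun u => esym (cImD _ _))).
by apply: cvgD; assumption.
Qed.

Lemma ccontinuous_cst (a : R[i]) (t : R) : ccontinuous_at (fun=> a) t.
Proof. by split; exact: cvg_cst. Qed.

Lemma ccontinuous_real (h : R -> R) (t : R) : {for t, continuous h} ->
  ccontinuous_at (fun x => (h x)%:C) t.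
Proof. by move=> ch; split => //=; exact: cvg_cst. Qed.

Variables (D : R[i] -> Prop) (f df : R[i] -> R[i]) (K : R).
Hypothesis fK : C11 D f df K.

Lemma C11_comp_continuous (g : R -> R[i]) (t : R) : ccontinuous_at g t ->
  (exists2 del : R, 0 < del & forall s : R, `|s - t| < del -> D (g s)) ->
  ccontinuous_at (fun s => f (g s)) t /\ ccontinuous_at (fun s => df (g s)) t.
Proof.
move=> cg [d1 d10 hD].
have Dt : D (g t) by apply: hD; rewrite subrr normr0.
have K0 : 0 <= K by have [h _ _] := fK Dt Dt; exact: le_trans (normc_ge0 _) h.
have K1 : 0 < 2 * K + 1 by rewrite ltr_wpDl// mulr_ge0.
suff key (k : R[i] -> R[i]) :
    (forall z w, D z -> D w -> normc (k w - k z) <= 2 * K * normc (w - z)) ->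
    ccontinuous_at (fun s => k (g s)) t.
  split; apply: key => z w Dz Dw; first exact: C11_lip fK Dz Dw.
  exact: C11_lip_d fK Dz Dw.
move=> lip; apply: ccontinuous_eps => e e0.
have e10 : 0 < e / (2 * K + 1) by rewrite divr_gt0.
have [d2 d20 h2] := ccontinuous_epsE cg e10.
exists (Num.min d1 d2); first by rewrite lt_min d10.
move=> s; rewrite lt_min => /andP[/hD s1 /h2 s2].
apply: le_trans (lip _ _ Dt s1) _.
apply: (@le_trans _ _ ((2 * K + 1) * normc (g s - g t))).
  by rewrite ler_wpM2r ?normc_ge0// lerDl.
by rewrite mulrC -ler_pdivlMr.
Qed.

Lemma C11_chain (g : R -> R[i]) (t : R) (d : R[i]) : cderive g t d ->
  (exists2 del : R, 0 < del & forall s : R, `|s - t| < del -> D (g s)) ->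
  cderive (fun s => f (g s)) t (d * df (g t)).
Proof.
move=> dg [d1 d10 hD].
have Dt : D (g t) by apply: hD; rewrite subrr normr0.
have K0 : 0 <= K by have [h _ _] := fK Dt Dt; exact: le_trans (normc_ge0 _) h.
apply: cderive_eps => e e0.
pose L := normc d + 1.
have L0 : 0 < L by rewrite ltr_wpDl ?normc_ge0.
pose e1 := Num.min 1 (e / 2 / (K + 1)).
have K1 : 0 < K + 1 by rewrite ltr_wpDl.
have e10 : 0 < e1 by rewrite lt_min ltr01 !divr_gt0.
have [d2 d20 h2] := cderive_epsE dg e10.
(* Chosen so that the quadratic remainder, at most (K + 1) (L |s - t|)^2, stays below (e/2) |s - t|;
   K + 1 is used because K may be 0. *)
pose d3 := e / 2 / ((K + 1) * L ^+ 2).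
have d30 : 0 < d3 by rewrite !divr_gt0// mulr_gt0// exprn_gt0.
exists (Num.min (Num.min d1 d2) d3); first by rewrite !lt_min d10 d20.
move=> s; rewrite !lt_min => /andP[/andP[/hD s1 /h2 s2] s3].
have [_ dft fst] := fK Dt s1.
set q := g s - g t - (s - t)%:C * d in s2.
have qb : normc (g s - g t) <= L * `|s - t|.
  rewrite (_ : g s - g t = q + (s - t)%:C * d); last by rewrite /q; ring.
  apply: le_trans (ler_normcD _ _) _; rewrite normcM normc_real /L mulrDl addrC mul1r.
  rewrite mulrC lerD// (le_trans s2)// ler_piMl//.
  by rewrite /e1 ge_min lexx.
rewrite (_ : f (g s) - f (g t) - (s - t)%:C * (d * df (g t)) =
   (f (g s) - f (g t) - (g s - g t) * df (g t)) + q * df (g t)); last by rewrite /q; ring.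
apply: le_trans (ler_normcD _ _) _; rewrite (splitr e) [leRHS]mulrDl lerD//.
  apply: le_trans fst _.
  apply: (@le_trans _ _ ((K + 1) * (L * `|s - t|) ^+ 2)).
    apply: ler_pM; rewrite ?exprn_ge0 ?normc_ge0//; first by rewrite lerDl.
    by rewrite lerXn2r ?nnegrE ?mulr_ge0 ?normc_ge0// ltW.
  have -> : (K + 1) * (L * `|s - t|) ^+ 2 = (`|s - t| * ((K + 1) * L ^+ 2)) * `|s - t|.
    by ring.
  rewrite ler_wpM2r// -ler_pdivlMr; last by rewrite mulr_gt0// exprn_gt0.
  exact: ltW.
rewrite normcM; apply: (@le_trans _ _ (e1 * `|s - t| * K)).
  by rewrite ler_pM ?normc_ge0.
rewrite mulrAC ler_wpM2r//.
apply: (@le_trans _ _ (e / 2 / (K + 1) * (K + 1))); last by rewrite divfK ?gt_eqF.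
by apply: ler_pM; rewrite ?(ltW e10) ?lerDl// /e1 ge_min lexx orbT.
Qed.

End ChainRule.

Section ContourIndependence.
Context {R : realType}.
Local Notation mu := (@lebesgue_measure R).

Local Notation ii := (@Complex R 0 1).

Definition rect (x1 x2 y1 y2 : R) (z : R[i]) : Prop :=
  x1 <= complex.Re z <= x2 /\ y1 <= complex.Im z <= y2.

(* Holomorphy on the plane slit along ]-oo, l] and [r, +oo[. *)
Definition slit_holomorphic (l r : R) (f : R[i] -> R[i]) : Prop :=
  forall x1 x2 y1 y2 : R, (l < x1 /\ x2 < r) \/ 0 < y1 \/ y2 < 0 ->
    is_C11 (rect x1 x2 y1 y2) f.

(** Order tau^-2 suffices twice: vertical integrals converge, and the homotopy term vanishes at
    infinity. Points close to the real axis, where poles may lie, are excluded. *)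
Definition strip_decay (f : R[i] -> R[i]) : Prop :=
  forall M : R, exists K : R, 0 <= K /\ forall x tau : R, `|x| <= M ->
    1 <= `|tau| -> normc (f (x +i* tau)) <= K / tau ^+ 2.

Lemma cintegrable_segment (f : R -> R[i]) (a b : R) :
  (forall x, a <= x <= b -> ccontinuous_at f x) -> cintegrable `[a, b] f.
Proof.
move=> cf.
have key (h : R -> R) : (forall x, a <= x <= b -> {for x, continuous h}) ->
    mu.-integrable `[a, b] (EFin \o h).
  move=> ch; apply: continuous_compact_integrable; first exact: segment_compact.
  by apply: continuous_in_subspaceT => x /[!inE] /=; rewrite in_itv/=; exact: ch.
by split; apply: key => x /cf [].
Qed.

Lemma normc_cintegral01 (f : R -> R[i]) (B : R) : cintegrable `[0, 1] f ->
  (forall x, 0 <= x <= 1 -> normc (f x) <= B) ->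
  normc (cintegral `[0, 1] f) <= 2 * B.
Proof.
move=> if_ fB.
have m01 : measurable (`[0, 1]%classic : set R) by exact: measurable_itv.
have iB : mu.-integrable `[0, 1] (EFin \o (fun=> B)).
  apply: continuous_compact_integrable; first exact: segment_compact.
  by apply: continuous_subspaceT => x; exact: cvg_cst.
apply: le_trans (normc_cintegral_le m01 if_ _ iB) _.
  by move=> x; rewrite /= in_itv/=; exact: fB.
rewrite ler_wpM2l//.
suff -> : \int[mu]_(x in `[0, 1]) B = B * (1 - 0) by rewrite subr0 mulr1.
transitivity (B * fine (mu `[0, 1]%classic)); first exact: Rintegral_cst.
by rewrite lebesgue_measure_itv/= lte_fin ltr01.
Qed.

Variables (l r : R) (f : R[i] -> R[i]) (c : R -> R) (c0 : R).
Hypotheses (hf : slit_holomorphic l r f) (df : strip_decay f).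
Hypotheses (hc : contour c) (lc0 : l < c0) (c0r : c0 < r).
Hypotheses (lc : l < c 0) (cr : c 0 < r).

(** Straight-line homotopy at constant ordinate, from the vertical line (th = 0) to the contour (th
    = 1). It meets the real axis only at tau = 0, between [c0] and [c 0], hence avoids the slits. *)
Let p (tau th : R) : R[i] := (c0 + th * (c tau - c0)) +i* tau.
Let dc (tau : R) : R := (c^`()%classic) tau.

Let c_derive (tau : R) : is_derive tau 1 c (dc tau).
Proof. by case: hc => dcc _ _; apply: DeriveDef => //; rewrite /dc derive1E. Qed.

(** Letting th overshoot [0, 1] by [del] makes two-sided derivatives in th available at the end
    points 0 and 1. *)
Let local_rect (t : R) : exists D df K, C11 D f df K /\
  exists2 del : R, 0 < del & forall s : R, `|s - t| < del -> forall th : R,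
    - del < th -> th < 1 + del -> D (p s th).
Proof.
pose a := Num.min c0 (c t); pose b := Num.max c0 (c t).
have [ac0 act] : a <= c0 /\ a <= c t by rewrite /a !ge_min !lexx orbT.
have [c0b ctb] : c0 <= b /\ c t <= b by rewrite /b !le_max !lexx orbT.
have [e e0 he] : exists2 e : R, 0 < e &
    (l < a - e /\ b + e < r) \/ 0 < t - e \/ t + e < 0.
  (* For t nonzero a rectangle off the real axis will do; for t = 0 it crosses the axis and has to
     fit between [l] and [r]. *)
  have [t0|t0|t0] := ltgtP t 0.
  - by exists (- t / 2); [rewrite divr_gt0// oppr_gt0|right; right; lra].
  - by exists (t / 2); [rewrite divr_gt0|right; left; lra].
  - have la : l < a by rewrite /a t0 lt_min lc0.
    have br : b < r by rewrite /b t0 gt_max c0r.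
    exists (Num.min ((a - l) / 2) ((r - b) / 2)).
      by rewrite lt_min !divr_gt0// subr_gt0.
    have m1 : Num.min ((a - l) / 2) ((r - b) / 2) <= (a - l) / 2 by rewrite ge_min lexx.
    have m2 : Num.min ((a - l) / 2) ((r - b) / 2) <= (r - b) / 2.
      by rewrite ge_min lexx orbT.
    left; lra.
have [dfr [K hK]] := hf he.
exists (rect (a - e) (b + e) (t - e) (t + e)), dfr, K; split => //.
have /is_derive_continuous_at /cvgrPdist_le := c_derive t.
have e40 : 0 < e / 4 by rewrite divr_gt0.
move=> /(_ _ e40) /nbhs_ballP[d1 /= d10 h1].
pose m := `|c t - c0| + e.
have m0 : 0 < m by rewrite ltr_wpDl.
(* Controls at once the variation of [c] (d1), that of the ordinate (e), and the overshoot of th,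
   whose effect on the abscissa is at most e/4. *)
pose del := Num.min (Num.min d1 e) (Num.min 1 (e / 4 / m)).
have del0 : 0 < del by rewrite !lt_min d10 e0 ltr01 !divr_gt0.
have [del1 del2 del3] : [/\ del <= d1, del <= e & del <= e / 4 / m].
  by split; rewrite /del !ge_min lexx ?orbT.
exists del => // s st th th0 th1.
have cs : `|c s - c t| <= e / 4.
  by rewrite distrC; apply: h1; rewrite /ball /= distrC (lt_le_trans st).
have cm : `|c s - c0| <= m.
  rewrite (_ : c s - c0 = (c t - c0) + (c s - c t)); last by ring.
  by rewrite (le_trans (ler_normD _ _))// lerD// (le_trans cs)// ler_pdivrMr//; lra.
have dm : del * m <= e / 4 by rewrite -ler_pdivlMr.
move: cs; rewrite ler_norml => /andP[cs1 cs2].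
split => /=; last first.
  have : `|s - t| < e by apply: lt_le_trans st _.
  rewrite ltr_norml; lra.
have small x : `|x| <= del -> - (e / 4) <= x * (c s - c0) <= e / 4.
  move=> xd; rewrite -ler_norml normrM (le_trans _ dm)//.
  by rewrite ler_pM.
have [th_lt0|th_ge0] := ltP th 0.
  have : `|th| <= del by rewrite ler_norml; lra.
  move=> /small; lra.
have [th_gt1|th_le1] := ltP 1 th.
  have : `|th - 1| <= del by rewrite ler_norml; lra.
  move=> /small; have -> : c0 + th * (c s - c0) = c s + (th - 1) * (c s - c0) by ring.
  lra.
have -> : c0 + th * (c s - c0) = (1 - th) * c0 + th * c s by ring.
have h2 : a - e <= c0 by lra. have h3 : c0 <= b + e by lra.
have h4 : a - e <= c s by lra. have h5 : c s <= b + e by lra.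
nra.
Qed.

Let J (tau : R) : R[i] := cintegral `[0, 1] (fun th => f (p tau th)).

Let Phi (tau : R) : R[i] := (c tau - c0)%:C * J tau.

Let p_cderive (s th : R) : cderive (p s) th (c s - c0)%:C.
Proof.
split => /=; last exact: is_derive_cst.
have h := is_deriveD (is_derive_cst (c0 : R) th 1)
  (is_deriveM (is_derive_id th 1) (is_derive_cst (c s - c0 : R) th 1)).
by apply: is_derive1_ext h _ _ => //; rewrite /GRing.scale/= add0r mulr1 mulr0 add0r.
Qed.

(** Cauchy's theorem in differential form. [Phi] is the integral of f over the horizontal segment
    from the line to the contour; differentiating under the integral and integrating by parts in th
    leaves only the two end points. *)
Let Phi_cderive (t : R) :
  cderive Phi t (f (c t +i* t) * (dc t +i* 1) - ii * f (c0 +i* t)).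
Proof.
have [D [dfD [K [fK [del del0 hD]]]]] := local_rect t.
have pD (s : R) : `|s - t| < del -> forall th : R, 0 <= th <= 1 ->
    exists2 e : R, 0 < e & forall x : R, `|x - th| < e -> D (p s x).
  move=> st th /andP[th0 th1]; exists del => // x; rewrite ltr_norml => xth.
  apply: hD => //; lra.
have pc (s th : R) : ccontinuous_at (p s) th by exact: cderive_continuous (p_cderive s th).
have fpc (s : R) : `|s - t| < del -> forall th : R, 0 <= th <= 1 ->
    ccontinuous_at (fun x => f (p s x)) th /\ ccontinuous_at (fun x => dfD (p s x)) th.
  by move=> st th th01; apply: (C11_comp_continuous fK) => //; exact: pD.
have tt : `|t - t| < del by rewrite subrr normr0.
have Dt (th : R) : 0 <= th <= 1 -> D (p t th).
  by move=> /andP[h1 h2]; apply: hD => //; lra.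
have K0 : 0 <= K.
  have t01 : ((0 : R) <= (0 : R)) && ((0 : R) <= (1 : R)).
    by rewrite !lexx ler01.
  have [h _ _] := fK _ _ (Dt 0 t01) (Dt 0 t01).
  exact: le_trans (normc_ge0 _) h.
(* Partial derivative of [p] with respect to the ordinate. *)
pose u (th : R) : R[i] := (th * dc t) +i* 1.
have uc (th : R) : ccontinuous_at u th.
  have h : cderive u th (dc t)%:C.
    split => /=; last exact: is_derive_cst.
    have h := is_deriveM (is_derive_id th 1) (is_derive_cst (dc t : R) th 1).
    by apply: is_derive1_ext h _ _ => //; rewrite /GRing.scale/= mulr1 mulr0 add0r.
  exact: cderive_continuous h.
have m01 : measurable (`[0, 1]%classic : set R) by exact: measurable_itv.
pose A := cintegral `[0, 1] (fun th => u th * dfD (p t th)).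
have iA : cintegrable `[0, 1] (fun th => u th * dfD (p t th)).
  by apply: cintegrable_segment => th /(fpc _ tt) [_ h]; exact: ccontinuousM.
have iJ (s : R) : `|s - t| < del -> cintegrable `[0, 1] (fun th => f (p s th)).
  by move=> st; apply: cintegrable_segment => th /(fpc _ st) [].
have dJ : cderive J t A.
  apply: cderive_eps => e e0.
  pose L := `|dc t| + 2.
  have L0 : 0 < L by rewrite ltr_wpDl.
  pose e1 := Num.min 1 (e / 4 / (K + 1)).
  have K1 : 0 < K + 1 by rewrite ltr_wpDl.
  have e10 : 0 < e1 by rewrite lt_min ltr01 !divr_gt0.
  have [d2 d20 h2] := is_derive_epsE (c_derive t) e10.
  pose d3 := e / 4 / ((K + 1) * L ^+ 2).
  have d30 : 0 < d3 by rewrite !divr_gt0// mulr_gt0// exprn_gt0.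
  exists (Num.min (Num.min del d2) d3); first by rewrite !lt_min del0 d20.
  move=> s; rewrite !lt_min => /andP[/andP[s1 /h2 s2] s3].
  have iAs := cintegrableZ (s - t)%:C m01 iA.
  rewrite /J /A -(cintegralB m01 (iJ _ s1) (iJ _ tt)) -(cintegralZ _ m01 iA).
  rewrite -(cintegralB m01 (cintegrableB m01 (iJ _ s1) (iJ _ tt)) iAs).
  have -> : e * `|s - t| = 2 * (e / 2 * `|s - t|) by field.
  apply: normc_cintegral01.
    by apply: (cintegrableB m01) => //; apply: (cintegrableB m01); exact: iJ.
  move=> th th01; have [thp thp1] := andP th01.
  have Ds : D (p s th) by apply: hD => //; lra.
  have [_ dft fst] := fK _ _ (Dt th th01) Ds.
  set q := p s th - p t th in fst *.
  (* Error of the linear approximation of [p] in the ordinate; it comes from [c] alone. *)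
  pose w : R[i] := (th * (c s - c t - (s - t) * dc t))%:C.
  have qE : q = (s - t)%:C * u th + w.
    apply: complex_eq; rewrite /q /w /p /u !cReImE /= ?mulr0 ?mul0r; ring.
  have wb : normc w <= e1 * `|s - t|.
    rewrite normc_real normrM (le_trans _ s2)// ler_piMl// ger0_norm//.
  have ub : normc (u th) <= `|dc t| + 1.
    apply: le_trans (ler_normc_ReIm _) _; rewrite /= normr1 lerD2r normrM.
    by rewrite ler_piMl// ger0_norm.
  have qb : normc q <= L * `|s - t|.
    rewrite qE (le_trans (ler_normcD _ _))// normcM normc_real /L.
    have -> : (`|dc t| + 2) * `|s - t| = `|s - t| * (`|dc t| + 1) + 1 * `|s - t| by ring.
    apply: lerD; first by rewrite ler_wpM2l.
    by rewrite (le_trans wb)// ler_wpM2r// /e1 ge_min lexx.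
  have -> : f (p s th) - f (p t th) - (s - t)%:C * (u th * dfD (p t th)) =
     (f (p s th) - f (p t th) - q * dfD (p t th)) + w * dfD (p t th).
    by rewrite qE; ring.
  have -> : e / 2 = e / 4 + e / 4 by field.
  apply: le_trans (ler_normcD _ _) _; rewrite [leRHS]mulrDl lerD//.
    apply: le_trans fst _.
    apply: (@le_trans _ _ ((K + 1) * (L * `|s - t|) ^+ 2)).
      apply: ler_pM; rewrite ?exprn_ge0 ?normc_ge0//; first by rewrite lerDl.
      by rewrite lerXn2r ?nnegrE ?mulr_ge0 ?normc_ge0// ltW.
    have -> : (K + 1) * (L * `|s - t|) ^+ 2 = (`|s - t| * ((K + 1) * L ^+ 2)) * `|s - t|.
      by ring.
    rewrite ler_wpM2r// -ler_pdivlMr; last by rewrite mulr_gt0// exprn_gt0.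
    exact: ltW.
  rewrite normcM; apply: (@le_trans _ _ (e1 * `|s - t| * K)).
    by rewrite ler_pM ?normc_ge0.
  rewrite mulrAC ler_wpM2r//.
  apply: (@le_trans _ _ (e / 4 / (K + 1) * (K + 1))); last by rewrite divfK ?gt_eqF.
  by apply: ler_pM; rewrite ?(ltW e10) ?lerDl// /e1 ge_min lexx orbT.
have dct : is_derive t 1 (fun s => c s - c0) (dc t).
  by apply: is_derive1_ext (is_deriveB (c_derive t) (is_derive_cst (c0 : R) t 1)) _ _;
    rewrite ?subr0.
apply: cderive_eq (cderiveM (cderive_real dct) dJ) _.
have dfp (th : R) : 0 <= th <= 1 -> cderive (fun x => f (p t x)) th
    ((c t - c0)%:C * dfD (p t th)).
  move=> th01; apply: (C11_chain fK); first exact: p_cderive.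
  exact: pD.
have [i1 e1] := @cFTC_segment R (fun x => f (p t x)) _ 0 1 (@ltr01 R) dfp
  (fun th th01 => ccontinuousM (ccontinuous_cst _ _) (proj2 (fpc _ tt th th01))).
have cid th : ccontinuous_at (fun x : R => x%:C) th.
  by apply: ccontinuous_real; exact: cvg_id.
have c2 (th : R) : 0 <= th <= 1 -> ccontinuous_at
    (fun th => th%:C * ((c t - c0)%:C * dfD (p t th)) + 1%:C * f (p t th)) th.
  move=> /(fpc _ tt) [h3 h4]; apply: ccontinuousD.
    by apply: ccontinuousM => //; apply: ccontinuousM => //; exact: ccontinuous_cst.
  by apply: ccontinuousM => //; exact: ccontinuous_cst.
have [i2 e2] := @cFTC_segment R (fun x => x%:C * f (p t x)) _ 0 1 (@ltr01 R)
  (fun th th01 => cderiveM (cderive_real (is_derive_id th 1)) (dfp th th01)) c2.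
have p1 : p t 1 = c t +i* t by rewrite /p mul1r addrC subrK.
have p0 : p t 0 = c0 +i* t by rewrite /p mul0r addr0.
have e2' : cintegral `[0, 1] (fun th : R => th%:C * ((c t - c0)%:C * dfD (p t th))
    + 1%:C * f (p t th)) = f (p t 1).
  by rewrite e2 (_ : 1%:C = 1 :> R[i])// (_ : 0%:C = 0 :> R[i])// mul1r mul0r subr0.
(* Integration by parts: (c - c0) times the derivative of f at p is the derivative of f(p) in th,
   and adding f(p) to th times it makes the derivative of th f(p). The added term is removed again
   as dc times [J], which cancels against the other half of the product rule for [Phi]. *)
have AE : (c t - c0)%:C * A = (dc t)%:C * cintegral `[0, 1] (fun th : R => th%:C *
     ((c t - c0)%:C * dfD (p t th)) + 1%:C * f (p t th))
   + ii * cintegral `[0, 1] (fun th : R => (c t - c0)%:C * dfD (p t th))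
   - (dc t)%:C * J t.
  have j2 := cintegrableZ (dc t)%:C m01 i2; have j1 := cintegrableZ ii m01 i1.
  have jJ := cintegrableZ (dc t)%:C m01 (iJ _ tt).
  rewrite -(cintegralZ _ m01 iA) -(cintegralZ _ m01 i2) -(cintegralZ _ m01 i1).
  rewrite -(cintegralZ _ m01 (iJ _ tt)).
  rewrite -(cintegralD m01 j2 j1) -(cintegralB m01 (cintegrableD m01 j2 j1) jJ).
  apply: eq_cintegral => th _.
  have -> : u th = (dc t)%:C * th%:C + ii.
    by apply: complex_eq; rewrite /u !cReImE /=; ring.
  have -> : 1%:C = 1 :> R[i] by [].
  by ring.
rewrite e2' e1 p1 p0 in AE.
rewrite AE.
have -> : dc t +i* 1 = (dc t)%:C + ii by apply: complex_eq; rewrite !cReImE /=; ring.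
by ring.
Qed.

Lemma contour_homotopy : exists (Phi : R -> R[i]) (B : R),
  (forall t : R, cderive Phi t (f (c t +i* t) * (c^`()%classic t +i* 1) - ii * f (c0 +i* t))) /\
  (forall t : R, 1 <= `|t| -> normc (Phi t) <= B / t ^+ 2) /\
  forall t : R, ccontinuous_at (fun s => f (c s +i* s)) t.
Proof.
have [_ _ [M cM]] := hc.
have [K [K0 hK]] := df (M + 2 * `|c0|).
have m01 : measurable (`[0, 1]%classic : set R) by exact: measurable_itv.
exists Phi, ((M + `|c0|) * (2 * K)); split; first exact: Phi_cderive.
split; last first.
  move=> t; have [D [dfD [L [fL [del del0 hD]]]]] := local_rect t.
  apply: (proj1 (C11_comp_continuous fL (g := fun s => c s +i* s) _ _)).
    by split => /=; [exact: is_derive_continuous_at (c_derive t)|exact: cvg_id].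
  exists del => // s st.
  have -> : c s +i* s = p s 1 by rewrite /p mul1r addrC subrK.
  by apply: hD => //; lra.
move=> t t1.
have M0 : 0 <= M := le_trans (normr_ge0 _) (cM 0).
have tn0 : t != 0 by apply: contraTneq t1 => ->; rewrite normr0 ler10.
have t20 : 0 < t ^+ 2 by rewrite exprn_even_gt0//= tn0.
rewrite /Phi normcM normc_real -mulrA.
apply: ler_pM; rewrite ?normc_ge0//.
  by rewrite (le_trans (ler_normB _ _))// lerD2r.
rewrite -mulrA; have [D [dfD [L [fL [del del0 hD]]]]] := local_rect t.
have tt : `|t - t| < del by rewrite subrr normr0.
apply: normc_cintegral01.
  apply: cintegrable_segment => th /andP[th0 th1].
  apply: (proj1 (C11_comp_continuous fL _ _)); first exact: cderive_continuous (p_cderive t th).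
  exists del => // x; rewrite ltr_norml => xth; apply: hD => //; lra.
move=> th /andP[th0 th1]; apply: hK => //.
rewrite (_ : c0 + _ = th * c t + (1 - th) * c0); last by ring.
apply: le_trans (ler_normD _ _) _.
have th2 : 0 <= 1 - th by rewrite subr_ge0.
rewrite !normrM (ger0_norm th0) (ger0_norm th2); apply: lerD.
  by apply: le_trans (cM t); rewrite ler_piMl.
by rewrite mulr_natl mulr2n (le_trans (ler_piMl _ (_ : 1 - th <= 1)))// ?lerDl//; lra.
Qed.

End ContourIndependence.

Section ContourIntegral.
Context {R : realType}.
Local Notation mu := (@lebesgue_measure R).
Local Notation ii := (@Complex R 0 1).

Lemma bigcup_itvT : \bigcup_n `[- n.+1%:R, n.+1%:R]%classic = [set: R].
Proof.
apply/seteqP; split => // x _; exists (Num.truncn `|x|) => //=.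
by rewrite in_itv/= -ler_norml ltW// truncnS_gt.
Qed.

Lemma ltr_NS1 n : - n.+1%:R < n.+1%:R :> R.
Proof. by apply: (@lt_trans _ _ 0); rewrite ?oppr_lt0 ltr0n. Qed.

Lemma homo_NS1 : {homo (fun n => - n.+1%:R : R) : n m / (n <= m)%N >-> m <= n}.
Proof. by move=> n m nm; rewrite lerN2 ler_nat ltnS. Qed.

Lemma homo_S1 : {homo (fun n => n.+1%:R : R) : n m / (n <= m)%N >-> n <= m}.
Proof. by move=> n m nm; rewrite ler_nat ltnS. Qed.

Lemma integrable_cauchy : mu.-integrable setT (EFin \o (fun x : R => (1 + x ^+ 2)^-1)).
Proof.
have p x : 0 < 1 + x ^+ 2 :> R by rewrite ltr_pwDl// sqr_ge0.
have ch (x : R) : {for x, continuous (fun x : R => (1 + x ^+ 2)^-1)}.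
  apply: (@cvgV _ _ _ _ (fun x : R => 1 + x ^+ 2)); first by rewrite gt_eqF.
  by apply: cvgD; [exact: cvg_cst|exact: exprn_continuous].
have mh : measurable_fun setT (fun x : R => (1 + x ^+ 2)^-1).
  by apply: continuous_measurable_fun => x; exact: ch.
have h0 (x : R) : setT x -> 0 <= (1 + x ^+ 2)^-1 by rewrite invr_ge0 ltW.
have hB (x y : R) : setT x -> setT y -> atan x - atan y <= pi.
  move=> _ _; have := atan_gtNpi2 x; have := atan_ltpi2 x.
  have := atan_gtNpi2 y; have := atan_ltpi2 y; lra.
exact: (proj1 (improper_integrable ltr_NS1 homo_NS1 homo_S1 bigcup_itvT
  (fun x _ => is_derive1_atan x) (fun x _ => ch x) mh h0 hB)).
Qed.

Lemma cvg_invS2sqr (B : R) : (fun n => B / n.+1%:R ^+ 2) @ \oo --> (0 : R).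
Proof.
have -> : (fun n => B / n.+1%:R ^+ 2 : R) = (fun n => B * (n.+1%:R^-1 * n.+1%:R^-1)).
  by apply/funext => n; rewrite -invfM -expr2.
rewrite -[X in _ --> X](mulr0 B); apply: cvgM; first exact: cvg_cst.
rewrite -[X in _ --> X](mulr0 0); apply: cvgM; exact: cvg_harmonic.
Qed.

Lemma vertical_continuous (l r : R) (f : R[i] -> R[i]) (c0 t : R) :
  slit_holomorphic l r f -> l < c0 < r -> ccontinuous_at (fun t : R => f (c0 +i* t)) t.
Proof.
move=> hf /andP[lc0 c0r].
have [e e0 he] : exists2 e : R, 0 < e & (l < c0 /\ c0 < r) \/ 0 < t - e \/ t + e < 0.
  by exists 1 => //; left.
have [df [K fK]] := hf _ _ _ _ he.
apply: (proj1 (C11_comp_continuous fK (g := fun t => c0 +i* t) _ _)).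
  by split => /=; [exact: cvg_cst|exact: cvg_id].
exists e => // s; rewrite ltr_norml => st; split => /=; rewrite ?lexx//; lra.
Qed.

(** Decay says nothing for |t| < 1; there the uniform bound on a segment across the real axis takes
    over. The two are merged into one multiple of the Cauchy density. *)
Lemma vertical_bound (l r : R) (f : R[i] -> R[i]) (c0 : R) :
  slit_holomorphic l r f -> strip_decay f -> l < c0 < r ->
  exists2 B : R, 0 <= B & forall t : R, normc (f (c0 +i* t)) <= B * (1 + t ^+ 2)^-1.
Proof.
move=> hf df /andP[lc0 c0r].
have h1 : (l < c0 /\ c0 < r) \/ 0 < (-1 : R) \/ (1 : R) < 0 by left.
have [dfD [K fK]] := hf _ _ _ _ h1.
have [L [L0 hL]] := df `|c0|.
have rc t : `|t| <= 1 -> rect c0 c0 (-1) 1 (c0 +i* t).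
  by rewrite ler_norml => /= t1; rewrite /rect /= lexx.
have K0 : 0 <= K.
  have h0 := rc 0; rewrite normr0 ler01 in h0.
  have [h _ _] := fK _ _ (h0 isT) (h0 isT).
  exact: le_trans (normc_ge0 _) h.
exists (2 * (K + L)) => [|t]; first by rewrite mulr_ge0 ?addr_ge0.
have p : 0 < 1 + t ^+ 2 by rewrite ltr_pwDl// sqr_ge0.
rewrite ler_pdivlMr//.
have [t1|t1] := leP `|t| 1.
  have [h _ _] := fK _ _ (rc t t1) (rc t t1).
  have : t ^+ 2 <= 1 by rewrite -real_normK ?num_real// expr_le1.
  have := normc_ge0 (f (c0 +i* t)); have := sqr_ge0 t; nra.
have h := hL c0 t (lexx _) (ltW t1).
have t2 : 1 <= t ^+ 2 by rewrite -real_normK ?num_real// expr_ge1// ltW.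
have t20 : 0 < t ^+ 2 by apply: lt_le_trans t2.
rewrite ler_pdivlMr// in h.
have := normc_ge0 (f (c0 +i* t)); nra.
Qed.

Lemma vertical_measurable (l r : R) (f : R[i] -> R[i]) (c0 : R) :
  slit_holomorphic l r f -> l < c0 < r ->
  cmeasurable setT (fun t : R => f (c0 +i* t)).
Proof.
by move=> hf lr; split; apply: continuous_measurable_fun => t;
  have [] := vertical_continuous t hf lr.
Qed.

Lemma vertical_integrable (l r : R) (f : R[i] -> R[i]) (c0 : R) :
  slit_holomorphic l r f -> strip_decay f -> l < c0 < r ->
  cintegrable setT (fun t : R => f (c0 +i* t)).
Proof.
move=> hf df lr; have [B B0 hB] := vertical_bound hf df lr.
apply: (@cintegrable_le R setT _ (fun t => B * (1 + t ^+ 2)^-1)) => //.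
- exact: vertical_measurable hf lr.
- by apply: integrableZl_fin => //; exact: integrable_cauchy.
Qed.

(** The difference of the integrands is the derivative of [Phi], whose values at -n and n tend to 0.
    The factor i on the right is that of ds = i dt on a vertical line. *)
Lemma contour_integral_eq (l r : R) (f : R[i] -> R[i]) (c : R -> R) (c0 : R) :
  slit_holomorphic l r f -> strip_decay f -> contour c ->
  l < c0 < r -> l < c 0 < r ->
  cintegrable setT (fun t => f (c t +i* t) * (c^`()%classic t +i* 1)) ->
  cintegral setT (fun t => f (c t +i* t) * (c^`()%classic t +i* 1)) =
  ii * cintegral setT (fun t => f (c0 +i* t)).
Proof.
move=> hf df hc /[dup] lr /andP[lc0 c0r] /andP[lc cr] ig.
have [Phi [B [dPhi [hB cfc]]]] := contour_homotopy hf df hc lc0 c0r lc cr.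
have iv := vertical_integrable hf df lr.
have mT : measurable ([set: R]) by exact: measurableT.
have iiv := cintegrableZ ii mT iv.
apply/eqP; rewrite -subr_eq0; apply/eqP.
rewrite -(cintegralZ _ mT iv) -(cintegralB mT ig iiv) -[RHS](subrr 0).
have tail (e : R) : `|e| = 1 -> ccvg (fun n => Phi (e * n.+1%:R)) 0.
  move=> e1; apply: (@ccvg0_le _ _ (fun n => B / n.+1%:R ^+ 2)); last exact: cvg_invS2sqr.
  move=> n; apply: le_trans (hB _ _) _.
    by rewrite normrM e1 mul1r ger0_norm// ler1n.
  by rewrite exprMn -(real_normK (num_real e)) e1 expr1n mul1r.
apply: (@improper_cFTC R (fun n => - n.+1%:R) (fun n => n.+1%:R) setT Phi).
- exact: ltr_NS1.
- exact: homo_NS1.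
- exact: homo_S1.
- exact: bigcup_itvT.
- by move=> t _; exact: dPhi.
- move=> t _; apply: ccontinuousB.
    apply: ccontinuousM => //; split => /=; last exact: cvg_cst.
    by case: hc => _ cc _; exact: cc.
  apply: ccontinuousM; first exact: ccontinuous_cst.
  exact: vertical_continuous hf lr.
- exact: cintegrableB.
- have -> : Phi \o (fun n => - n.+1%:R) = (fun n => Phi (-1 * n.+1%:R)).
    by apply/funext => n /=; rewrite mulN1r.
  by apply: tail; rewrite normrN1.
- have -> : Phi \o (fun n => n.+1%:R) = (fun n => Phi (1 * n.+1%:R)).
    by apply/funext => n /=; rewrite mul1r.
  by apply: tail; rewrite normr1.
Qed.

End ContourIntegral.

(** * Mellin integrals along vertical lines *)

Section FubiniBounded.
Context {R : realType}.
Local Notation mu := (@lebesgue_measure R).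

(** Domination by a product fits the intended use: the modulus of y^(c + it) does not depend on t,
    so a kernel in t and a weight in y separate. *)
Lemma Rintegral_fubini (f : R * R -> R) (a b : R -> R) :
  measurable_fun setT f ->
  mu.-integrable setT (EFin \o a) -> mu.-integrable setT (EFin \o b) ->
  (forall x y, `|f (x, y)| <= a x * b y) ->
  [/\ forall x, mu.-integrable setT (EFin \o (fun y => f (x, y))),
      forall y, mu.-integrable setT (EFin \o (fun x => f (x, y))),
      mu.-integrable setT (EFin \o (fun y => \int[mu]_x f (x, y))) &
      \int[mu]_x \int[mu]_y f (x, y) = \int[mu]_y \int[mu]_x f (x, y)].
Proof.
move=> mf ia ib fab.
have m1 x : measurable_fun setT (fun y => f (x, y)).
  exact: measurableT_comp mf (pair1_measurable x).
have m2 y : measurable_fun setT (fun x => f (x, y)).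
  exact: measurableT_comp mf (pair2_measurable y).
have ma : measurable_fun setT a by apply/measurable_EFinP; case/integrableP : ia.
have mb : measurable_fun setT b by apply/measurable_EFinP; case/integrableP : ib.
have i1 x : mu.-integrable setT (EFin \o (fun y => f (x, y))).
  apply: (@integrable_le _ _ _ (fun y => a x * b y)) => //.
  exact: integrableZl_fin.
have i2 y : mu.-integrable setT (EFin \o (fun x => f (x, y))).
  apply: (@integrable_le _ _ _ (fun x => b y * a x)) => //.
    by move=> x _; rewrite mulrC.
  exact: integrableZl_fin.
have ifp : (mu \x mu)%E.-integrable setT (EFin \o f).
  apply/integrable12ltyP; first exact/measurable_EFinP.
  apply: (@le_lt_trans _ _ (\int[mu]_x (`|a x| * \int[mu]_y `|b y|)%:E)%E).
    apply: ge0_le_integral => //.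
    - by move=> x _; apply: integral_ge0.
    - have := @measurable_fun_fubini_tonelli_F _ _ _ _ R mu (fun z => `|(f z)%:E|%E); apply => //.
      by apply: measurableT_comp => //; exact/measurable_EFinP.
    - apply/measurable_EFinP; apply: measurable_funM; last exact: measurable_cst.
      exact: measurableT_comp.
    - move=> x _.
      have -> : (`|a x| * \int[mu]_y `|b y|)%:E = (\int[mu]_y (`|a x| * `|b y|)%:E)%E.
        rewrite -RintegralZl//; last exact: integrable_norm.
        rewrite -EFin_Rintegral//.
        by apply: integrableZl_fin => //; exact: integrable_norm.
      apply: ge0_le_integral => //.
      + by apply: measurableT_comp => //; apply/measurable_EFinP; exact: m1.
      + apply/measurable_EFinP; apply: measurable_funM; first exact: measurable_cst.
        exact: measurableT_comp.
      + by move=> y _; rewrite lee_fin (le_trans (fab x y))// -normrM ler_norm.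
  have iab : mu.-integrable setT (EFin \o (fun x => `|a x| * \int[mu]_y `|b y|)).
    rewrite (_ : (fun x => _) = (fun x => (\int[mu]_y `|b y|) * `|a x|)); last first.
      by apply/funext => x; rewrite mulrC.
    by apply: integrableZl_fin => //; exact: integrable_norm.
  by rewrite EFin_Rintegral// ltry.
have eG : fubini_G mu (EFin \o f) = EFin \o (fun y => \int[mu]_x f (x, y)).
  by apply/funext => y; rewrite /fubini_G /= EFin_Rintegral//; exact: i2.
have eF x : (\int[mu]_y (EFin \o f) (x, y))%E = (\int[mu]_y f (x, y))%:E.
  by rewrite EFin_Rintegral//; exact: i1.
split=> //.
  apply: (@integrable_le _ _ _ (fun y => (\int[mu]_x a x) * b y)) => //.
  - apply/measurable_EFinP; rewrite (_ : EFin \o _ = fubini_G mu (EFin \o f))//.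
    exact: (measurable_fubini_G ifp).
  - move=> y _; apply: (le_trans (le_normr_Rintegral _ (i2 y))) => //.
    rewrite -RintegralZr//; apply: le_Rintegral => //.
    + exact: integrable_norm.
    + rewrite (_ : (fun x => a x * b y) = (fun x => b y * a x)); last first.
        by apply/funext => x; rewrite mulrC.
      exact: integrableZl_fin.
  - exact: integrableZl_fin.
have F := Fubini ifp.
transitivity (fine (\int[mu]_x \int[mu]_y (EFin \o f) (x, y))%E).
  by congr fine; apply: eq_integral => x _; rewrite eF.
rewrite F; congr fine; apply: eq_integral => y _.
exact: (congr1 (fun g => g y) eG).
Qed.

End FubiniBounded.

Section MellinFubini.
Context {R : realType}.
Local Notation mu := (@lebesgue_measure R).

Lemma real1C : (1 : R)%:C = 1 :> R[i].
Proof. by []. Qed.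

Lemma cintegrableS (E D : set R) (f : R -> R[i]) : measurable E -> measurable D ->
  D `<=` E -> cintegrable E f -> cintegrable D f.
Proof.
move=> mE mD DE [h1 h2]; split.
  exact: (@integrableS _ _ _ mu E D _ mE mD DE h1).
exact: (@integrableS _ _ _ mu E D _ mE mD DE h2).
Qed.

Lemma cintegral_fubini (F : R * R -> R[i]) (a b : R -> R) :
  measurable_fun setT (fun z => complex.Re (F z)) ->
  measurable_fun setT (fun z => complex.Im (F z)) ->
  mu.-integrable setT (EFin \o a) -> mu.-integrable setT (EFin \o b) ->
  (forall x y, normc (F (x, y)) <= a x * b y) ->
  cintegrable setT (fun y => cintegral setT (fun x => F (x, y))) /\
  cintegral setT (fun x => cintegral setT (fun y => F (x, y))) =
  cintegral setT (fun y => cintegral setT (fun x => F (x, y))).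
Proof.
move=> m1 m2 ia ib Fab.
have [_ _ i1 e1] := Rintegral_fubini m1 ia ib
  (fun x y => le_trans (ler_Re_normc _) (Fab x y)).
have [_ _ i2 e2] := Rintegral_fubini m2 ia ib
  (fun x y => le_trans (ler_Im_normc _) (Fab x y)).
split; first by split; [exact: i1|exact: i2].
by apply: complex_eq; [exact: e1|exact: e2].
Qed.

(** Inverse Mellin transform along Re s = c, in the convention x^s of the H-function; the i of ds =
    i dt cancels that of 1 / (2 pi i). *)
Definition mellin_line (c : R) (phi : R[i] -> R[i]) (x : R) : R[i] :=
  ((2 * pi)^-1)%:C * cintegral setT (fun t => phi (c +i* t) * cpow x (c +i* t)).

Variables (c : R) (phi : R[i] -> R[i]) (D : set R) (w el : R -> R).
Hypothesis iphi : cintegrable setT (fun t => phi (c +i* t)).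
Hypotheses (mD : measurable D) (mw : measurable_fun setT w)
  (ml : measurable_fun setT el).
Hypothesis w0 : forall y, D y -> 0 <= w y.
Hypothesis iw : mu.-integrable D (EFin \o (fun y => w y * expR (c * ln (el y)))).

Lemma mellin_line_integrable (x : R) :
  cintegrable setT (fun t => phi (c +i* t) * cpow x (c +i* t)).
Proof.
apply: (@cintegrable_le _ _ _ (fun t => expR (c * ln x) * normc (phi (c +i* t)))) => //.
- apply: cmeasurableM; first exact: cintegrable_measurable.
  have m1 (k : R) : measurable_fun setT (fun t : R => t * k).
    by apply: measurable_funM => //; exact: measurable_cst.
  split; rewrite /cpow /=; apply: measurable_funM; try exact: measurable_cst.
    apply: measurableT_comp (m1 (ln x)).
    by apply: continuous_measurable_fun; exact: continuous_cos.
  apply: measurableT_comp (m1 (ln x)).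
  by apply: continuous_measurable_fun; exact: continuous_sin.
- by move=> t _; rewrite normcM normc_cpow mulrC.
- by apply: integrableZl_fin => //; exact: cintegrable_normc.
Qed.

(** The substitution [el] is left general because the transforms to come insert a product, a
    quotient or a power of the variable. *)
Lemma mellin_line_fubini :
  cintegrable D (fun y => (w y)%:C * mellin_line c phi (el y)) /\
  cintegral D (fun y => (w y)%:C * mellin_line c phi (el y)) =
  ((2 * pi)^-1)%:C * cintegral setT (fun t => phi (c +i* t) *
     cintegral D (fun y => (w y)%:C * cpow (el y) (c +i* t))).
Proof.
have mT : measurable [set: R] by exact: measurableT.
(* The weight extended by 0, so that both integrations run over the whole line. *)
pose W y : R := \1_D y * w y.
have mW : measurable_fun setT W.
  by apply: measurable_funM => //; exact: measurable_indic.
have W0 y : 0 <= W y.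
  rewrite /W indicE; have [/set_mem Dy|_] := boolP (y \in D).
    by rewrite mul1r w0.
  by rewrite mul0r.
pose F z : R[i] := phi (c +i* z.1) * ((W z.2)%:C * cpow (el z.2) (c +i* z.1)).
pose a t := normc (phi (c +i* t)).
pose b y := W y * expR (c * ln (el y)).
have ia : mu.-integrable setT (EFin \o a) by exact: cintegrable_normc.
have ib : mu.-integrable setT (EFin \o b).
  rewrite (_ : EFin \o b = (EFin \o (fun y => w y * expR (c * ln (el y)))) \_ D).
    by rewrite -integrable_mkcond.
  apply/funext => y; rewrite /= /b /W indicE /patch.
  by case: ifP; rewrite /= ?mul1r ?mul0r.
have [p1 p2] := cintegrable_measurable iphi.
have mfst (h : R -> R) : measurable_fun setT h ->
    measurable_fun setT (fun z : R * R => h z.1).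
  by move=> mh; apply: measurableT_comp mh _; exact: measurable_fst.
have msnd (h : R -> R) : measurable_fun setT h ->
    measurable_fun setT (fun z : R * R => h z.2).
  by move=> mh; apply: measurableT_comp mh _; exact: measurable_snd.
have mln : measurable_fun setT (fun z : R * R => ln (el z.2)).
  by apply: (msnd (fun y => ln (el y))); apply: measurableT_comp ml; exact: measurable_ln.
have mtl : measurable_fun setT (fun z : R * R => z.1 * ln (el z.2)).
  by apply: measurable_funM => //; exact: measurable_fst.
have mexp : measurable_fun setT (fun z : R * R => expR (c * ln (el z.2))).
  apply: measurableT_comp; first exact: measurable_expR.
  by apply: measurable_funM => //; exact: measurable_cst.
have mcos : measurable_fun setT (fun z : R * R => cos (z.1 * ln (el z.2))).
  apply: measurableT_comp mtl.
  by apply: continuous_measurable_fun; exact: continuous_cos.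
have msin : measurable_fun setT (fun z : R * R => sin (z.1 * ln (el z.2))).
  apply: measurableT_comp mtl.
  by apply: continuous_measurable_fun; exact: continuous_sin.
have mWz := msnd _ mW; have p1z := mfst _ p1; have p2z := mfst _ p2.
have mF1 : measurable_fun setT (fun z => complex.Re (F z)).
  rewrite (_ : (fun z => _) = (fun z : R * R =>
     complex.Re (phi (c +i* z.1)) * (W z.2 * (expR (c * ln (el z.2)) * cos (z.1 * ln (el z.2))))
     - complex.Im (phi (c +i* z.1)) * (W z.2 * (expR (c * ln (el z.2)) * sin (z.1 * ln (el z.2)))))).
    by apply: measurable_funB; do 3 (apply: measurable_funM => //).
  by apply/funext => z; rewrite /F cReM [complex.Re (_%:C * _)]cReM [complex.Im (_%:C * _)]cImM /cpow /=;
    ring.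
have mF2 : measurable_fun setT (fun z => complex.Im (F z)).
  rewrite (_ : (fun z => _) = (fun z : R * R =>
     complex.Re (phi (c +i* z.1)) * (W z.2 * (expR (c * ln (el z.2)) * sin (z.1 * ln (el z.2))))
     + complex.Im (phi (c +i* z.1)) * (W z.2 * (expR (c * ln (el z.2)) * cos (z.1 * ln (el z.2)))))).
    by apply: measurable_funD; do 3 (apply: measurable_funM => //).
  by apply/funext => z; rewrite /F cImM [complex.Re (_%:C * _)]cReM [complex.Im (_%:C * _)]cImM /cpow /=;
    ring.
have Fab t y : normc (F (t, y)) <= a t * b y.
  by rewrite /F /= !normcM normc_cpow normc_real (ger0_norm (W0 y)).
have [iG eG] := cintegral_fubini mF1 mF2 ia ib Fab.
have eD (h : R -> R[i]) y : (\1_D y)%:C * ((w y)%:C * h y) = (W y)%:C * h y.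
  by rewrite mulrA -realCM.
have eL y : ((2 * pi)^-1)%:C * cintegral setT (fun t => F (t, y)) =
    (\1_D y)%:C * ((w y)%:C * mellin_line c phi (el y)).
  rewrite (eD (fun y => mellin_line c phi (el y))) /mellin_line mulrCA; congr (_ * _).
  rewrite -(cintegralZ _ mT (mellin_line_integrable (el y))).
  by apply: eq_cintegral => t _; rewrite /F /= mulrCA.
split.
  have h := cintegrableS mT mD (@subsetT _ D)
    (eq_cintegrable mT (fun y _ => eL y) (cintegrableZ ((2 * pi)^-1)%:C mT iG)).
  have E1 y : D y -> (\1_D y)%:C * ((w y)%:C * mellin_line c phi (el y)) =
      (w y)%:C * mellin_line c phi (el y).
    move=> Dy; have -> : \1_D y = 1 :> R by rewrite indicE mem_set.
    by rewrite real1C mul1r.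
  exact: (eq_cintegrable mD E1 h).
rewrite cintegral_mkcond.
rewrite -(eq_cintegral (fun y _ => eL y)) (cintegralZ _ mT iG) -eG; congr (_ * _).
have iWt t : cintegrable setT (fun y => (\1_D y)%:C * ((w y)%:C * cpow (el y) (c +i* t))).
  apply: (@cintegrable_le _ _ _ b mT _ _ ib).
  - apply: cmeasurableM.
      by apply: cmeasurable_real; exact: measurable_indic.
    by apply: cmeasurableM; [exact: cmeasurable_real|exact: cmeasurable_cpow].
  - move=> y _; rewrite (eD (fun y => cpow (el y) (c +i* t))) normcM normc_real.
    by rewrite (ger0_norm (W0 y)) normc_cpow.
apply: eq_cintegral => t _; rewrite [in RHS]cintegral_mkcond -(cintegralZ _ mT (iWt t)).
by apply: eq_cintegral => y _; rewrite /F /= (eD (fun y => cpow (el y) (c +i* t))).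
Qed.

End MellinFubini.

(** * Holomorphy and decay of the factors of the kernels *)

Section Factors.
Context {R : realType}.

(* Keeps the poles of [cGamma (a%:C + k%:C * s)] out of the strip l < Re s < r. *)
Definition pos_strip (l r a k : R) : Prop := forall x, l < x < r -> 0 < a + k * x.

(** The image of an admissible rectangle keeps a distance [e] from the poles of Gamma: it lies to
    their right if the rectangle is inside the strip, above or below them if the rectangle avoids
    the real axis. *)
Lemma affine_rect (l r a k x1 x2 y1 y2 : R) : k != 0 -> pos_strip l r a k ->
  (l < x1 /\ x2 < r) \/ 0 < y1 \/ y2 < 0 ->
  exists2 e : R, 0 < e & forall z, rect x1 x2 y1 y2 z ->
    - (`|a| + `|k| * (`|x1| + `|x2|)) <= complex.Re (a%:C + k%:C * z)
      <= `|a| + `|k| * (`|x1| + `|x2|) /\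
    (e <= complex.Re (a%:C + k%:C * z) \/ e <= `|complex.Im (a%:C + k%:C * z)|).
Proof.
move=> k0 hp hr.
have k0' : 0 < `|k| by rewrite normr_gt0.
have bd z : rect x1 x2 y1 y2 z ->
    - (`|a| + `|k| * (`|x1| + `|x2|)) <= complex.Re (a%:C + k%:C * z)
      <= `|a| + `|k| * (`|x1| + `|x2|).
  move=> [/andP[z1 z2] _]; rewrite -ler_norml !cReImE /= mul0r subr0.
  rewrite (le_trans (ler_normD _ _))// lerD2l normrM ler_wpM2l//.
  have := ler_norm x2; have := ler_norm (- x1); rewrite normrN => h1 h2.
  have := normr_ge0 x1; have := normr_ge0 x2.
  by rewrite ler_norml; lra.
have [x12|x12] := leP x1 x2; last first.
  by exists 1 => // z [/andP[z1 z2] _]; have := le_trans z1 z2; lra.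
case: hr => [[lx1 x2r]|[y1p|y2n]].
- pose e := Num.min (a + k * x1) (a + k * x2).
  exists e => [|z zr]; first by rewrite lt_min !hp//; lra.
  split; first exact: bd.
  left; case: zr => /andP[z1 z2] _; rewrite !cReImE /= mul0r subr0.
  have [kp|kn] := ltP 0 k.
    apply: (@le_trans _ _ (a + k * x1)); first by rewrite /e ge_min lexx.
    by rewrite lerD2l ler_wpM2l// ltW.
  apply: (@le_trans _ _ (a + k * x2)); first by rewrite /e ge_min lexx orbT.
  by rewrite lerD2l ler_wnM2l.
- exists (`|k| * y1) => [|z zr]; first by rewrite mulr_gt0.
  split; first exact: bd.
  right; case: zr => _ /andP[z1 z2]; rewrite !cReImE /= mul0r addr0 add0r normrM.
  by rewrite ler_wpM2l// (le_trans z1)// ler_norm.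
- exists (`|k| * - y2) => [|z zr]; first by rewrite mulr_gt0// oppr_gt0.
  split; first exact: bd.
  right; case: zr => _ /andP[z1 z2]; rewrite !cReImE /= mul0r addr0 add0r normrM.
  by rewrite ler_wpM2l// -normrN (le_trans _ (ler_norm _))// lerN2.
Qed.

Lemma slit_cGamma (l r a k : R) : k != 0 -> pos_strip l r a k ->
  slit_holomorphic l r (fun s => cGamma (a%:C + k%:C * s)).
Proof.
move=> k0 hp x1 x2 y1 y2 hr; have [e e0 he] := affine_rect k0 hp hr.
apply: (@is_C11_affine _ _ (fun w => - (`|a| + `|k| * (`|x1| + `|x2|)) <= complex.Re w
      <= `|a| + `|k| * (`|x1| + `|x2|) /\ (e <= complex.Re w \/ e <= `|complex.Im w|))) => //.
exact: (@is_C11_cGamma _ _ (- (`|a| + `|k| * (`|x1| + `|x2|)))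
  (`|a| + `|k| * (`|x1| + `|x2|)) e).
Qed.

Lemma slit_inv (l r a k : R) : k != 0 -> pos_strip l r a k ->
  slit_holomorphic l r (fun s => (a%:C + k%:C * s)^-1).
Proof.
move=> k0 hp x1 x2 y1 y2 hr; have [e e0 he] := affine_rect k0 hp hr.
apply: (@is_C11_affine _ _ (fun w => e <= normc w) (fun w => w^-1)).
  move=> z /he [_ [h|h]]; apply: (le_trans h).
    by apply: le_trans (ler_Re_normc _); exact: ler_norm.
  exact: ler_Im_normc.
apply: (is_C11_eq (g := fun w => (w - 0)^-1)); first by move=> w _; rewrite subr0.
by apply: (is_C11_inv e0) => w; rewrite subr0.
Qed.

Lemma slit_cpow (l r x : R) : slit_holomorphic l r (cpow x).
Proof.
by move=> x1 x2 y1 y2 _; apply: (@is_C11_cpow _ _ x x1 x2) => z [].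
Qed.

Lemma slitM (l r : R) f g : slit_holomorphic l r f -> slit_holomorphic l r g ->
  slit_holomorphic l r (fun s => f s * g s).
Proof.
by move=> hf hg x1 x2 y1 y2 h; apply: is_C11M; [exact: hf|exact: hg].
Qed.

Lemma slitX (l r : R) f (n : nat) : slit_holomorphic l r f ->
  slit_holomorphic l r (fun s => f s ^+ n).
Proof. by move=> hf x1 x2 y1 y2 h; apply: is_C11X; exact: hf. Qed.

(** In a product one factor provides the decay; this is what is asked of the others. *)
Definition strip_bounded (f : R[i] -> R[i]) : Prop :=
  forall M : R, exists K : R, 0 <= K /\ forall x tau : R, `|x| <= M ->
    1 <= `|tau| -> normc (f (x +i* tau)) <= K.

Lemma decay_bounded f : strip_decay f -> strip_bounded f.
Proof.
move=> df M; have [K [K0 hK]] := df M; exists K; split => // x t xM t1.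
have t2 : 1 <= t ^+ 2 by rewrite -real_normK ?num_real// expr_ge1// ltW.
rewrite (le_trans (hK _ _ xM t1))// ler_pdivrMr ?ler_peMr//.
exact: lt_le_trans t2.
Qed.

Lemma boundedX f (n : nat) : strip_bounded f -> strip_bounded (fun s => f s ^+ n).
Proof.
move=> hf M; have [K [K0 hK]] := hf M; exists (K ^+ n); split; first exact: exprn_ge0.
move=> x t xM t1; rewrite normcX lerXn2r ?nnegrE ?normc_ge0//; exact: hK.
Qed.

Lemma decayM f g : strip_decay f -> strip_bounded g ->
  strip_decay (fun s => f s * g s).
Proof.
move=> hf hg M; have [K [K0 hK]] := hf M; have [L [L0 hL]] := hg M.
exists (K * L); split => [|x t xM t1]; first exact: mulr_ge0.
by rewrite normcM mulrAC ler_pM ?normc_ge0 ?hK ?hL.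
Qed.

Lemma decay_cGamma (a k : R) : k != 0 ->
  strip_decay (fun s => cGamma (a%:C + k%:C * s)).
Proof.
move=> k0 M.
have k0' : 0 < `|k| by rewrite normr_gt0.
have [n [K [n2 K0 hK]]] := @cGamma_decay R (`|a| + `|k| * M) 2.
exists (K / `|k| ^+ n); split => [|x t xM t1]; first by rewrite divr_ge0// exprn_ge0.
have t0 : 0 < `|t| by apply: lt_le_trans t1.
have IE : complex.Im (a%:C + k%:C * (x +i* t)) = k * t.
  by rewrite !cReImE /= mul0r addr0 add0r.
apply: le_trans (hK _ _ _) _.
- rewrite !cReImE /= mul0r subr0 (le_trans (ler_normD _ _))// lerD2l normrM.
  by rewrite ler_wpM2l.
- by rewrite IE normrM mulr_gt0.
- rewrite IE normrM exprMn invfM mulrA ler_wpM2l ?divr_ge0 ?exprn_ge0//.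
  have -> : t ^+ 2 = `|t| ^+ 2 by rewrite real_normK ?num_real.
  by rewrite lef_pV2 ?posrE ?exprn_gt0// ler_weXn2l.
Qed.

Lemma bounded_inv (a k : R) : k != 0 ->
  strip_bounded (fun s => (a%:C + k%:C * s)^-1).
Proof.
move=> k0 M; have k0' : 0 < `|k| by rewrite normr_gt0.
exists `|k|^-1; split => [|x t xM t1]; first by rewrite invr_ge0.
have h : `|k| <= normc (a%:C + k%:C * (x +i* t)).
  apply: le_trans (ler_Im_normc _).
  by rewrite !cReImE /= mul0r addr0 add0r normrM ler_peMr.
by rewrite normcV lef_pV2// posrE (lt_le_trans k0').
Qed.

Lemma bounded_cpow (x : R) : strip_bounded (cpow x).
Proof.
move=> M; exists (expR (M * `|ln x|)); split => [|y t yM t1]; first exact: expR_ge0.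
rewrite normc_cpow ler_expR /= (le_trans (ler_norm _))// normrM ler_wpM2r//.
Qed.

End Factors.

(** * The inverse Mellin transform of Gamma(b - s) *)

Section GammaLine.
Context {R : realType}.
Local Notation mu := (@lebesgue_measure R).
Local Notation ii := (@Complex R 0 1).

Lemma two_pi_gt0 : 0 < 2 * pi :> R.
Proof. by rewrite mulr_gt0// pi_gt0. Qed.

(** Contour independence with one of the two lines taken as the contour. *)
Lemma mellin_line_shift (l r : R) (phi : R[i] -> R[i]) (c c' x : R) :
  slit_holomorphic l r phi -> strip_decay phi -> l < c < r -> l < c' < r ->
  mellin_line c phi x = mellin_line c' phi x.
Proof.
move=> hp dp cl cl'; rewrite /mellin_line; congr (_ * _).
have h1 := slitM hp (slit_cpow x).
have h2 := decayM dp (bounded_cpow x).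
have d0 : (cst c : R -> R)^`()%classic = cst 0.
  by apply/funext => t; rewrite derive1E derive_cst.
have hc : contour (cst c : R -> R).
  split; first by move=> t; exact: derivable_cst.
    by rewrite d0 => t; exact: cvg_cst.
  by exists `|c|.
have e1 t : (phi (c +i* t) * cpow x (c +i* t)) * ((cst c : R -> R)^`()%classic t +i* 1) =
   ii * (phi (c +i* t) * cpow x (c +i* t)) by rewrite d0 mulrC.
have mT : measurable [set: R] by exact: measurableT.
have iv := vertical_integrable h1 h2 cl.
have := contour_integral_eq h1 h2 hc cl' cl.
rewrite (eq_cintegral (fun t _ => e1 t)) (cintegralZ _ mT iv).
move=> h; have {}h := h (eq_cintegrable mT (fun t _ => esym (e1 t)) (cintegrableZ ii mT iv)).
apply: (mulfI _ h); apply/eqP => /(congr1 (@complex.Im R)) /= /eqP.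
by rewrite oner_eq0.
Qed.

(** The modulus of x^s is constant on the line and leaves the integral. *)
Lemma normc_mellin_line (phi : R[i] -> R[i]) (c : R) :
  cintegrable setT (fun t => phi (c +i* t)) ->
  exists2 B : R, 0 <= B & forall x, normc (mellin_line c phi x) <= B * expR (c * ln x).
Proof.
move=> ip; have mT : measurable [set: R] by exact: measurableT.
have in_ := cintegrable_normc mT ip.
pose I := \int[mu]_t normc (phi (c +i* t)).
have I0 : 0 <= I by apply: Rintegral_ge0 => t _; exact: normc_ge0.
exists ((2 * pi)^-1 * (2 * I)) => [|x].
  by rewrite !mulr_ge0// invr_ge0 ltW// two_pi_gt0.
rewrite /mellin_line normcM normc_real ger0_norm; last first.
  by rewrite invr_ge0 ltW// two_pi_gt0.
rewrite -mulrA ler_wpM2l ?invr_ge0 ?(ltW two_pi_gt0)//.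
have h := normc_cintegral_le mT (mellin_line_integrable ip x)
  (g := fun t => expR (c * ln x) * normc (phi (c +i* t))).
apply: le_trans (h _ _) _.
- by move=> t _; rewrite normcM normc_cpow mulrC.
- exact: integrableZl_fin.
- by rewrite RintegralZl// -/I mulrCA [_ * expR _]mulrC mulrA.
Qed.

(** Gamma(b - s), put in the form a + k s of the lemmas on affine arguments. *)
Definition gline (b : R) (s : R[i]) : R[i] := cGamma (b%:C + (-1)%:C * s).

Lemma pos_strip_gline (l b r : R) : r <= b -> pos_strip l r b (-1).
Proof. by move=> rb x /andP[_ xr]; rewrite mulN1r subr_gt0 (lt_le_trans xr). Qed.

Lemma N1_neq0 : (-1 : R) != 0.
Proof. by rewrite oppr_eq0 oner_eq0. Qed.

Lemma slit_gline (l b r : R) : r <= b -> slit_holomorphic l r (gline b).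
Proof. by move=> rb; apply: slit_cGamma N1_neq0 (pos_strip_gline rb). Qed.

Lemma decay_gline (b : R) : strip_decay (gline b).
Proof. exact: decay_cGamma N1_neq0. Qed.

Lemma integrable_gline (b c : R) : c < b -> cintegrable setT (fun t => gline b (c +i* t)).
Proof.
move=> cb; apply: (@vertical_integrable _ (c - 1) b) => //.
- exact: slit_gline.
- exact: decay_gline.
- by rewrite cb andbT ltrBlDr ltrDl.
Qed.

Definition gam (b c x : R) : R[i] := mellin_line c (gline b) x.

Lemma gam_shift (b c c' x : R) : c < b -> c' < b -> gam b c x = gam b c' x.
Proof.
move=> cb cb'; pose l := Num.min c c' - 1.
have h1 : Num.min c c' <= c by rewrite ge_min lexx.
have h2 : Num.min c c' <= c' by rewrite ge_min lexx orbT.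
have lc : l < c by rewrite /l; lra.
have lc' : l < c' by rewrite /l; lra.
apply: (@mellin_line_shift l b); rewrite ?lc ?lc'//.
  exact: slit_gline.
exact: decay_gline.
Qed.

Lemma cpow_1 (x : R) : 0 < x -> cpow x 1 = x%:C.
Proof.
by move=> x0; rewrite (_ : 1 = (1 : R)%:C)// cpow_real// powRr1// ltW.
Qed.

(** The substitution s -> s + 1 leaves Gamma(b - s) and produces one factor x. *)
Lemma gam_succ (b c x : R) : 0 < x -> c - 1 < b ->
  gam (b + 1) c x = x%:C * gam b (c - 1) x.
Proof.
move=> x0 cb; rewrite /gam /mellin_line mulrCA; congr (_ * _).
have mT : measurable [set: R] by exact: measurableT.
rewrite -(cintegralZ _ mT (mellin_line_integrable (integrable_gline cb) x)).
apply: eq_cintegral => t _; rewrite /gline.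
have e1 : c +i* t = ((c - 1) +i* t) + 1 by apply: complex_eq; rewrite !cReImE /=; ring.
rewrite e1 cpowD cpow_1// realCD.
have -> : (b%:C + 1%:C + (-1)%:C * (((c - 1) +i* t) + 1)) = b%:C + (-1)%:C * ((c - 1) +i* t) :> R[i].
  by apply: complex_eq; rewrite !cReImE /=; ring.
by ring.
Qed.

Lemma cintegral_cpow_segment (s : R[i]) (x X : R) : 0 < x < X -> s != 0 ->
  cintegral `[x, X] (fun y => cpow y (s - 1)) = (cpow X s - cpow x s) / s.
Proof.
move=> /andP[x0 xX] s0.
have pos y : x <= y <= X -> 0 < y by move=> /andP[h _]; apply: lt_le_trans h.
have dF y : x <= y <= X -> cderive (fun y => s^-1 * cpow y s) y (cpow y (s - 1)).
  move=> /pos y0; apply: cderive_eq (cderiveZ s^-1 (cderive_cpow s y0)) _.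
  by rewrite mulrA mulVf// mul1r.
have [_ ->] := cFTC_segment xX dF
  (fun y xy => cderive_continuous (cderive_cpow (s - 1) (pos y xy))).
by rewrite mulrBl ![_ / s]mulrC.
Qed.

(** Expected to be a multiple of e^-x, which is proved through a differential equation. *)
Definition gnorm (b c x : R) : R[i] := cpow x (- b)%:C * gam b c x.

(** The equation g' = -g in integral form. By [gam_succ] the integrand is y^(-b-1) times the
    function for b + 1; integrating the power of y leaves a denominator s - b, which the recurrence
    of Gamma cancels up to sign. *)
Lemma gnorm_int (b c x X : R) : c < b -> 0 < x -> x < X ->
  cintegrable `[x, X] (gnorm b c) /\
  cintegral `[x, X] (gnorm b c) = gnorm b c x - gnorm b c X.
Proof.
move=> cb x0 xX.
have mT : measurable [set: R] by exact: measurableT.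
have cb1 : c - 1 < b by lra.
have cb2 : c < b + 1 by lra.
pose w y : R := expR ((- b - 1) * ln y).
have mD : measurable (`[x, X]%classic : set R) by exact: measurable_itv.
have mln : measurable_fun setT (fun y : R => (- b - 1) * ln y).
  by apply: measurable_funM; [exact: measurable_cst|exact: measurable_ln].
have mw : measurable_fun setT w by apply: measurableT_comp mln; exact: measurable_expR.
have iw : mu.-integrable `[x, X] (EFin \o (fun y => w y * expR (c * ln y))).
  have h y : x <= y <= X -> {for y, continuous (fun y => w y * expR (c * ln y))}.
    move=> /andP[xy _]; have y0 : 0 < y by apply: lt_le_trans xy.
    have ce k : {for y, continuous (fun y : R => expR (k * ln y))}.
      apply: (@continuous_comp _ _ _ (fun y : R => k * ln y) expR); last exact: continuous_expR.
      by apply: cvgM; [exact: cvg_cst|exact: continuous_ln].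
    by apply: cvgM; exact: ce.
  apply: continuous_compact_integrable; first exact: segment_compact.
  by apply: continuous_in_subspaceT => y /[!inE] /=; rewrite in_itv/=; exact: h.
have [ie e] := mellin_line_fubini (integrable_gline cb2) mD mw
   (@measurable_id _ _ setT) (fun y _ => expR_ge0 _) iw.
have wE y : (w y)%:C = cpow y (- b - 1)%:C by rewrite cpowE -realCM cexp_real.
have eL y : `[x, X]%classic y -> gnorm b c y = (w y)%:C * mellin_line c (gline (b + 1)) y.
  rewrite /= in_itv/= => /andP[xy _]; have y0 : 0 < y by apply: lt_le_trans xy.
  rewrite -/(gam (b + 1) c y) gam_succ// (gam_shift y cb1 cb) wE mulrA /gnorm.
  congr (_ * _); rewrite -(cpow_1 y0) -cpowD; congr cpow.
  by rewrite -real1C -realCD subrK.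
split; first exact: (eq_cintegrable mD (fun y h => esym (eL y h)) ie).
rewrite (eq_cintegral eL) e /gnorm /gam /mellin_line.
rewrite ![cpow _ (- b)%:C * _]mulrCA -mulrBr; congr (_ * _).
have ib := integrable_gline cb.
have ix := mellin_line_integrable ib x; have iX := mellin_line_integrable ib X.
rewrite -(cintegralZ _ mT ix) -(cintegralZ _ mT iX).
rewrite -(cintegralB mT (cintegrableZ _ mT ix) (cintegrableZ _ mT iX)).
apply: eq_cintegral => t _.
pose s : R[i] := c +i* t.
have sb : s - b%:C != 0.
  apply/eqP => /(congr1 (@complex.Re R)); rewrite !cReImE /= => h; lra.
have -> : cintegral `[x, X] (fun y => (w y)%:C * cpow y s) =
   (cpow X (s - b%:C) - cpow x (s - b%:C)) / (s - b%:C).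
  rewrite -cintegral_cpow_segment ?x0//; apply: eq_cintegral => y _.
  rewrite wE -cpowD; congr cpow.
  by rewrite (_ : (- b - 1)%:C = - b%:C - 1)//; [ring|rewrite realCD !realCN].
have -> : gline (b + 1) s = (b%:C - s) * gline b s.
  rewrite /gline [in RHS]cGamma_rec.
  have -> : b%:C + (-1)%:C * s = b%:C - s by rewrite realCN mulNr mul1r.
  have -> : (b + 1)%:C + (-1)%:C * s = b%:C - s + 1.
    by rewrite realCN mulNr mul1r realCD; ring.
  rewrite mulrCA divff ?mulr1//; rewrite -opprB oppr_eq0//.
have eN y : cpow y (s - b%:C) = cpow y s * cpow y (- b)%:C by rewrite cpowD realCN.
rewrite !eN -/s; field.
exact: sb.
Qed.

End GammaLine.

Section GammaLineValue.
Context {R : realType}.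
Local Notation mu := (@lebesgue_measure R).

Lemma normc_cintegral_segment (f : R -> R[i]) (x X B : R) : x < X ->
  cintegrable `[x, X] f -> (forall y, x <= y <= X -> normc (f y) <= B) ->
  normc (cintegral `[x, X] f) <= 2 * (B * (X - x)).
Proof.
move=> xX if_ fB.
have m01 : measurable (`[x, X]%classic : set R) by exact: measurable_itv.
have iB : mu.-integrable `[x, X] (EFin \o (fun=> B)).
  apply: continuous_compact_integrable; first exact: segment_compact.
  by apply: continuous_subspaceT => y; exact: cvg_cst.
apply: le_trans (normc_cintegral_le m01 if_ _ iB) _.
  by move=> y; rewrite /= in_itv/=; exact: fB.
rewrite ler_wpM2l//.
suff -> : \int[mu]_(y in `[x, X]) B = B * (X - x) by [].
transitivity (B * fine (mu `[x, X]%classic)); first exact: Rintegral_cst.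
by rewrite lebesgue_measure_itv/= lte_fin xX.
Qed.

Lemma cintegral_cst (x X : R) (a : R[i]) : x < X ->
  cintegrable `[x, X] (fun=> a) /\ cintegral `[x, X] (fun=> a) = (X - x)%:C * a.
Proof.
move=> xX.
have dF y : x <= y <= X -> cderive (fun y => y%:C * a) y a.
  move=> _; apply: cderive_eq (cderiveM (cderive_real (is_derive_id y 1)) (cderive_cst a y)) _.
  by rewrite mulr0 add0r real1C mul1r.
have [h1 h2] := cFTC_segment xX dF (fun y _ => ccontinuous_cst a y).
by split => //; rewrite h2 -mulrBl -realCN -realCD.
Qed.

(** Bootstrap from the integral equation: a local bound gives a Lipschitz bound, and this continuity
    gives the derivative. *)
Lemma gnorm_cderive (b c x : R) : c < b -> 0 < x ->
  cderive (gnorm b c) x (- gnorm b c x).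
Proof.
move=> cb x0.
have [B B0 hB] := normc_mellin_line (integrable_gline cb).
(* A crude bound on [x/2, 2x], where [ln y] lies between the logarithms of the ends. *)
pose M := B * expR (`|c - b| * (ln (2 * x) - ln (x / 2)) + `|c - b| * (`|ln (2 * x)| + `|ln (x/2)|)).
have M0 : 0 <= M by rewrite mulr_ge0 ?expR_ge0.
have kM y : x / 2 <= y <= 2 * x -> normc (gnorm b c y) <= M.
  move=> /andP[y1 y2].
  have x20 : 0 < x / 2 by rewrite divr_gt0.
  have y0 : 0 < y by apply: lt_le_trans y1.
  have l1 : ln (x / 2) <= ln y by rewrite ler_ln ?posrE.
  have l2 : ln y <= ln (2 * x) by rewrite ler_ln ?posrE// mulr_gt0.
  rewrite /gnorm normcM normc_cpow /= mulrC.
  apply: le_trans (ler_wpM2r (expR_ge0 _) (hB y)) _.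
  rewrite -mulrA -expRD ler_wpM2l// ler_expR -mulrDl.
  have h : (c + - b) * ln y <= `|c - b| * `|ln y| by rewrite -normrM ler_norm.
  apply: (le_trans h); rewrite -mulrDr ler_wpM2l//.
  have h1 := ler_norm (ln (2 * x)); have h2 := ler_norm (- ln (x / 2)).
  rewrite normrN in h2.
  have := normr_ge0 (ln (2 * x)); have := normr_ge0 (ln (x / 2)).
  by rewrite ler_norml; lra.
have lip y z : x / 2 <= y -> y < z -> z <= 2 * x ->
    normc (gnorm b c z - gnorm b c y) <= 2 * (M * (z - y)).
  move=> xy yz zx; have y0 : 0 < y by apply: lt_le_trans xy; rewrite divr_gt0.
  have [ig e] := gnorm_int cb y0 yz.
  rewrite normcBC -e; apply: normc_cintegral_segment => // w /andP[w1 w2].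
  by apply: kM; rewrite (le_trans xy)//= (le_trans w2).
apply: cderive_eps => e e0.
(* The first bound keeps X inside [x/2, 2x], the second makes 4 M |X - x| at most e. *)
pose del := Num.min (x / 2) (e / (4 * (M + 1))).
have M10 : 0 < 4 * (M + 1) by rewrite mulr_gt0// ltr_wpDl.
exists del; first by rewrite lt_min !divr_gt0.
move=> X; rewrite lt_min => /andP[]; rewrite ltr_norml => /andP[X1 X2] X3.
have Me : 4 * M * `|X - x| <= e.
  apply: (@le_trans _ _ (`|X - x| * (4 * (M + 1)))).
    by rewrite mulrC ler_wpM2l//; lra.
  by rewrite -ler_pdivlMr// ltW.
have [XltX|XgtX|->] := ltgtP X x; last first.
- by rewrite !subrr mul0r subr0 normc0 normr0 mulr0.
- have [ig eg] := gnorm_int cb x0 XgtX.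
  have [ic ec] := cintegral_cst (gnorm b c x) XgtX.
  have mX : measurable (`[x, X]%classic : set R) by exact: measurable_itv.
  have -> : gnorm b c X - gnorm b c x - (X - x)%:C * - gnorm b c x =
     - (cintegral `[x, X] (fun y => gnorm b c y - gnorm b c x)).
    by rewrite (cintegralB mX ig ic) eg ec; ring.
  rewrite normcN; apply: le_trans (normc_cintegral_segment XgtX
    (cintegrableB mX ig ic) (B := 2 * (M * `|X - x|)) _) _.
    move=> y /andP[y1 y2]; move: y1; rewrite le_eqVlt => /predU1P[<-|y1].
      by rewrite subrr normc0 !mulr_ge0.
    apply: le_trans (lip _ _ _ y1 _) _; try lra.
    rewrite ler_wpM2l// ler_wpM2l// (le_trans _ (ler_norm _))//; lra.
  have nX : `|X - x| = X - x by rewrite gtr0_norm ?subr_gt0.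
  have -> : 2 * (2 * (M * `|X - x|) * (X - x)) = 4 * M * `|X - x| * `|X - x|.
    by rewrite nX; ring.
  by rewrite ler_wpM2r.
- have X0 : 0 < X by lra.
  have [ig eg] := gnorm_int cb X0 XltX.
  have [ic ec] := cintegral_cst (gnorm b c x) XltX.
  have mX : measurable (`[X, x]%classic : set R) by exact: measurable_itv.
  have -> : gnorm b c X - gnorm b c x - (X - x)%:C * - gnorm b c x =
     cintegral `[X, x] (fun y => gnorm b c y - gnorm b c x).
    rewrite (cintegralB mX ig ic) eg ec (_ : (x - X)%:C = - (X - x)%:C); first by ring.
    by rewrite -realCN opprB.
  apply: le_trans (normc_cintegral_segment XltX
    (cintegrableB mX ig ic) (B := 2 * (M * `|X - x|)) _) _.
    move=> y /andP[y1]; rewrite le_eqVlt => /predU1P[->|y2].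
      by rewrite subrr normc0 !mulr_ge0.
    rewrite normcBC; apply: le_trans (lip _ _ _ y2 _) _; try lra.
    by rewrite ler_wpM2l// ler_wpM2l// distrC (le_trans _ (ler_norm _))//; lra.
  have nX : `|X - x| = x - X by rewrite distrC gtr0_norm ?subr_gt0.
  have -> : 2 * (2 * (M * `|X - x|) * (x - X)) = 4 * M * `|X - x| * `|X - x|.
    by rewrite nX; ring.
  by rewrite ler_wpM2r.
Qed.

Lemma gnorm_exp (b c x y : R) : c < b -> 0 < x -> x < y ->
  (expR y)%:C * gnorm b c y = (expR x)%:C * gnorm b c x.
Proof.
move=> cb x0 xy.
have d z : x <= z <= y -> cderive (fun z => (expR z)%:C * gnorm b c z) z 0.
  move=> /andP[xz _]; have z0 : 0 < z by apply: lt_le_trans xz.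
  apply: cderive_eq (cderiveM (cderive_real (is_derive_expR z)) (gnorm_cderive cb z0)) _.
  by rewrite mulrN addNr.
have [_ e] := cFTC_segment xy d (fun z _ => ccontinuous_cst 0 z).
have [_ e0] := cintegral_cst (0 : R[i]) xy.
by apply/eqP; rewrite -subr_eq0 -e e0 mulr0.
Qed.

Lemma Rintegral_odd (h : R -> R) : continuous h ->
  mu.-integrable setT (EFin \o h) -> (forall t, h (- t) = - h t) ->
  \int[mu]_t h t = 0.
Proof.
move=> ch ih oh.
have mT : measurable [set: R] by exact: measurableT.
have cv : (fun n => \int[mu]_(t in `[- n.+1%:R, n.+1%:R]) h t) @ \oo --> \int[mu]_t h t.
  apply: (@cvg_integral_exhaustion R (fun n => `[- n.+1%:R, n.+1%:R]%classic)) => //.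
    move=> n m nm; apply/subsetPset => x /=; rewrite !in_itv/= => /andP[h1 h2].
    by rewrite (le_trans (homo_NS1 nm) h1) (le_trans h2 (homo_S1 nm)).
  exact: bigcup_itvT.
have z n : \int[mu]_(t in `[- n.+1%:R, n.+1%:R]) h t = 0.
  have ih1 : mu.-integrable `[- n.+1%:R, n.+1%:R] (EFin \o h).
    exact: (@integrableS _ _ _ mu setT _ _ mT (measurable_itv _) (@subsetT _ _) ih).
  have := @integration_by_substitution_oppr R h (- n.+1%:R) n.+1%:R (ltW (ltr_NS1 n)).
  rewrite opprK => /(_ (continuous_subspaceT ch)).
  set D : set R := `[- n.+1%:R, n.+1%:R]%classic.
  have mD : measurable D by exact: measurable_itv.
  rewrite (EFin_Rintegral mD ih1).
  have -> : (\int[mu]_(x in D) ((h \o -%R) x)%:E)%E = (\int[mu]_(x in D) (-1 * h x)%:E)%E.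
    by apply: eq_integral => x _; rewrite /= oh mulN1r.
  rewrite (EFin_Rintegral mD (integrableZl_fin (-1) mD ih1)).
  rewrite RintegralZl// => -[]; lra.
have cv0 : (fun n => \int[mu]_(t in `[- n.+1%:R, n.+1%:R]) h t) @ \oo --> (0 : R).
  by under eq_fun do rewrite z; exact: cvg_cst.
by rewrite -(cvg_lim (@Rhausdorff R) cv); exact: (cvg_lim (@Rhausdorff R) cv0).
Qed.

Lemma conjc_gline (b c t : R) : c < b ->
  gline b (c +i* (- t)) = conjc (gline b (c +i* t)).
Proof.
move=> cb; rewrite /gline.
have e : b%:C + (-1)%:C * (c +i* (- t)) = conjc (b%:C + (-1)%:C * (c +i* t)).
  by apply: complex_eq; rewrite /= ; ring.
have p : 0 < complex.Re (b%:C + (-1)%:C * (c +i* t)) by rewrite !cReImE /=; lra.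
have p' : 0 < complex.Re (b%:C + (-1)%:C * (c +i* (- t))) by rewrite !cReImE /=; lra.
by rewrite !cGamma_euler// e conjc_euler.
Qed.

(** Conjugation reverses t, so the imaginary part of the integrand is odd. *)
Lemma gam1_real (b c : R) : c < b -> complex.Im (gam b c 1) = 0.
Proof.
move=> cb; rewrite /gam /mellin_line cImM /= mul0r addr0.
apply/eqP; rewrite mulf_eq0; apply/orP; right; apply/eqP.
have cp1 t : cpow 1 (c +i* t) = 1 by rewrite cpowE ln1 mulr0 cexp0.
have -> : \int[mu]_x complex.Im (gline b (c +i* x) * cpow 1 (c +i* x)) =
   \int[mu]_x complex.Im (gline b (c +i* x)).
  by apply: eq_Rintegral => t _; rewrite cp1 mulr1.
have lr : c - 1 < c < b by rewrite cb andbT; lra.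
have hs := @slit_gline R (c - 1) b b (lexx b).
apply: Rintegral_odd.
- by move=> t; have [_] := vertical_continuous t hs lr.
- by have [_] := integrable_gline cb.
- by move=> t; rewrite conjc_gline//; case: (gline b _).
Qed.

(* The constant is 1 by Mellin inversion, but its value is never needed: its
   sign follows from the total mass of the density. *)
Lemma gam_value (b : R) : exists k : R, forall c x : R, c < b -> 0 < x ->
  gam b c x = (k * (expR (b * ln x) * expR (- x)))%:C.
Proof.
have b1 : b - 1 < b by lra.
pose k := expR 1 * complex.Re (gam b (b - 1) 1).
have g1 c : c < b -> gnorm b c 1 = (complex.Re (gam b (b - 1) 1))%:C.
  move=> cb; rewrite /gnorm cpowE ln1 mulr0 cexp0 mul1r (gam_shift 1 cb b1).
  by apply: complex_eq; [by []|exact: gam1_real].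
exists k => c x cb x0.
have eE y : (expR (- y))%:C * (expR y)%:C = 1 :> R[i].
  by rewrite -realCM -expRD addNr expR0.
have h : (expR x)%:C * gnorm b c x = k%:C.
  have -> : k%:C = (expR 1)%:C * gnorm b c 1 by rewrite g1// -realCM.
  have [x1|x1|->//] := ltgtP x 1.
    by rewrite (gnorm_exp cb x0 x1).
  by rewrite (gnorm_exp cb ltr01 x1).
have -> : gam b c x = cpow x b%:C * gnorm b c x.
  by rewrite /gnorm mulrA -cpowD -realCD subrr cpowE mul0r cexp0 mul1r.
have -> : gnorm b c x = (expR (- x))%:C * k%:C.
  by rewrite -h mulrA eE mul1r.
rewrite cpowE -realCM cexp_real -!realCM; congr (_%:C); ring.
Qed.

End GammaLineValue.

(** * Mellin transforms of the weights *)

Section Weights.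
Context {R : realType}.
Local Notation mu := (@lebesgue_measure R).
Local Notation Dp := (`]0, +oo[%classic : set R).

Lemma homo_cst (X : R) : {homo (fun _ : nat => X) : n m / (n <= m)%N >-> n <= m}.
Proof. by []. Qed.

Lemma homo_divS2 (X : R) : 0 < X ->
  {homo (fun n => X / n.+2%:R) : n m / (n <= m)%N >-> m <= n}.
Proof. by move=> X0 n m nm; rewrite ler_pM2l//; exact: homo_invS2. Qed.

Lemma ltr_divS2 (X : R) (n : nat) : 0 < X -> X / n.+2%:R < X.
Proof. by move=> X0; rewrite gtr_pMr// invf_lt1 ?ltr0n// ltr1n. Qed.

Lemma itv0cP (X y : R) : `]0, X]%classic y <-> 0 < y <= X.
Proof. by rewrite /= in_itv. Qed.

Lemma measurable_expR_ln (k : R) (D : set R) :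
  measurable_fun D (fun y : R => expR (k * ln y)).
Proof.
apply: measurable_funTS; apply: measurableT_comp; first exact: measurable_expR.
by apply: measurable_funM; [exact: measurable_cst|exact: measurable_ln].
Qed.

Lemma is_derive_expR_ln (a y : R) : 0 < y ->
  is_derive y 1 (fun y => expR (a * ln y)) (a * expR ((a - 1) * ln y)).
Proof.
move=> y0.
have l := is_deriveZ a (is_derive1_ln y0).
apply: is_derive1_ext (is_derive1_comp (g := fun v => a * ln v) (is_derive_expR (a * ln y)) l) _ _ => //.
rewrite mulrBl mul1r expRD expRN lnK ?posrE//.
by rewrite /GRing.scale /=; ring.
Qed.

Lemma integrable_pow (a X : R) : 0 < a -> 0 < X ->
  mu.-integrable `]0, X] (EFin \o (fun y => expR ((a - 1) * ln y))).
Proof.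
move=> a0 X0.
pose H y := a^-1 * expR (a * ln y).
have dH y : `]0, X]%classic y -> is_derive y 1 H (expR ((a - 1) * ln y)).
  move=> /itv0cP /andP[y0 _].
  apply: is_derive1_ext (is_deriveZ a^-1 (is_derive_expR_ln a y0)) _ _ => //.
  by rewrite /GRing.scale /= mulrA mulVf ?gt_eqF// mul1r.
have ch y : `]0, X]%classic y -> {for y, continuous (fun y => expR ((a - 1) * ln y))}.
  by move=> /itv0cP /andP[y0 _]; exact: is_derive_continuous_at (is_derive_expR_ln _ y0).
have HB x y : `]0, X]%classic x -> `]0, X]%classic y -> H x - H y <= a^-1 * expR (a * ln X).
  move=> /itv0cP /andP[x0 xX] _.
  have : H x <= a^-1 * expR (a * ln X).
    by rewrite ler_wpM2l ?invr_ge0 ?(ltW a0)// ler_expR ler_wpM2l ?(ltW a0)// ler_ln ?posrE.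
  have : 0 <= H y by rewrite mulr_ge0 ?expR_ge0// invr_ge0 ltW.
  lra.
have [ih _] := improper_integrable (fun n => ltr_divS2 n X0) (homo_divS2 X0)
  (homo_cst X) (bigcup_itv0c X0) dH ch (@measurable_expR_ln (a - 1) _) (fun y _ => expR_ge0 _) HB.
exact: ih.
Qed.

Lemma cintegrable_cpow0 (s : R[i]) (X : R) : 0 < complex.Re s -> 0 < X ->
  cintegrable `]0, X] (fun y => cpow y (s - 1)).
Proof.
move=> s0 X0.
have m : measurable (`]0, X]%classic : set R) by exact: measurable_itv.
apply: (cintegrable_le m _ _ (integrable_pow s0 X0)).
  by apply: cmeasurable_cpow; exact: measurable_id.
by move=> y _; rewrite normc_cpow cReD cReN.
Qed.

Lemma cintegral_cpow0 (s : R[i]) (X : R) : 0 < complex.Re s -> 0 < X ->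
  cintegral `]0, X] (fun y => cpow y (s - 1)) = cpow X s / s.
Proof.
move=> s0 X0.
have sn0 : s != 0 by apply: contraTneq s0 => ->; rewrite ltxx.
pose F y := s^-1 * cpow y s.
have dF y : `]0, X]%classic y -> cderive F y (cpow y (s - 1)).
  move=> /itv0cP /andP[y0 _]; apply: cderive_eq (cderiveZ s^-1 (cderive_cpow s y0)) _.
  by rewrite mulrA mulVf// mul1r.
have cF y : `]0, X]%classic y -> ccontinuous_at (fun y => cpow y (s - 1)) y.
  by move=> /itv0cP /andP[y0 _]; exact: cderive_continuous (cderive_cpow _ y0).
have F0 : ccvg (F \o (fun n => X / n.+2%:R)) 0.
  apply: (@ccvg0_le _ _ (fun n => normc s^-1 * expR (complex.Re s * ln (X / n.+2%:R)))).
    by move=> n; rewrite -[(F \o _) n]/(F (X / n.+2%:R)) /F normcM normc_cpow.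
  rewrite -[X in _ --> X](mulr0 (normc s^-1)); apply: cvgM; first exact: cvg_cst.
  exact: cvg_expR_ln_0.
have := improper_cFTC (fun n => ltr_divS2 n X0) (homo_divS2 X0)
  (homo_cst X) (bigcup_itv0c X0) dF cF (cintegrable_cpow0 s0 X0) F0 (@ccvg_cst _ (F X)).
by move=> ->; rewrite subr0 /F mulrC.
Qed.

Lemma pow_expRN_le (a x : R) (k : nat) : 0 < a -> 0 <= x ->
  x ^+ k * expR (- (a * x)) <= k`!%:R / a ^+ k.
Proof.
move=> a0 x0.
rewrite ler_pdivlMr ?exprn_gt0// mulrAC -exprMn [x * a]mulrC.
have ax0 : 0 <= a * x by rewrite mulr_ge0// ltW.
rewrite expRN ler_pdivrMr ?expR_gt0//.
case: k => [|k].
  by rewrite expr0 fact0 mul1r -expR0 ler_expR.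
have h : (a * x) ^+ k.+1 / (k.+1)`!%:R <= expR (a * x).
  by apply: le_trans (expR_ge1Dxn k ax0); rewrite lerDr.
by move: h; rewrite ler_pdivrMr ?ltr0n ?fact_gt0// [expR _ * _]mulrC.
Qed.

Definition fogk (k : nat) (y : R) : R := ln y^-1 ^+ k.

Lemma fogk_ge0 k y : 0 < y <= 1 -> 0 <= fogk k y.
Proof.
by move=> /andP[y0 y1]; rewrite exprn_ge0// ln_ge0// -invf_le1 ?invr_gt0// invrK.
Qed.

(** Powers of the logarithm cost an arbitrarily small negative power of y; the constant comes from
    one term of the exponential series. *)
Lemma fogk_le (a y : R) (k : nat) : 0 < a -> 0 < y <= 1 ->
  fogk k y <= k`!%:R / a ^+ k * expR (- a * ln y).
Proof.
move=> a0 /andP[y0 y1].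
have L0 : 0 <= ln y^-1 by rewrite ln_ge0// -invf_le1 ?invr_gt0// invrK.
have := pow_expRN_le k a0 L0; rewrite -ler_pdivlMr ?expR_gt0//.
by rewrite -expRN opprK lnV ?posrE// mulrN mulNr /fogk lnV ?posrE.
Qed.

Lemma measurable_fogk k (D : set R) : measurable_fun D (fogk k).
Proof.
apply: measurable_funTS; apply: measurable_funX.
have -> : (fun y : R => ln y^-1) = (fun y => - ln y).
  apply/funext => y; have [y0|y0] := ltP 0 y; first by rewrite lnV// posrE.
  by rewrite !ln0 ?oppr0// invr_le0.
by apply: measurableT_comp => //; exact: measurable_ln.
Qed.

Lemma integrable_fogk (k : nat) (a : R) : 0 < a ->
  mu.-integrable `]0, 1] (EFin \o (fun y => fogk k y * expR ((a - 1) * ln y))).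
Proof.
move=> a0; have a20 : 0 < a / 2 by rewrite divr_gt0.
have m : measurable (`]0, 1]%classic : set R) by exact: measurable_itv.
apply: (integrable_le m (g := fun y => k`!%:R / (a / 2) ^+ k * expR ((a / 2 - 1) * ln y))).
- by apply: measurable_funM; [exact: measurable_fogk|exact: measurable_expR_ln].
- move=> y /itv0cP y01; rewrite ger0_norm; last by rewrite mulr_ge0 ?expR_ge0 ?fogk_ge0.
  apply: le_trans (ler_wpM2r (expR_ge0 _) (fogk_le k a20 y01)) _.
  rewrite -[leLHS]mulrA -expRD ler_wpM2l ?divr_ge0 ?exprn_ge0 ?(ltW a20)//.
  by rewrite ler_expR le_eqVlt; apply/orP; left; apply/eqP; field.
- by apply: (integrableZl_fin _ m); exact: integrable_pow.
Qed.

(** Primitive of ln(1/y)^k y^(w-1), unfolded by repeated integration by parts; at y = 1 only the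
    last term survives. *)
Fixpoint fogF (w : R[i]) (k : nat) (y : R) : R[i] :=
  if k is k'.+1 then w^-1 * ((fogk k y)%:C * cpow y w + k%:R * fogF w k' y)
  else w^-1 * cpow y w.

Lemma fogF_cderive (w : R[i]) (k : nat) (y : R) : w != 0 -> 0 < y ->
  cderive (fogF w k) y ((fogk k y)%:C * cpow y (w - 1)).
Proof.
move=> w0 y0; elim: k => [|k IH].
  apply: cderive_eq (cderiveZ w^-1 (cderive_cpow w y0)) _.
  by rewrite mulrA mulVf// /fogk expr0.
have dl : is_derive y 1 (fogk k.+1) (- (k.+1%:R * fogk k y * y^-1)).
  have h1 : is_derive y 1 (fun y : R => ln y^-1) (- y^-1).
    have hy : 0 < y^-1 by rewrite invr_gt0.
    have hV := is_deriveV (f := fun y : R => y) (lt0r_neq0 y0) (is_derive_id y 1).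
    apply: is_derive1_ext (is_derive1_comp (g := fun y : R => y^-1) (is_derive1_ln hy) hV) _ _ => //.
    by rewrite /GRing.scale /=; field; rewrite gt_eqF.
  apply: is_derive1_ext (is_deriveX k.+1 h1) _ _.
    by move=> u; rewrite fctE.
  by rewrite /GRing.scale /= /fogk; ring.
have := cderiveZ w^-1 (cderiveD (cderiveM (cderive_real dl) (cderive_cpow w y0))
  (cderiveZ k.+1%:R IH)).
move/cderive_eq; apply.
have -> : cpow y w = y%:C * cpow y (w - 1).
  by rewrite -(cpow_1 y0) -cpowD addrC subrK.
rewrite realCN !realCM -natC realCV.
have yC : y%:C != 0 :> R[i] by apply/eqP => /(congr1 (@complex.Re R)) /=; apply/eqP; rewrite gt_eqF.
by field; rewrite yC w0.
Qed.

Lemma fogF_bound (w : R[i]) (k : nat) : 0 < complex.Re w ->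
  exists2 K : R, 0 <= K & forall y, 0 < y <= 1 ->
    normc (fogF w k y) <= K * expR (complex.Re w / 2 * ln y).
Proof.
move=> w0; set a := complex.Re w in w0 *.
have a20 : 0 < a / 2 by rewrite divr_gt0.
elim: k => [|k [K K0 hK]].
  exists (normc w^-1) => [|y /andP[y0 y1]]; first exact: normc_ge0.
  rewrite -[fogF _ _ _]/(w^-1 * cpow y w) normcM normc_cpow ler_wpM2l ?normc_ge0// ler_expR -/a.
  by rewrite ler_wnM2r ?ln_le0//; lra.
exists (normc w^-1 * ((k.+1)`!%:R / (a / 2) ^+ k.+1 + k.+1%:R * K)).
  by rewrite mulr_ge0 ?normc_ge0// addr_ge0 ?mulr_ge0 ?invr_ge0 ?exprn_ge0 ?(ltW a20).
move=> y y01; rewrite -[fogF _ _ _]/(w^-1 * ((fogk k.+1 y)%:C * cpow y w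
  + k.+1%:R * fogF w k y)) normcM -[leRHS]mulrA ler_wpM2l ?normc_ge0//.
apply: le_trans (ler_normcD _ _) _; rewrite mulrDl; apply: lerD.
  rewrite normcM normc_real normc_cpow -/a ger0_norm ?fogk_ge0//.
  apply: le_trans (ler_wpM2r (expR_ge0 _) (fogk_le k.+1 a20 y01)) _.
  rewrite -[leLHS]mulrA -expRD ler_wpM2l ?divr_ge0 ?exprn_ge0 ?(ltW a20)//.
  by rewrite ler_expR le_eqVlt; apply/orP; left; apply/eqP; field.
rewrite normcM natC normc_real ger0_norm// -[leRHS]mulrA ler_wpM2l//.
exact: hK.
Qed.

Lemma fogF1 (w : R[i]) (k : nat) : w != 0 -> fogF w k 1 = k`!%:R / w ^+ k.+1.
Proof.
move=> w0; have c1 : cpow 1 w = 1 by rewrite cpowE ln1 mulr0 cexp0.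
elim: k => [|k IH]; first by rewrite /= c1 fact0 expr1 mulr1 mul1r.
rewrite /= IH /fogk invr1 ln1 expr0n /= mul0r add0r factS natrM [in RHS]exprS.
by rewrite invfM; ring.
Qed.

Lemma cintegral_fog (w : R[i]) (k : nat) : 0 < complex.Re w ->
  cintegral `]0, 1] (fun y => (fogk k y)%:C * cpow y (w - 1)) = k`!%:R / w ^+ k.+1.
Proof.
move=> w0; have wn0 : w != 0 by apply: contraTneq w0 => ->; rewrite ltxx.
have m : measurable (`]0, 1]%classic : set R) by exact: measurable_itv.
have dF y : `]0, 1]%classic y -> cderive (fogF w k) y ((fogk k y)%:C * cpow y (w - 1)).
  by move=> /itv0cP /andP[y0 _]; exact: fogF_cderive.
have cF y : `]0, 1]%classic y -> ccontinuous_at (fun y => (fogk k y)%:C * cpow y (w - 1)) y.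
  move=> /itv0cP /andP[y0 _]; apply: ccontinuousM; last first.
    exact: cderive_continuous (cderive_cpow _ y0).
  apply: ccontinuous_real; apply: (@continuous_comp _ _ _ (fun y : R => ln y^-1) (fun t => t ^+ k)).
    apply: (@continuous_comp _ _ _ (fun y : R => y^-1) (@ln R)).
      by apply: cvgV; [rewrite gt_eqF|exact: cvg_id].
    by apply: continuous_ln; rewrite invr_gt0.
  exact: exprn_continuous.
have ic : cintegrable `]0, 1] (fun y => (fogk k y)%:C * cpow y (w - 1)).
  apply: (cintegrable_le m _ _ (integrable_fogk k w0)).
    apply: cmeasurableM; first by apply: cmeasurable_real; exact: measurable_fogk.
    by apply: cmeasurable_cpow; exact: measurable_id.
  move=> y /itv0cP y01; rewrite normcM normc_real normc_cpow ger0_norm ?fogk_ge0//.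
  by rewrite cReD cReN.
have [K K0 hK] := fogF_bound k w0.
have F0 : ccvg (fogF w k \o (fun n => 1 / n.+2%:R)) 0.
  apply: (@ccvg0_le _ _ (fun n => K * expR (complex.Re w / 2 * ln (1 / n.+2%:R)))).
    move=> n; apply: hK; rewrite divr_gt0 ?ltr0n//= ltW// ltr_divS2//.
  rewrite -[X in _ --> X](mulr0 K); apply: cvgM; first exact: cvg_cst.
  by apply: cvg_expR_ln_0; rewrite // divr_gt0.
have := improper_cFTC (fun n => ltr_divS2 n (@ltr01 R)) (homo_divS2 (@ltr01 R))
  (homo_cst 1) (bigcup_itv0c (@ltr01 R)) dF cF ic F0 (@ccvg_cst _ (fogF w k 1)).
by move=> ->; rewrite subr0 fogF1.
Qed.

End Weights.

Section Scaling.
Context {R : realType}.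
Local Notation mu := (@lebesgue_measure R).
Local Notation Dp := (`]0, +oo[%classic : set R).

Lemma integrable_segment (h : R -> R) (a b : R) :
  (forall x, a <= x <= b -> {for x, continuous h}) ->
  mu.-integrable `[a, b] (EFin \o h).
Proof.
move=> ch; apply: continuous_compact_integrable; first exact: segment_compact.
by apply: continuous_in_subspaceT => x /[!inE] /=; rewrite in_itv/=; exact: ch.
Qed.

Lemma scale_segment (h : R -> R) (q a b : R) : 0 < q -> a < b ->
  (forall x, q * a <= x <= q * b -> {for x, continuous h}) ->
  \int[mu]_(x in `[q * a, q * b]) h x = q * \int[mu]_(x in `[a, b]) h (q * x).
Proof.
move=> q0 ab ch.
have dq (x : R) : is_derive x 1 (fun x => q * x) q.
  by apply: is_derive1_ext (is_deriveZ q (is_derive_id x 1)) _ _;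
    rewrite /GRing.scale /= ?mulr1.
have dqE : (fun x : R => q * x)^`()%classic = cst q.
  by apply/funext => x; rewrite derive1E (derive_val (is_derive := dq x)).
have cq (x : R) : {for x, continuous (fun x => q * x)} by exact: is_derive_continuous_at (dq x).
have chq x : a <= x <= b -> {for x, continuous (fun x => h (q * x))}.
  move=> /andP[ax xb]; apply: (@continuous_comp _ _ _ (fun x => q * x) h x (cq x)).
  by apply: ch; rewrite !ler_pM2l// ax.
have mab : measurable (`[a, b]%classic : set R) by exact: measurable_itv.
have mqab : measurable (`[q * a, q * b]%classic : set R) by exact: measurable_itv.
have ihq := integrable_segment chq.
have := @integration_by_substitution_increasing R (fun x => q * x) h a b (ltW ab).
rewrite dqE => H.
have {}H := H _ _ _ _ _ _.
rewrite (EFin_Rintegral mqab (integrable_segment ch)) in H.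
apply: EFin_inj; rewrite H.
- rewrite -RintegralZl // -(EFin_Rintegral mab (integrableZl_fin q mab ihq)).
  by apply: eq_integral => x _; rewrite /= mulrC.
- by move=> x y _ _; rewrite ltr_pM2l.
- by move=> x _; exact: cvg_cst.
- exact: is_cvg_cst.
- exact: is_cvg_cst.
- split.
  + by move=> x _; case: (dq x).
  + exact: cvg_at_right_filter (cq a).
  + exact: cvg_at_left_filter (cq b).
- by apply: continuous_in_subspaceT => x /[!inE] /=; rewrite in_itv/=; exact: ch.
Qed.

Lemma scale_Dp (h : R -> R) (q : R) : 0 < q ->
  (forall x, 0 < x -> {for x, continuous h}) -> mu.-integrable Dp (EFin \o h) ->
  mu.-integrable Dp (EFin \o (fun x => h (q * x))) /\
  \int[mu]_(x in Dp) h (q * x) = q^-1 * \int[mu]_(x in Dp) h x.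
Proof.
move=> q0 ch ih.
have mDp := @measurable_Dp R.
pose A n : set R := `[n.+2%:R^-1, n.+2%:R]%classic.
have ndA : nondecreasing_seq A.
  move=> n m nm; apply/subsetPset => x; rewrite /A ?/B /= !in_itv/= => /andP[h1 h2].
  by rewrite (le_trans (homo_invS2 nm) h1) (le_trans h2 (homo_S2 R nm)).
have mA n : measurable (A n) by exact: measurable_itv.
have cA : \bigcup_n A n = Dp by exact: bigcup_itv0y.
have A0 n x : n.+2%:R^-1 <= x <= n.+2%:R -> 0 < x :> R.
  by move=> /andP[h1 _]; apply: lt_le_trans h1; rewrite invr_gt0 ltr0n.
have cq (g : R -> R) : (forall x, 0 < x -> {for x, continuous g}) ->
    forall x, 0 < x -> {for x, continuous (fun x => g (q * x))}.
  move=> cg x x0; apply: (@continuous_comp _ _ _ (fun x => q * x) g); last first.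
    by apply: cg; rewrite mulr_gt0.
  by apply: cvgM; [exact: cvg_cst|exact: cvg_id].
have seg (g : R -> R) n : (forall x, 0 < x -> {for x, continuous g}) ->
   \int[mu]_(x in `[q * n.+2%:R^-1, q * n.+2%:R]) g x =
   q * \int[mu]_(x in A n) g (q * x).
  move=> cg; apply: scale_segment => //; first exact: ltr_invS2.
  move=> x /andP[h1 _]; apply: cg; apply: lt_le_trans h1.
  by rewrite mulr_gt0// invr_gt0 ltr0n.
have ihq : mu.-integrable Dp (EFin \o (fun x => h (q * x))).
  pose g x := `|h x|.
  have cg x : 0 < x -> {for x, continuous g}.
    by move=> /ch cx; apply: (@continuous_comp _ _ _ h (fun t => `|t|) x cx); exact: norm_continuous.
  have ig : mu.-integrable Dp (EFin \o g) by exact: integrable_norm.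
  have mg : measurable_fun Dp (fun x => g (q * x)).
    apply: open_continuous_measurable_fun; first exact: interval_open.
    by move=> x /[!inE] /DpP x0; exact: cq.
  have [|igq _] := @integrable_exhaustion R A Dp (fun x => g (q * x))
    (q^-1 * \int[mu]_(x in Dp) g x) ndA mA cA mg (fun x _ => normr_ge0 _).
    move=> n; split.
      by apply: integrable_segment => x /A0 x0; exact: cq.
    rewrite ler_pdivlMl// -seg//.
    have sD : `[q * n.+2%:R^-1, q * n.+2%:R]%classic `<=` Dp.
      move=> x /=; rewrite !in_itv/= andbT => /andP[h1 _]; apply: lt_le_trans h1.
      by rewrite mulr_gt0// invr_gt0 ltr0n.
    have mS : measurable (`[q * n.+2%:R^-1, q * n.+2%:R]%classic : set R) by exact: measurable_itv.
    rewrite -lee_fin -!EFin_Rintegral//; last exact: (@integrableS _ _ _ mu Dp _ _ mDp mS sD ig).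
    apply: ge0_subset_integral => //.
      by case/integrableP : ig.
    by move=> x _; rewrite lee_fin normr_ge0.
  apply: (integrable_le mDp _ _ igq); last by move=> x _.
  apply: open_continuous_measurable_fun; first exact: interval_open.
  by move=> x /[!inE] /DpP x0; exact: cq.
split => //.
have cv1 := cvg_integral_exhaustion ndA mA cA ihq.
pose B n : set R := `[q * n.+2%:R^-1, q * n.+2%:R]%classic.
have ndB : nondecreasing_seq B.
  move=> n m nm; apply/subsetPset => x; rewrite /A ?/B /= !in_itv/= => /andP[h1 h2].
  rewrite (le_trans _ h1) ?ler_pM2l ?homo_invS2//=.
  by rewrite (le_trans h2)// ler_pM2l ?homo_S2.
have mB n : measurable (B n) by exact: measurable_itv.
have cB : \bigcup_n B n = Dp.
  apply/seteqP; split => [x [n _]|x].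
    rewrite /B /= !in_itv/= andbT => /andP[h1 _]; apply: lt_le_trans h1.
    by rewrite mulr_gt0// invr_gt0 ltr0n.
  move=> /DpP x0; have : Dp (x / q) by apply/DpP; rewrite divr_gt0.
  rewrite -cA => -[n _]; rewrite /A /= in_itv/= => /andP[h1 h2].
  exists n => //; rewrite /B /= in_itv/=.
  by rewrite mulrC -ler_pdivlMr// h1 /= mulrC -ler_pdivrMr.
have cv2 := cvg_integral_exhaustion ndB mB cB ih.
have cv3 : (fun n => q^-1 * \int[mu]_(x in B n) h x) @ \oo --> q^-1 * \int[mu]_(x in Dp) h x.
  by apply: cvgM => //; exact: cvg_cst.
have e n : q^-1 * \int[mu]_(x in B n) h x = \int[mu]_(x in A n) h (q * x).
  by rewrite /B seg// mulrA mulVf ?gt_eqF// mul1r.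
move: cv3; under eq_fun do rewrite e.
move=> cv3; rewrite -(cvg_lim (@Rhausdorff R) cv1).
exact: (cvg_lim (@Rhausdorff R) cv3).
Qed.

(** With z = p + s/t the factor q^-z splits into q^-p, compensated by the normalisation of the
    average, and q^(-s/t), which enters the argument of the H-function. *)
Lemma euler_scaled (q : R) (z : R[i]) : 0 < q -> 0 < complex.Re z ->
  cintegral Dp (fun x => (expR (- (q * x)))%:C * cpow x (z - 1)) =
  cpow q (- z) * euler_integral z.
Proof.
move=> q0 z0.
have mDp := @measurable_Dp R.
have cE x : 0 < x -> ccontinuous_at (Eker z) x.
  move=> x0; apply: ccontinuousM; last exact: cderive_continuous (cderive_cpow _ x0).
  apply: ccontinuous_real; apply: (@continuous_comp _ _ _ -%R expR); last exact: continuous_expR.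
  exact: opp_continuous.
have [i1 i2] := cintegrable_Eker z0.
have [j1 e1] := scale_Dp q0 (fun x x0 => proj1 (cE x x0)) i1.
have [j2 e2] := scale_Dp q0 (fun x x0 => proj2 (cE x x0)) i2.
have e : cintegral Dp (fun x => Eker z (q * x)) = (q^-1)%:C * euler_integral z.
  apply: complex_eq.
    by rewrite cReM /= mul0r subr0; exact: e1.
  by rewrite cImM /= mul0r addr0; exact: e2.
have -> : cintegral Dp (fun x => (expR (- (q * x)))%:C * cpow x (z - 1)) =
   cintegral Dp (fun x => cpow q (1 - z) * Eker z (q * x)).
  apply: eq_cintegral => x /DpP x0; rewrite /Eker cpowM// mulrCA; congr (_ * _).
  rewrite mulrA -cpowD (_ : 1 - z + (z - 1) = 0); last by ring.
  by rewrite [cpow q 0]cpowE mul0r cexp0 mul1r.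
have ic : cintegrable Dp (fun x => Eker z (q * x)) by split.
rewrite (cintegralZ _ mDp ic) e mulrA; congr (_ * _).
rewrite cpowD cpow_1// mulrAC -realCM divff ?gt_eqF//.
by rewrite real1C mul1r.
Qed.

Lemma integrable_gker_scaled (q s : R) : 0 < q -> 0 < s ->
  mu.-integrable Dp (EFin \o (fun x => expR (- (q * x)) * expR ((s - 1) * ln x))).
Proof.
move=> q0 s0.
have mDp := @measurable_Dp R.
have cE x : 0 < x -> {for x, continuous (gker s)}.
  move=> x0; apply: cvgM; last exact: is_derive_continuous_at (is_derive_expR_ln _ x0).
  apply: (@continuous_comp _ _ _ -%R expR); last exact: continuous_expR.
  exact: opp_continuous.
have [j1 _] := scale_Dp q0 cE (integrable_gker s0).
have ig := integrableZl_fin (expR (- ((s - 1) * ln q))) mDp j1.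
apply: eq_integrable ig => // x /[!inE] /DpP x0 /=; congr EFin.
rewrite /gker lnM ?posrE// mulrCA; congr (_ * _).
by rewrite -expRD; congr expR; ring.
Qed.

End Scaling.

(** * One step of the chain of transforms; lower bounds by boxes *)

Section MellinStep.
Context {R : realType}.
Local Notation mu := (@lebesgue_measure R).

Lemma cRe_scale (x : R) (z : R[i]) : complex.Re (x%:C * z) = x * complex.Re z.
Proof. by case: z => a b /=; rewrite mul0r subr0. Qed.

Lemma cIm_scale (x : R) (z : R[i]) : complex.Im (x%:C * z) = x * complex.Im z.
Proof. by case: z => a b /=; rewrite mul0r addr0. Qed.

(** Real-valuedness is passed along with the value, so that afterwards only real parts have to be
    integrated against the next weight. *)
Lemma mellin_step (c : R) (phi N : R[i] -> R[i]) (D : set R) (w el : R -> R) (X : R) :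
  cintegrable setT (fun t => phi (c +i* t)) -> measurable D ->
  measurable_fun setT w -> measurable_fun setT el -> (forall y, D y -> 0 <= w y) ->
  mu.-integrable D (EFin \o (fun y => w y * expR (c * ln (el y)))) ->
  (forall t, cintegral D (fun y => (w y)%:C * cpow (el y) (c +i* t)) =
     N (c +i* t) * cpow X (c +i* t)) ->
  [/\ mu.-integrable D (EFin \o (fun y => w y * complex.Re (mellin_line c phi (el y)))),
      complex.Re (mellin_line c (fun s => phi s * N s) X) =
        \int[mu]_(y in D) (w y * complex.Re (mellin_line c phi (el y))) &
      (forall y, D y -> complex.Im (mellin_line c phi (el y)) = 0) ->
        complex.Im (mellin_line c (fun s => phi s * N s) X) = 0].
Proof.
move=> ip mD mw ml w0 iw hN.
have [ig e] := mellin_line_fubini ip mD mw ml w0 iw.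
have e1 : mellin_line c (fun s => phi s * N s) X =
    cintegral D (fun y => (w y)%:C * mellin_line c phi (el y)).
  rewrite e /mellin_line; congr (_ * _); apply: eq_cintegral => t _.
  by rewrite hN mulrA.
have eRe y : complex.Re ((w y)%:C * mellin_line c phi (el y)) =
    w y * complex.Re (mellin_line c phi (el y)).
  exact: cRe_scale.
split.
- case: ig => i1 _; apply: eq_integrable i1 => // y _.
  exact: (congr1 EFin (eRe y)).
- rewrite e1; apply: eq_Rintegral => y _; exact: eRe.
- move=> im0; rewrite e1.
  transitivity (\int[mu]_(y in D) (0 : R)); last by rewrite Rintegral_cst// mul0r.
  by apply: eq_Rintegral => y /[!inE] Dy; rewrite cIm_scale im0// mulr0.
Qed.

(** Source of the lower bounds below. The boxes chosen have length comparable to their distance from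
    0, so that powers vary on them by a bounded factor only. *)
Lemma Rintegral_box (D : set R) (h : R -> R) (a b m : R) : measurable D ->
  mu.-integrable D (EFin \o h) -> (forall y, D y -> 0 <= h y) -> a < b ->
  (forall y, a <= y <= b -> D y) -> (forall y, a <= y <= b -> m <= h y) ->
  m * (b - a) <= \int[mu]_(y in D) h y.
Proof.
move=> mD ih h0 ab abD mh.
have m12 : measurable (`[a, b]%classic : set R) by exact: measurable_itv.
have i12 : mu.-integrable `[a, b] (EFin \o (fun=> m)).
  apply: continuous_compact_integrable; first exact: segment_compact.
  by apply: continuous_subspaceT => x; exact: cvg_cst.
have s12 : `[a, b]%classic `<=` D by move=> u /=; rewrite in_itv/=; exact: abD.
have is12 : mu.-integrable `[a, b] (EFin \o h).
  exact: (@integrableS _ _ _ mu D _ _ mD m12 s12 ih).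
apply: (@le_trans _ _ (\int[mu]_(u in `[a, b]) h u)).
  apply: (@le_trans _ _ (\int[mu]_(u in `[a, b]) m)).
    suff -> : \int[mu]_(u in `[a, b]) m = m * (b - a) by [].
    transitivity (m * fine (mu `[a, b]%classic)); first exact: Rintegral_cst.
    by rewrite lebesgue_measure_itv/= lte_fin ab.
  by apply: le_Rintegral => // u; rewrite /= in_itv/=; exact: mh.
rewrite -lee_fin -(EFin_Rintegral m12 is12) -(EFin_Rintegral mD ih).
apply: ge0_subset_integral => //.
by case/integrableP : ih.
Qed.

Lemma expR_ln_ge (a y y0 : R) : 0 < y0 -> y0 / 2 <= y <= 2 * y0 ->
  expR (- (`|a| * ln 2)) * expR (a * ln y0) <= expR (a * ln y).
Proof.
move=> p /andP[h1 h2].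
have y00 : 0 < y by apply: lt_le_trans h1; rewrite divr_gt0.
rewrite -expRD ler_expR.
have l2 : 0 <= ln 2 :> R by rewrite ln_ge0// ler1n.
have k1 : ln y0 - ln 2 <= ln y.
  by rewrite -ln_div ?posrE// ler_ln ?posrE// divr_gt0.
have k2 : ln y <= ln 2 + ln y0.
  by rewrite -lnM ?posrE// ler_ln ?posrE// mulr_gt0.
have [a0|a0] := leP 0 a.
  by rewrite (ger0_norm a0); nra.
by rewrite (ltr0_norm a0); nra.
Qed.

End MellinStep.

(** * The positive function behind the kernel of the three models *)

Section ModelKernel.
Context {R : realType}.
Local Notation mu := (@lebesgue_measure R).
Local Notation Dp := (`]0, +oo[%classic : set R).
Local Notation D1 := (`]0, 1]%classic : set R).

Definition lin (a k : R) (s : R[i]) : R[i] := a%:C + k%:C * s.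

Definition kern2 (al be e : R) (s : R[i]) : R[i] := gline al s * cGamma (lin be (- e) s).

Definition kern (al be e rho2 : R) (s : R[i]) : R[i] :=
  kern2 al be e s * (lin rho2 (-1) s)^-1.

Definition gal (al z : R) : R := expR (al * ln z) * expR (- z).

(** Averaging (z u^-e)^s against u^(be-1) e^-u gives z^s Gamma(be - e s); so this average of x^al
    e^-x corresponds, up to a constant, to the kernel Gamma(al - s) Gamma(be - e s). *)
Definition kA (al be e z : R) : R :=
  \int[mu]_(u in Dp) (gker be u * gal al (z * expR (- e * ln u))).

(** The weight y^(rho2-1) on ]0, 1] with argument x / y contributes the factor 1 / (rho2 - s) of the
    pointing error. *)
Definition kJ (al be e rho2 x : R) : R :=
  \int[mu]_(y in D1) (expR ((rho2 - 1) * ln y) * kA al be e (x / y)).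

Lemma gal_ge0 al z : 0 <= gal al z.
Proof. by rewrite mulr_ge0 ?expR_ge0. Qed.

Lemma kA_ge0 al be e z : 0 <= kA al be e z.
Proof. by apply: Rintegral_ge0 => u _; apply: mulr_ge0; [exact: gker_ge0|exact: gal_ge0]. Qed.

Lemma kJ_ge0 al be e rho2 x : 0 <= kJ al be e rho2 x.
Proof. by apply: Rintegral_ge0 => u _; apply: mulr_ge0; [exact: expR_ge0|exact: kA_ge0]. Qed.

Lemma slit_kern2 (l r al be e : R) : e != 0 -> r <= al -> pos_strip l r be (- e) ->
  slit_holomorphic l r (kern2 al be e).
Proof.
move=> e0 ra hp; apply: slitM; first exact: slit_gline.
by apply: slit_cGamma => //; rewrite oppr_eq0.
Qed.

Lemma decay_kern2 (al be e : R) : e != 0 -> strip_decay (kern2 al be e).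
Proof.
move=> e0; apply: decayM; first exact: decay_gline.
by apply: decay_bounded; apply: decay_cGamma; rewrite oppr_eq0.
Qed.

Lemma slit_kern (l r al be e rho2 : R) : e != 0 -> r <= al -> r <= rho2 ->
  pos_strip l r be (- e) -> slit_holomorphic l r (kern al be e rho2).
Proof.
move=> e0 ra rr hp; apply: slitM; first exact: slit_kern2.
exact: slit_inv N1_neq0 (pos_strip_gline rr).
Qed.

Lemma decay_kern (al be e rho2 : R) : e != 0 -> strip_decay (kern al be e rho2).
Proof.
move=> e0; apply: decayM; first exact: decay_kern2.
exact: bounded_inv N1_neq0.
Qed.

Variables (al be e rho2 l r c : R).
Hypotheses (e0 : e != 0) (ra : r <= al) (rr : r <= rho2).
Hypotheses (hp : pos_strip l r be (- e)) (lc : l < c) (cr : c < r).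

Let lcr : l < c < r. Proof. by rewrite lc cr. Qed.

Variable k : R.
Hypothesis hk : forall c x : R, c < al -> 0 < x ->
  gam al c x = (k * (expR (al * ln x) * expR (- x)))%:C.

Let mDp := @measurable_Dp R.
Let mD1 : measurable D1. Proof. exact: measurable_itv. Qed.

Let becp : 0 < be - e * c.
Proof. by have := hp lcr; rewrite mulNr. Qed.

(** Fubini gives the integrability of [k] times the integrand; dividing by [k] needs the condition
    in the second conclusion. *)
Lemma kern2_value (z : R) : 0 < z ->
  mellin_line c (kern2 al be e) z = (k * kA al be e z)%:C /\
  (k != 0 -> mu.-integrable Dp (EFin \o (fun u => gker be u * gal al (z * expR (- e * ln u))))).
Proof.
move=> z0; have cal : c < al by apply: lt_le_trans ra.
pose el u : R := z * expR (- e * ln u).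
have el0 u : 0 < el u by rewrite mulr_gt0 ?expR_gt0.
have lel u : ln (el u) = ln z - e * ln u.
  by rewrite lnM ?posrE ?expR_gt0// expRK mulNr.
have hN t : cintegral Dp (fun u => (gker be u)%:C * cpow (el u) (c +i* t)) =
    cGamma (lin be (- e) (c +i* t)) * cpow z (c +i* t).
  rewrite cGamma_euler; last by rewrite /lin !cReImE /= mul0r subr0 mulNr.
  have p : 0 < complex.Re (lin be (- e) (c +i* t)).
    by rewrite /lin !cReImE /= mul0r subr0 mulNr.
  rewrite -(cintegralZr _ mDp (cintegrable_Eker p)); apply: eq_cintegral => u /DpP u0.
  rewrite /Eker /gker realCM -!mulrA; congr (_ * _).
  rewrite !cpowE -cexp_real -!cexpD lel; congr cexp.
  by rewrite /lin !(realCD, realCM, realCN) real1C; ring.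
have [|||| ig eg im] := @mellin_step R c (gline al) (fun s => cGamma (lin be (- e) s))
   Dp (gker be) el z (integrable_gline cal) mDp _ _ _ _ hN.
- exact: measurable_gker.
- by apply: measurable_funM; [exact: measurable_cst|exact: measurable_expR_ln].
- by move=> u _; exact: gker_ge0.
- have := integrableZl_fin (expR (c * ln z)) mDp (integrable_gker becp).
  move=> h; apply: eq_integrable h => // u _ /=; congr EFin.
  rewrite lel /gker mulrCA -mulrA; congr (_ * _).
  by rewrite -!expRD; congr expR; ring.
have vE u : mellin_line c (gline al) (el u) = (k * gal al (el u))%:C.
  by rewrite -/(gam al c (el u)) hk.
have vRe u : gker be u * complex.Re (mellin_line c (gline al) (el u)) =
    k * (gker be u * gal al (el u)).
  by rewrite vE mulrCA.
have eI : \int[mu]_(y in Dp) (gker be y * complex.Re (mellin_line c (gline al) (el y))) =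
    \int[mu]_(y in Dp) (k * (gker be y * gal al (el y))).
  by apply: eq_Rintegral => u _; exact: vRe.
have ih : mu.-integrable Dp (EFin \o (fun u => k * (gker be u * gal al (el u)))).
  by apply: eq_integrable ig => // u _; exact: (congr1 EFin (vRe u)).
have ik : k != 0 -> mu.-integrable Dp (EFin \o (fun u => gker be u * gal al (el u))).
  move=> k0; have h := integrableZl_fin k^-1 mDp ih.
  apply: eq_integrable h => // u _; apply: (congr1 EFin).
  by rewrite mulrA mulVf// mul1r.
split=> //; apply: complex_eq.
  apply: (etrans eg); rewrite eI; have [->|k0] := eqVneq k 0.
    rewrite mul0r (eq_Rintegral _ (g := fun=> 0)).
      by rewrite Rintegral_cst// mul0r.
    by move=> u _; rewrite mul0r.
  by rewrite RintegralZl//; exact: ik.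
apply: im => u _; by rewrite vE.
Qed.

End ModelKernel.

Section ModelKernelValue.
Context {R : realType}.
Local Notation mu := (@lebesgue_measure R).
Local Notation Dp := (`]0, +oo[%classic : set R).
Local Notation D1 := (`]0, 1]%classic : set R).

Variables (al be e rho2 l r c : R).
Hypotheses (e0 : e != 0) (ra : r <= al) (rr : r <= rho2).
Hypotheses (hp : pos_strip l r be (- e)) (lc : l < c) (cr : c < r).
Variable k : R.
Hypothesis hk : forall c x : R, c < al -> 0 < x ->
  gam al c x = (k * (expR (al * ln x) * expR (- x)))%:C.

Let mDp := @measurable_Dp R.
Let mD1 : measurable D1. Proof. exact: measurable_itv. Qed.
Let lcr : l < c < r. Proof. by rewrite lc cr. Qed.

Lemma ln_mul_expR (x t : R) : 0 < x -> ln (x * expR t) = ln x + t.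
Proof. by move=> x0; rewrite lnM ?posrE ?expR_gt0// expRK. Qed.

Lemma divE_expR (x y : R) : 0 < y -> x / y = x * expR (- 1 * ln y).
Proof. by move=> y0; rewrite mulN1r expRN lnK. Qed.

Lemma kern_value (x : R) : 0 < x ->
  mellin_line c (kern al be e rho2) x = (k * kJ al be e rho2 x)%:C /\
  (k != 0 -> mu.-integrable D1 (EFin \o (fun y => expR ((rho2 - 1) * ln y) * kA al be e (x / y)))).
Proof.
move=> x0; have crho : c < rho2 by apply: lt_le_trans rr.
pose w y : R := expR ((rho2 - 1) * ln y).
pose el y : R := x * expR (- 1 * ln y).
have el0 y : 0 < el y by rewrite mulr_gt0 ?expR_gt0.
have lel y : ln (el y) = ln x - ln y by rewrite ln_mul_expR// mulN1r.
have p t : 0 < complex.Re (lin rho2 (-1) (c +i* t)).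
  by rewrite /lin !cReImE /= mul0r subr0 mulN1r subr_gt0.
have hN t : cintegral D1 (fun y => (w y)%:C * cpow (el y) (c +i* t)) =
    (lin rho2 (-1) (c +i* t))^-1 * cpow x (c +i* t).
  set s := c +i* t.
  have -> : cintegral D1 (fun y => (w y)%:C * cpow (el y) s) =
     cintegral D1 (fun y => cpow x s * cpow y (lin rho2 (-1) s - 1)).
    apply: eq_cintegral => y _.
    rewrite !cpowE -cexp_real -!cexpD lel; congr cexp.
    by rewrite /lin !(realCD, realCM, realCN) real1C; ring.
  rewrite (cintegralZ _ mD1 (cintegrable_cpow0 (p t) ltr01)) cintegral_cpow0//.
  have -> : cpow 1 (lin rho2 (-1) s) = 1 by rewrite cpowE ln1 mulr0 cexp0.
  by rewrite mul1r mulrC.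
have i2 : cintegrable setT (fun t => kern2 al be e (c +i* t)).
  by apply: (vertical_integrable (slit_kern2 e0 ra hp) (decay_kern2 al be e0)).
have [|||| ig eg im] := @mellin_step R c (kern2 al be e) (fun s => (lin rho2 (-1) s)^-1)
   D1 w el x i2 mD1 _ _ _ _ hN.
- exact: measurable_expR_ln.
- by apply: measurable_funM; [exact: measurable_cst|exact: measurable_expR_ln].
- by move=> u _; exact: expR_ge0.
- have rc : 0 < rho2 - c by rewrite subr_gt0.
  have h := integrableZl_fin (expR (c * ln x)) mD1 (integrable_pow rc ltr01).
  apply: eq_integrable h => // u _; apply: (congr1 EFin).
  by rewrite lel /w -!expRD; congr expR; ring.
have vE y : mellin_line c (kern2 al be e) (el y) = (k * kA al be e (el y))%:C.
  by rewrite (proj1 (kern2_value ra hp lc cr hk (el0 y))).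
have vRe y : D1 y -> w y * complex.Re (mellin_line c (kern2 al be e) (el y)) =
    k * (w y * kA al be e (x / y)).
  by move=> /itv0cP /andP[y0 _]; rewrite vE mulrCA divE_expR.
have eI : \int[mu]_(y in D1) (w y * complex.Re (mellin_line c (kern2 al be e) (el y))) =
    \int[mu]_(y in D1) (k * (w y * kA al be e (x / y))).
  by apply: eq_Rintegral => y /[!inE] Dy; exact: vRe.
have ih : mu.-integrable D1 (EFin \o (fun y => k * (w y * kA al be e (x / y)))).
  by apply: eq_integrable ig => // y /[!inE] Dy; exact: (congr1 EFin (vRe y Dy)).
have ik : k != 0 -> mu.-integrable D1 (EFin \o (fun y => w y * kA al be e (x / y))).
  move=> k0; have h := integrableZl_fin k^-1 mD1 ih.
  apply: eq_integrable h => // u _; apply: (congr1 EFin).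
  by rewrite mulrA mulVf// mul1r.
split=> //; apply: complex_eq.
  apply: (etrans eg); rewrite eI; have [->|k0] := eqVneq k 0.
    rewrite mul0r (eq_Rintegral _ (g := fun=> 0)).
      by rewrite Rintegral_cst// mul0r.
    by move=> u _; rewrite mul0r.
  by rewrite RintegralZl//; exact: ik.
by apply: im => u _; rewrite vE.
Qed.

Hypothesis k0 : k != 0.
Hypothesis e1 : e = 1 \/ e = -1.

(** Box [u0, 2 u0]. Since e is 1 or -1, z u^-e changes there by a factor at most 2, which gives the
    constants 2^-|be - 1| and 2^-|al|. *)
Lemma kA_lower (z u0 : R) : 0 < z -> 0 < u0 ->
  expR (- (`|be - 1| * ln 2)) * expR (- (`|al| * ln 2)) *
  expR (be * ln u0 + al * (ln z - e * ln u0) - 2 * u0 - 2 * (z * expR (- e * ln u0)))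
  <= kA al be e z.
Proof.
move=> z0 u00.
set zeta := z * expR (- e * ln u0).
have zeta0 : 0 < zeta by rewrite mulr_gt0 ?expR_gt0.
have lz : ln zeta = ln z - e * ln u0 by rewrite ln_mul_expR// mulNr.
pose m := (expR (- (2 * u0)) * (expR (- (`|be - 1| * ln 2)) * expR ((be - 1) * ln u0))) *
  ((expR (- (`|al| * ln 2)) * expR (al * ln zeta)) * expR (- (2 * zeta))).
have ik := proj2 (kern2_value ra hp lc cr hk z0) k0.
have h : m * (2 * u0 - u0) <= kA al be e z.
  apply: (Rintegral_box mDp ik).
  - by move=> u _; apply: mulr_ge0; [exact: gker_ge0|exact: gal_ge0].
  - lra.
  - by move=> y /andP[y1 _]; apply/DpP; apply: lt_le_trans y1.
  move=> u /andP[u1 u2]; have up : 0 < u by apply: lt_le_trans u1.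
  have zb : zeta / 2 <= z * expR (- e * ln u) <= 2 * zeta.
    have E (t : R) : z * expR t = expR (ln z + t) by rewrite expRD lnK.
    have l1 : ln u0 <= ln u by rewrite ler_ln ?posrE.
    have l2 : ln u <= ln 2 + ln u0 by rewrite -lnM ?posrE// ler_ln ?posrE// mulr_gt0.
    have -> : zeta / 2 = expR (ln zeta - ln 2) by rewrite expRD expRN !lnK ?posrE.
    have -> : 2 * zeta = expR (ln 2 + ln zeta) by rewrite expRD !lnK ?posrE.
    rewrite E !ler_expR lz; case: e1 => ->; lra.
  apply: ler_pM.
  - by rewrite !mulr_ge0 ?expR_ge0.
  - by rewrite !mulr_ge0 ?expR_ge0.
  - apply: ler_pM; rewrite ?mulr_ge0 ?expR_ge0//; first by rewrite ler_expR lerN2.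
    by apply: expR_ln_ge => //; rewrite u2 andbT; lra.
  - apply: ler_pM; rewrite ?mulr_ge0 ?expR_ge0//.
      exact: expR_ln_ge.
    by rewrite ler_expR lerN2; case/andP: zb.
apply: le_trans h; rewrite le_eqVlt; apply/orP; left; apply/eqP.
have -> : 2 * u0 - u0 = expR (ln u0) by rewrite lnK ?posrE//; ring.
by rewrite /m lz -!expRD; congr expR; ring.
Qed.

Lemma kJ_lower (x u0 y0 : R) : 0 < x -> 0 < u0 -> 0 < y0 -> y0 <= 2^-1 ->
  expR (- (`|rho2 - 1| * ln 2)) *
  (expR (- (`|be - 1| * ln 2)) * expR (- (`|al| * ln 2)) * expR (- (`|al| * ln 2))) *
  expR (be * ln u0 + rho2 * ln y0 + al * (ln x - ln y0 - e * ln u0)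
    - 2 * u0 - 2 * (x / y0 * expR (- e * ln u0)))
  <= kJ al be e rho2 x.
Proof.
move=> x0 u00 y00 y0h.
set zeta := x / y0 * expR (- e * ln u0).
have xy0 : 0 < x / y0 by rewrite divr_gt0.
have zeta0 : 0 < zeta by rewrite mulr_gt0 ?expR_gt0.
have lz : ln zeta = ln x - ln y0 - e * ln u0.
  by rewrite ln_mul_expR// ln_div ?posrE// mulNr.
pose m := (expR (- (`|rho2 - 1| * ln 2)) * expR ((rho2 - 1) * ln y0)) *
  (expR (- (`|be - 1| * ln 2)) * expR (- (`|al| * ln 2)) *
  (expR (be * ln u0) * (expR (- (`|al| * ln 2)) * expR (al * ln zeta)) *
   expR (- (2 * u0)) * expR (- (2 * zeta)))).
have ik := proj2 (kern_value x0) k0.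
have h : m * (2 * y0 - y0) <= kJ al be e rho2 x.
  apply: (Rintegral_box mD1 ik).
  - by move=> u _; apply: mulr_ge0; [exact: expR_ge0|exact: kA_ge0].
  - lra.
  - by move=> y /andP[y1 y2]; apply/itv0cP; rewrite (lt_le_trans y00 y1) /= (le_trans y2)//; lra.
  move=> y /andP[y1 y2]; have yp : 0 < y by apply: lt_le_trans y1.
  have xy : 0 < x / y by rewrite divr_gt0.
  apply: ler_pM.
  - by rewrite !mulr_ge0 ?expR_ge0.
  - by rewrite !mulr_ge0 ?expR_ge0.
  - by apply: expR_ln_ge => //; rewrite y2 andbT; lra.
  apply: le_trans (kA_lower xy u00).
  rewrite ler_wpM2l ?mulr_ge0 ?expR_ge0//.
  set zy := x / y * expR (- e * ln u0).
  have zb : zeta / 2 <= zy <= zeta.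
    have -> : zeta / 2 = x / (2 * y0) * expR (- e * ln u0).
      by rewrite /zeta; field; rewrite gt_eqF.
    rewrite !ler_pM2r ?expR_gt0// !ler_pM2l//.
    by rewrite !lef_pV2 ?posrE ?mulr_gt0// y1 y2.
  have lzy : ln zy = ln (x / y) - e * ln u0 by rewrite ln_mul_expR// mulNr.
  rewrite !expRD -lzy; apply: ler_pM; rewrite ?mulr_ge0 ?expR_ge0//.
    rewrite ler_pM ?mulr_ge0 ?expR_ge0// ler_wpM2l ?expR_ge0//.
    apply: expR_ln_ge => //; case/andP: zb => -> h2 /=; lra.
  by rewrite ler_expR lerN2 ler_pM2l//; case/andP: zb.
apply: le_trans h; rewrite le_eqVlt; apply/orP; left; apply/eqP.
have -> : 2 * y0 - y0 = expR (ln y0) by rewrite lnK ?posrE//; ring.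
by rewrite /m lz -!expRD; congr expR; ring.
Qed.

(** Each exponent is seen by its own choice of (u0, y0): (1, 1/2) for al, (1, x) for rho2 and (x,
    1/2) for be. In all three cases x u0^-e / y0 stays bounded for x <= 1/2, so the exponentials
    cost only e^-4 or e^-5. *)
Lemma kJ_power_lower (b : R) : b = al \/ b = rho2 \/ (e = 1 /\ b = be) ->
  exists2 K : R, 0 < K & forall x, 0 < x <= 2^-1 ->
    K * expR (b * ln x) <= kJ al be e rho2 x.
Proof.
move=> hb.
pose K0 := expR (- (`|rho2 - 1| * ln 2)) *
  (expR (- (`|be - 1| * ln 2)) * expR (- (`|al| * ln 2)) * expR (- (`|al| * ln 2))).
have K00 : 0 < K0 by rewrite !mulr_gt0 ?expR_gt0.
have lh : ln (2^-1 : R) = - ln 2 by rewrite lnV ?posrE.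
case: hb => [->|[->|[e1' ->]]].
- exists (K0 * expR (- (rho2 * ln 2) + al * ln 2 - 4)); first by rewrite mulr_gt0 ?expR_gt0.
  move=> x /andP[x0 xh]; have h2 : (0 : R) < 2^-1 by rewrite invr_gt0.
  have := kJ_lower x0 ltr01 h2 (lexx _); rewrite -/K0 ln1 !mulr0 expR0 !mulr1 invrK lh.
  apply: le_trans; rewrite -mulrA ler_pM2l// -expRD ler_expR; lra.
- exists (K0 * expR (- 4)); first by rewrite mulr_gt0 ?expR_gt0.
  move=> x /andP[x0 xh]; have := kJ_lower x0 ltr01 x0 xh.
  rewrite -/K0 ln1 !mulr0 expR0 !mulr1 divff ?gt_eqF//.
  apply: le_trans; rewrite -mulrA ler_pM2l// -expRD ler_expR; lra.
- exists (K0 * expR (- (rho2 * ln 2) + al * ln 2 - 5)); first by rewrite mulr_gt0 ?expR_gt0.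
  move=> x /andP[x0 xh]; have h2 : (0 : R) < 2^-1 by rewrite invr_gt0.
  have := kJ_lower x0 x0 h2 (lexx _); rewrite -/K0 invrK lh e1' !mul1r mulN1r expRN lnK ?posrE//.
  rewrite [x * 2 / x]mulrAC divff ?gt_eqF// mul1r.
  apply: le_trans; rewrite -mulrA ler_pM2l// -expRD ler_expR; lra.
Qed.

End ModelKernelValue.

(** * The kernels of the cdf, of the fog and of the average error rate *)

Section Chain.
Context {R : realType}.
Local Notation mu := (@lebesgue_measure R).
Local Notation Dp := (`]0, +oo[%classic : set R).
Local Notation D1 := (`]0, 1]%classic : set R).

Variables (v r c : R).
Hypotheses (rv : r <= v) (c0 : 0 < c) (cr : c < r).
Variable phi : R[i] -> R[i].
Hypotheses (sphi : slit_holomorphic 0 r phi) (dphi : strip_decay phi).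

Let cc : 0 < c < r. Proof. by rewrite c0 cr. Qed.
Let mDp := @measurable_Dp R.

Definition cdf_kern (phi : R[i] -> R[i]) (s : R[i]) : R[i] :=
  phi s * (lin 0 1 s)^-1.

Definition fog_kern (v : R) (k : nat) (phi : R[i] -> R[i]) (s : R[i]) : R[i] :=
  phi s * (lin v (-1) s)^-1 ^+ k.

Definition ber_kern (p tau : R) (phi : R[i] -> R[i]) (s : R[i]) : R[i] :=
  phi s * cGamma (lin p tau s).

Lemma slit_cdf_kern : slit_holomorphic 0 r (cdf_kern phi).
Proof.
apply: slitM => //; apply: slit_inv; first exact: oner_neq0.
by move=> x /andP[x0 _]; rewrite add0r mul1r.
Qed.

Lemma decay_cdf_kern : strip_decay (cdf_kern phi).
Proof. by apply: decayM => //; apply: bounded_inv; exact: oner_neq0. Qed.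

Lemma slit_fog_kern k : slit_holomorphic 0 r (fog_kern v k phi).
Proof.
apply: slitM => //; apply: slitX; exact: slit_inv N1_neq0 (pos_strip_gline rv).
Qed.

Lemma decay_fog_kern k : strip_decay (fog_kern v k phi).
Proof. by apply: decayM => //; apply: boundedX; exact: bounded_inv N1_neq0. Qed.

Lemma slit_ber_kern p tau : 0 < p -> 0 < tau -> slit_holomorphic 0 r (ber_kern p tau phi).
Proof.
move=> p0 t0; apply: slitM => //; apply: slit_cGamma; first by rewrite gt_eqF.
by move=> x /andP[x0 _]; rewrite addr_gt0// mulr_gt0.
Qed.

Lemma decay_ber_kern p tau : 0 < tau -> strip_decay (ber_kern p tau phi).
Proof.
by move=> t0; apply: decayM => //; apply: decay_bounded; apply: decay_cGamma; rewrite gt_eqF.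
Qed.

Lemma integrable_phi : cintegrable setT (fun t => phi (c +i* t)).
Proof. exact: (vertical_integrable sphi dphi cc). Qed.

Hypothesis im0 : forall x, 0 < x -> complex.Im (mellin_line c phi x) = 0.

(** The density will be y^-1 times a Mellin integral, whence the weight; integrating y^(s-1) over
    ]0, X] gives X^s / s, for which the line must lie to the right of 0. *)
Lemma cdf_kern_value (C X : R) : 0 < C -> 0 < X ->
  [/\ mu.-integrable `]0, X] (EFin \o (fun y => y^-1 * complex.Re (mellin_line c phi (C * y)))),
      complex.Re (mellin_line c (cdf_kern phi) (C * X)) =
        \int[mu]_(y in `]0, X]) (y^-1 * complex.Re (mellin_line c phi (C * y))) &
      complex.Im (mellin_line c (cdf_kern phi) (C * X)) = 0].
Proof.
move=> C0 X0.
have mX : measurable (`]0, X]%classic : set R) by exact: measurable_itv.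
pose w (y : R) : R := expR ((0 - 1) * ln y).
have wE y : `]0, X]%classic y -> w y = y^-1.
  by move=> /itv0cP /andP[y0 _]; rewrite /w sub0r mulN1r expRN lnK.
have hN t : cintegral `]0, X] (fun y => (w y)%:C * cpow (C * y) (c +i* t)) =
    (lin 0 1 (c +i* t))^-1 * cpow (C * X) (c +i* t).
  set s := c +i* t; have s0 : 0 < complex.Re s by [].
  have -> : cintegral `]0, X] (fun y => (w y)%:C * cpow (C * y) s) =
      cintegral `]0, X] (fun y => cpow C s * cpow y (s - 1)).
    apply: eq_cintegral => y /itv0cP /andP[y0 _]; rewrite cpowM// !cpowE -cexp_real -!cexpD.
    by congr cexp; rewrite !(realCD, realCM, realCN) real1C; ring.
  rewrite (cintegralZ _ mX (cintegrable_cpow0 s0 X0)) cintegral_cpow0// cpowM// /lin.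
  by rewrite add0r real1C mul1r mulrA mulrC.
have [|||| ig eg im] := @mellin_step R c phi (fun s => (lin 0 1 s)^-1) `]0, X]%classic
    w (fun y => C * y) (C * X) integrable_phi mX _ _ _ _ hN.
- exact: measurable_expR_ln.
- by apply: measurable_funM; [exact: measurable_cst|exact: measurable_id].
- by move=> y _; exact: expR_ge0.
- have h := integrableZl_fin (expR (c * ln C)) mX (integrable_pow c0 X0).
  apply: eq_integrable h => // y /[!inE] /itv0cP /andP[y0 _]; apply: (congr1 EFin).
  by rewrite lnM ?posrE// /w -!expRD; congr expR; ring.
split.
- apply: eq_integrable ig => // y /[!inE] Dy.
  exact: (congr1 (fun u => EFin (u * complex.Re (mellin_line c phi (C * y)))) (wE y Dy)).
- apply: (etrans eg); apply: eq_Rintegral => y /[!inE] Dy.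
  exact: (congr1 (fun u => u * complex.Re (mellin_line c phi (C * y))) (wE y Dy)).
- by apply: im => y /itv0cP /andP[y0 _]; apply: im0; rewrite mulr_gt0.
Qed.

(** The fog density without its factor v^k, and with (k-1)! for Gamma(k), so that its transform is
    exactly (v - s)^-k. *)
Definition fog_weight (k : nat) (y : R) : R :=
  (k.-1)`!%:R^-1 * (fogk k.-1 y * expR ((v - 1) * ln y)).

Lemma fog_kern_value (k : nat) (X : R) : (0 < k)%N -> 0 < X ->
  [/\ mu.-integrable D1 (EFin \o (fun y =>
        fog_weight k y * complex.Re (mellin_line c phi (X / y)))),
      complex.Re (mellin_line c (fog_kern v k phi) X) =
        \int[mu]_(y in D1) (fog_weight k y * complex.Re (mellin_line c phi (X / y))) &
      complex.Im (mellin_line c (fog_kern v k phi) X) = 0].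
Proof.
move=> k0 X0; have cv : c < v := lt_le_trans cr rv.
have mX : measurable D1 by exact: measurable_itv.
have vc : 0 < v - c by rewrite subr_gt0.
pose el y : R := X * expR (- 1 * ln y).
have el0 y : 0 < el y by rewrite mulr_gt0 ?expR_gt0.
have lel y : ln (el y) = ln X - ln y by rewrite ln_mul_expR// mulN1r.
have elE y : D1 y -> el y = X / y.
  by move=> /itv0cP /andP[y0 _]; rewrite /el mulN1r expRN lnK.
have f0 : ((k.-1)`!%:R : R) != 0 by rewrite pnatr_eq0 -lt0n fact_gt0.
have mw : measurable_fun setT (fog_weight k).
  apply: measurable_funM; first exact: measurable_cst.
  by apply: measurable_funM; [exact: measurable_fogk|exact: measurable_expR_ln].
have hN t : cintegral D1 (fun y => (fog_weight k y)%:C * cpow (el y) (c +i* t)) =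
    (lin v (-1) (c +i* t))^-1 ^+ k * cpow X (c +i* t).
  set s := c +i* t; set z := lin v (-1) s.
  have z0 : 0 < complex.Re z by rewrite /z /s /lin !cReImE /= mul0r subr0 ?mulN1r//.
  have iz : cintegrable D1 (fun y => (fogk k.-1 y)%:C * cpow y (z - 1)).
    apply: (cintegrable_le mX _ _ (integrable_fogk k.-1 z0)).
      apply: cmeasurableM; first by apply: cmeasurable_real; exact: measurable_fogk.
      by apply: cmeasurable_cpow; exact: measurable_id.
    move=> y /itv0cP y1; rewrite normcM normc_real normc_cpow cReD cReN.
    by rewrite ger0_norm ?fogk_ge0.
  have -> : cintegral D1 (fun y => (fog_weight k y)%:C * cpow (el y) s) =
      cintegral D1 (fun y => (((k.-1)`!%:R : R)^-1%:C * cpow X s) *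
        ((fogk k.-1 y)%:C * cpow y (z - 1))).
    apply: eq_cintegral => y _.
    rewrite /fog_weight !realCM -!mulrA.
    suff -> : (expR ((v - 1) * ln y))%:C * cpow (el y) s = cpow X s * cpow y (z - 1).
      by congr (_ * _); rewrite mulrCA.
    rewrite !cpowE lel -cexp_real -!cexpD.
    by congr cexp; rewrite /z /lin !(realCD, realCM, realCN) real1C; ring.
  rewrite (cintegralZ _ mX iz) cintegral_fog// prednK// realCV natC.
  have fc : ((k.-1)`!%:R : R[i]) != 0 by rewrite pnatr_eq0 -lt0n fact_gt0.
  rewrite natC in fc; rewrite exprVn mulrACA mulVf// mul1r mulrC.
  by [].
have [||| ig eg im] := @mellin_step R c phi (fun s => (lin v (-1) s)^-1 ^+ k) D1
    (fog_weight k) el X integrable_phi mX mw _ _ _ hN.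
- by apply: measurable_funM; [exact: measurable_cst|exact: measurable_expR_ln].
- move=> y /itv0cP y1; rewrite mulr_ge0 ?invr_ge0//.
  by rewrite mulr_ge0 ?expR_ge0 ?fogk_ge0.
- have h := integrableZl_fin ((k.-1)`!%:R^-1 * expR (c * ln X)) mX (integrable_fogk k.-1 vc).
  apply: eq_integrable h => // y /[!inE] /itv0cP /andP[y0 _]; apply: (congr1 EFin).
  rewrite /fog_weight lel -!mulrA; congr (_ * _); rewrite mulrCA; congr (_ * _).
  by rewrite -!expRD; congr expR; ring.
split.
- apply: (@eq_integrable _ _ _ mu D1 mX _ _ _ ig).
  move=> y /[!inE] Dy; exact: (congr1 (fun u => EFin (fog_weight k y * complex.Re (mellin_line c phi u))) (elE y Dy)).
- apply: (etrans eg); apply: eq_Rintegral => y /[!inE] Dy.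
  exact: (congr1 (fun u => fog_weight k y * complex.Re (mellin_line c phi u)) (elE y Dy)).
- by apply: im => y _; apply: im0.
Qed.

Definition ber_weight (p q x : R) : R :=
  expR (p * ln q) * (expR (- (q * x)) * expR ((p - 1) * ln x)).

Lemma ber_weight_ge0 p q x : 0 <= ber_weight p q x.
Proof. by rewrite !mulr_ge0 ?expR_ge0. Qed.

Lemma measurable_ber_weight p q (D : set R) : measurable_fun D (ber_weight p q).
Proof.
apply: measurable_funM; first exact: measurable_cst.
apply: measurable_funM; last exact: measurable_expR_ln.
apply: measurable_funTS; apply: measurableT_comp; first exact: measurable_expR.
by apply: measurable_funN; apply: measurable_funM; [exact: measurable_cst|exact: measurable_id].
Qed.

(** To be used with tau = 1/t, because the cdf of the SNR at x is that of h at (x / gamma0)^(1/t);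
    [Y] absorbs gamma0 and the scale C. *)
Lemma ber_kern_value (p q tau Y : R) : 0 < p -> 0 < q -> 0 < tau -> 0 < Y ->
  [/\ mu.-integrable Dp (EFin \o (fun x =>
        ber_weight p q x * complex.Re (mellin_line c phi (Y * expR (tau * ln x))))),
      complex.Re (mellin_line c (ber_kern p tau phi) (Y * expR (- tau * ln q))) =
        \int[mu]_(x in Dp) (ber_weight p q x *
          complex.Re (mellin_line c phi (Y * expR (tau * ln x)))) &
      complex.Im (mellin_line c (ber_kern p tau phi) (Y * expR (- tau * ln q))) = 0].
Proof.
move=> p0 q0 t0 Y0.
pose el x : R := Y * expR (tau * ln x).
have el0 y : 0 < el y by rewrite mulr_gt0 ?expR_gt0.
have lel y : ln (el y) = ln Y + tau * ln y by rewrite ln_mul_expR.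
have ptc : 0 < p + tau * c by rewrite addr_gt0// mulr_gt0.
have hN t : cintegral Dp (fun y => (ber_weight p q y)%:C * cpow (el y) (c +i* t)) =
    cGamma (lin p tau (c +i* t)) * cpow (Y * expR (- tau * ln q)) (c +i* t).
  set s := c +i* t; set z := lin p tau s.
  have z0 : 0 < complex.Re z by rewrite /z /s /lin !cReImE /= mul0r subr0 ?mulN1r//.
  have iz : cintegrable Dp (fun x => (expR (- (q * x)))%:C * cpow x (z - 1)).
    apply: (cintegrable_le mDp _ _ (integrable_gker_scaled q0 z0)).
      apply: cmeasurableM; last by apply: cmeasurable_cpow; exact: measurable_id.
      apply: cmeasurable_real; apply: measurable_funTS; apply: measurableT_comp; first exact: measurable_expR.
      by apply: measurable_funN; apply: measurable_funM; [exact: measurable_cst|exact: measurable_id].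
    move=> y _; rewrite normcM normc_real normc_cpow cReD cReN.
    by rewrite ger0_norm ?expR_ge0.
  have -> : cintegral Dp (fun y => (ber_weight p q y)%:C * cpow (el y) s) =
      cintegral Dp (fun x => ((expR (p * ln q))%:C * cpow Y s) *
        ((expR (- (q * x)))%:C * cpow x (z - 1))).
    apply: eq_cintegral => x _.
    rewrite /ber_weight 2!realCM !cpowE !lel -!cexp_real -!cexpD.
    by congr cexp; rewrite /z /lin !(realCD, realCM, realCN) real1C; ring.
  rewrite (cintegralZ _ mDp iz) (euler_scaled q0 z0) (cGamma_euler z0) mulrA [RHS]mulrC.
  congr (_ * _).
  rewrite !cpowE (ln_mul_expR _ Y0) -!cexp_real -!cexpD.
  by congr cexp; rewrite /z /lin !(realCD, realCM, realCN); ring.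
have [|||| ig eg im] := @mellin_step R c phi (fun s => cGamma (lin p tau s)) Dp
    (ber_weight p q) el (Y * expR (- tau * ln q)) integrable_phi mDp _ _ _ _ hN.
- exact: measurable_ber_weight.
- by apply: measurable_funM; [exact: measurable_cst|exact: measurable_expR_ln].
- by move=> y _; exact: ber_weight_ge0.
- have h := integrableZl_fin (expR (p * ln q) * expR (c * ln Y)) mDp (integrable_gker_scaled q0 ptc).
  apply: eq_integrable h => // y _; apply: (congr1 EFin).
  rewrite /ber_weight lel -!mulrA; congr (_ * _); rewrite mulrCA; congr (_ * _).
  by rewrite -!expRD; congr expR; ring.
by split=> //; apply: im => y _; apply: im0.
Qed.

End Chain.

(** * The law of the fading coefficient *)

Section Densities.
Context {R : realType} {d : measure_display} {T : measurableType d}.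
Variable P : probability T R.
Local Notation mu := (@lebesgue_measure R).
Local Notation RT := (measurableTypeR R).

(* [R] and [measurableTypeR R] carry the same measurable sets under different
   displays; the Lebesgue measure lives on the latter. *)
Lemma measurable_RV (X : {RV P >-> R}) : measurable_fun setT (X : T -> RT).
Proof. by move=> mT B mB; exact: (measurable_funP X mT B mB). Qed.

Definition RV_of (X : {RV P >-> R}) : {RV P >-> RT} :=
  @mfun_Sub _ _ T RT _ (mem_set (measurable_RV X)).

(** The density agrees almost everywhere with the Radon-Nikodym derivative of the law, for which the
    change of variables is known. *)
Lemma integral_density (X : {RV P >-> R}) (f : R -> R) (g : RT -> \bar R) :
  has_density P X f -> (distribution P (RV_of X)).-integrable setT g ->
  (\int[distribution P (RV_of X)]_x g x = \int[mu]_x (g x * (f x)%:E))%E.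
Proof.
move=> [mf f0 fE'] ig.
pose nu : {finite_measure set RT -> \bar R} := distribution P (RV_of X).
have fE (A : set RT) : measurable A -> nu A = (\int[mu]_(x in A) (f x)%:E)%E.
  by move=> mA; exact: fE'.
have dom : nu `<< mu.
  apply/null_content_dominatesP => A mA A0.
  apply: (etrans (fE A mA)); apply: null_set_integral => //; apply/measurable_EFinP.
  exact: measurable_funTS.
have mg : measurable_fun setT g by case/integrableP: ig.
rewrite -(@Radon_Nikodym_change_of_variables _ _ _ nu _ dom g setT measurableT ig).
have mf' : measurable_fun setT (EFin \o f : RT -> \bar R) by apply/measurable_EFinP.
have if' : mu.-integrable setT (EFin \o f : RT -> \bar R).
  apply/integrableP; split => //.
  have -> : (\int[mu]_x `|(EFin \o f) x| = nu setT)%E.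
    rewrite fE//; apply: eq_integral => x _ /=.
    by rewrite ger0_norm.
  by rewrite ltey_eq fin_num_measure.
have ae : ae_eq mu setT (Radon_Nikodym (charge_of_finite_measure nu) mu) (EFin \o f).
  apply: integral_ae_eq => //.
    exact: Radon_Nikodym_integrable.
  by move=> A _ mA; rewrite -Radon_Nikodym_integral//; exact: fE.
apply: ae_eq_integral => //.
- by apply: emeasurable_funM => //; apply: measurable_int; exact: Radon_Nikodym_integrable.
- exact: emeasurable_funM.
- exact: ae_eqe_mul2l.
Qed.

(** By independence the joint law agrees with the product of the marginals on rectangles, hence
    everywhere. [Y] comes first so that the outer integral runs over the fog. *)
Lemma joint_distribution (X Y : {RV P >-> R}) (S : set (RT * RT)) :
  independent_RV P X Y -> measurable S ->
  P ((fun w => (Y w : RT, X w : RT)) @^-1` S) =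
  (\int[distribution P (RV_of Y)]_y distribution P (RV_of X) (xsection S y))%E.
Proof.
move=> iXY mS.
have mYX : measurable_fun setT (fun w => (Y w : RT, X w : RT)).
  by apply: measurable_fun_pair; exact: measurable_RV.
pose XY : {RV P >-> (RT * RT)%type} := @mfun_Sub _ _ T (RT * RT)%type _ (mem_set mYX).
have h := @product_measure_unique _ _ _ _ R (distribution P (RV_of Y))
  (distribution P (RV_of X)) (distribution P XY).
rewrite -[LHS]/(distribution P XY S) -h//.
move=> A B mA mB.
transitivity (P ((X @^-1` B) `&` (Y @^-1` A))).
  by congr (P _); apply/seteqP; split => w [].
by rewrite iXY// muleC.
Qed.

End Densities.

Section ProductLaw.
Context {R : realType} {d : measure_display} {T : measurableType d}.
Variable P : probability T R.
Local Notation mu := (@lebesgue_measure R).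
Local Notation RT := (measurableTypeR R).
Local Notation D1 := (`]0, 1]%classic : set R).

Variables (X Y : {RV P >-> R}) (f g : R -> R).
Hypotheses (dX : has_density P X f) (dY : has_density P Y g).
Hypotheses (iXY : independent_RV P X Y).
Hypotheses (f0 : forall x, x <= 0 -> f x = 0) (g0 : forall y, ~ D1 y -> g y = 0).

Definition cdf_of (f : R -> R) (x : R) : R := \int[mu]_(a in `]0, x]) f a.

Let mf : measurable_fun setT f. Proof. by case: dX. Qed.
Let mg : measurable_fun setT g. Proof. by case: dY. Qed.
Let fp x : 0 <= f x. Proof. by case: dX. Qed.
Let gp x : 0 <= g x. Proof. by case: dY. Qed.

Lemma density_integral1 (Z : {RV P >-> R}) (h : R -> R) : has_density P Z h ->
  (\int[mu]_x (h x)%:E = 1)%E.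
Proof.
by case=> mh h0 hE; rewrite -hE//; exact: probability_setT.
Qed.

Lemma integrable_density (Z : {RV P >-> R}) (h : R -> R) (D : set R) :
  has_density P Z h -> measurable D -> mu.-integrable D (EFin \o h).
Proof.
move=> dZ mD; have [mh h0 _] := dZ.
apply: (@integrableS _ _ _ mu setT D _ measurableT mD) => //.
apply/integrableP; split; first exact/measurable_EFinP.
have -> : (\int[mu]_x `|(EFin \o h) x| = \int[mu]_x (h x)%:E)%E.
  by apply: eq_integral => x _ /=; rewrite ger0_norm.
by rewrite (density_integral1 dZ) ltry.
Qed.

Lemma cdf_of_distribution (x : R) :
  distribution P (RV_of X) `]-oo, x] = (cdf_of f x)%:E.
Proof.
have mi : measurable (`]-oo, x]%classic : set R) by exact: measurable_itv.
have m0 : measurable (`]0, x]%classic : set R) by exact: measurable_itv.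
have [_ _ fE] := dX.
rewrite -(EFin_Rintegral m0 (integrable_density dX m0)).
transitivity (\int[mu]_(a in `]-oo, x]) (f a)%:E)%E; first exact: fE.
rewrite integral_mkcond [RHS]integral_mkcond; apply: eq_integral => a _.
rewrite !patchE !mem_setE !in_itv/=.
by case: (a <= x); rewrite ?andbF//= andbT; case: ltP => // /f0 ->.
Qed.

Lemma cdf_of_ge0 x : 0 <= cdf_of f x.
Proof. by apply: Rintegral_ge0 => a _; exact: fp. Qed.

Lemma cdf_of_le x y : x <= y -> cdf_of f x <= cdf_of f y.
Proof.
move=> xy; rewrite -lee_fin -!cdf_of_distribution.
by apply: le_measure; rewrite ?inE//; exact: subitvPr.
Qed.

(** Conditioning on the fog gain y, which lies in ]0, 1] almost surely: the product is at most x
    when the other gain is at most x / y. *)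
Lemma cdf_fading (x : R) : 0 < x ->
  mu.-integrable D1 (EFin \o (fun y => g y * cdf_of f (x / y))) /\
  cdf (fading X Y : {RV P >-> R}) x = (\int[mu]_(y in D1) (g y * cdf_of f (x / y)))%:E.
Proof.
move=> x0.
have mD1 : measurable D1 by exact: measurable_itv.
pose S : set (RT * RT) := [set z | z.2 * z.1 <= x].
have mS : measurable S.
  rewrite -[S]setTI; apply: measurable_fun_le => //.
  by apply: measurable_funM; [exact: measurable_snd|exact: measurable_fst].
pose h (y : RT) : \bar R := distribution P (RV_of X) (xsection S y).
have mh : measurable_fun setT h by exact: measurable_fun_xsection.
have ih : (distribution P (RV_of Y)).-integrable setT h.
  apply/integrableP; split => //.
  apply: (@le_lt_trans _ _ (\int[distribution P (RV_of Y)]_y cst 1%E y)%E).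
    apply: ge0_le_integral => //; first exact: measurableT_comp.
    move=> y _; rewrite gee0_abs ?measure_ge0//.
    by apply: probability_le1; exact: measurable_xsection.
  rewrite (integral_cst (distribution P (RV_of Y)) measurableT 1%E) mul1e.
  by apply: le_lt_trans (ltry 1%R); apply: probability_le1; exact: measurableT.
have hE y : D1 y -> h y = (cdf_of f (x / y))%:E.
  move=> /itv0cP /andP[y0 _]; rewrite -cdf_of_distribution; congr (distribution _ _ _).
  by apply/seteqP; split => a /=; rewrite /xsection /= inE /S/= in_itv/= ler_pdivlMr.
have e : cdf (fading X Y : {RV P >-> R}) x = (\int[mu]_(y in D1) (h y * (g y)%:E))%E.
  transitivity (\int[mu]_y (h y * (g y)%:E))%E.
    rewrite -(integral_density dY ih) -(joint_distribution iXY mS).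
    by congr (P _).
  rewrite [RHS]integral_mkcond; apply: eq_integral => y _; rewrite patchE.
  by case: ifPn => // /negP; rewrite inE => /g0 ->; rewrite mule0.
have e2 : (\int[mu]_(y in D1) (h y * (g y)%:E) =
    \int[mu]_(y in D1) (g y * cdf_of f (x / y))%:E)%E.
  by apply: eq_integral => y /[!inE] /hE ->; rewrite muleC.
have i : mu.-integrable D1 (EFin \o (fun y => g y * cdf_of f (x / y))).
  apply/integrableP; split.
    have m : measurable_fun D1 (fun y => (h y * (g y)%:E)%E).
      apply: measurable_funTS; apply: emeasurable_funM => //.
      exact/measurable_EFinP.
    apply: eq_measurable_fun m => y /[!inE] /hE -> /=.
    by rewrite muleC.
  have -> : (\int[mu]_(y in D1) `|(g y * cdf_of f (x / y))%:E| =
     \int[mu]_(y in D1) (g y * cdf_of f (x / y))%:E)%E.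
    apply: eq_integral => y _ /=; rewrite ger0_norm// mulr_ge0//.
    exact: cdf_of_ge0.
  rewrite -e2 -e; apply: (@le_lt_trans _ _ 1%E); last exact: ltry.
  exact: cdf_le1.
by split => //; rewrite e e2; exact: EFin_Rintegral.
Qed.

(** For even t the map h -> h^t is increasing on h >= 0 only, so the SNR and h can be compared only
    off the null set where a gain fails to be positive. *)
Lemma fading_pos : exists N : set T,
  [/\ measurable N, P N = 0 & forall w, ~ N w -> 0 < X w /\ 0 < Y w].
Proof.
have mi : measurable (`]-oo, 0]%classic : set R) by exact: measurable_itv.
exists (X @^-1` `]-oo, 0] `|` Y @^-1` `]-oo, 0]); split.
- by apply: measurableU; rewrite -[_ @^-1` _]setTI; exact: measurable_funP.
- have z (Z : {RV P >-> R}) (h : R -> R) : has_density P Z h ->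
      (forall x, x <= 0 -> h x = 0) -> P (Z @^-1` `]-oo, 0]) = 0.
    move=> [_ _ hE] h0; rewrite -[LHS]/(distribution P Z `]-oo, 0]) hE//.
    by apply: integral0_eq => a /=; rewrite in_itv/= => /h0 ->.
  have mXY (Z : {RV P >-> R}) : measurable (Z @^-1` `]-oo, 0]).
    by rewrite -[_ @^-1` _]setTI; exact: measurable_funP.
  apply/eqP; rewrite eq_le measure_ge0 andbT.
  apply: (le_trans (measureU2 _ (mXY X) (mXY Y))).
  have gn y : y <= 0 -> g y = 0 by move=> y0; apply: g0 => /itv0cP /andP[]; rewrite ltNge y0.
  by rewrite (etrans (congr2 (fun a b => a + b)%E (z _ _ dX f0) (z _ _ dY gn)) (adde0 _)).
- move=> w /= /not_orP; rewrite !in_itv/= => -[/negP a /negP b].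
  by rewrite !ltNge; split; assumption.
Qed.

Lemma cdf_snr (t : nat) (gamma0 x : R) : (0 < t)%N -> 0 < gamma0 -> 0 < x ->
  cdf (snr t (fading X Y) gamma0 : {RV P >-> R}) x =
  cdf (fading X Y : {RV P >-> R}) ((x / gamma0) `^ t%:R^-1).
Proof.
move=> t0 g0' x0; have [N [mN N0 NP]] := fading_pos.
set y := (x / gamma0) `^ t%:R^-1.
have xg : 0 < x / gamma0 by rewrite divr_gt0.
have y0 : 0 < y by rewrite powR_gt0.
have yt : y ^+ t = x / gamma0.
  by rewrite -powR_mulrn ?(ltW y0)// -powRrM mulVf ?powRr1 ?(ltW xg)// pnatr_eq0 -lt0n.
have nullD (A : set T) : measurable A -> P A = P (A `\` N).
  move=> mA; rewrite (measureDI P mA mN) [X in (_ + X)%E](_ : _ = 0%E) ?adde0//.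
  apply/eqP; rewrite eq_le measure_ge0 andbT -N0; apply: le_measure; rewrite ?inE//.
    exact: measurableI.
rewrite /cdf /distribution /pushforward.
have mi (z : R) : measurable (`]-oo, z]%classic : set R) by exact: measurable_itv.
rewrite nullD; last by rewrite -[_ @^-1` _]setTI; exact: measurable_snr.
rewrite [RHS]nullD; last by rewrite -[_ @^-1` _]setTI; exact: measurable_fading.
congr (P _); apply/seteqP.
have key w : ~ N w -> (gamma0 * fading X Y w ^+ t <= x) = (fading X Y w <= y).
  move=> /NP[Xw Yw]; have h0 : 0 < fading X Y w by rewrite mulr_gt0.
  by rewrite mulrC -ler_pdivlMr// -yt ler_pXn2r// nnegrE ltW.
by split => w /= []; rewrite !in_itv/= /snr => h nw; split => //; rewrite ?key// -key.
Qed.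

End ProductLaw.

(** * Lower bounds on the cdf of the fading coefficient near 0 *)

Section FadingBounds.
Context {R : realType} {d : measure_display} {T : measurableType d}.
Variable P : probability T R.
Local Notation mu := (@lebesgue_measure R).
Local Notation D1 := (`]0, 1]%classic : set R).

Variables (X Y : {RV P >-> R}) (f : R -> R) (v : R) (k : nat).
Hypotheses (v0 : 0 < v) (k0 : (0 < k)%N).
Hypotheses (dX : has_density P X f) (dY : has_density P Y (fog_density v k)).
Hypotheses (iXY : independent_RV P X Y).
Hypotheses (f0 : forall x, x <= 0 -> f x = 0).

Lemma fog_density_out (y : R) : ~ D1 y -> fog_density v k y = 0.
Proof. by move=> h; rewrite /fog_density; case: ifP => // h'; case: h; apply/itv0cP. Qed.

Let mD1 : measurable D1. Proof. exact: measurable_itv. Qed.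

Let fp x : 0 <= f x. Proof. by case: dX. Qed.

Lemma powR_expR (x a : R) : 0 < x -> x `^ a = expR (a * ln x).
Proof. by move=> x0; rewrite /powR gt_eqF. Qed.

Let fogI : \int[mu]_(y in D1) (fogk k.-1 y * expR ((v - 1) * ln y)) = (k.-1)`!%:R / v ^+ k.
Proof.
have := @cintegral_fog R v%:C k.-1 v0; rewrite prednK// => /(congr1 (@complex.Re R)).
have -> : complex.Re ((k.-1)`!%:R / v%:C ^+ k) = (k.-1)`!%:R / v ^+ k.
  by rewrite natC -realCX -realCV -realCM.
move=> <-.
rewrite -[RHS]/(\int[mu]_(y in D1) complex.Re ((fogk k.-1 y)%:C * cpow y (v%:C - 1))).
apply: eq_Rintegral => y /[!inE] /itv0cP /andP[y0 _].
by rewrite cRe_scale -real1C -realCN -realCD cpow_real//= powR_expR.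
Qed.

(* Read off from the total mass of the fog density. *)
Lemma rGamma_nat : rGamma k%:R = (k.-1)`!%:R :> R.
Proof.
have G0 : 0 < rGamma k%:R :> R by rewrite rGamma_gt0// ltr0n.
have e : (\int[mu]_x (fog_density v k x)%:E = \int[mu]_(x in D1) (fog_density v k x)%:E)%E.
  rewrite [RHS]integral_mkcond; apply: eq_integral => y _; rewrite patchE.
  by case: ifPn => // /negP; rewrite inE => /fog_density_out ->.
have := density_integral1 dY; rewrite e (EFin_Rintegral mD1 (integrable_density dY mD1)).
move=> [] h.
have : v ^+ k / rGamma k%:R * ((k.-1)`!%:R / v ^+ k) = 1.
  rewrite -fogI -[RHS]h -RintegralZl//; last exact: integrable_fogk.
  apply: eq_Rintegral => y /[!inE] /itv0cP Dy.
  by rewrite /fog_density Dy powR_expR ?mulrA//; case/andP: Dy.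
rewrite mulrACA [_ ^+ k * _]mulrC mulrACA mulfV ?mulr1 ?expf_neq0 ?gt_eqF//.
by move/(congr1 (fun u => u * rGamma k%:R)); rewrite mul1r mulfVK ?gt_eqF.
Qed.

Lemma fog_densityE (y : R) : D1 y -> fog_density v k y = v ^+ k * fog_weight v k y.
Proof.
move=> /itv0cP Dy; rewrite /fog_density Dy rGamma_nat powR_expR; last by case/andP: Dy.
by rewrite /fog_weight /fogk !mulrA.
Qed.

(** Staying below 1/2 keeps the logarithmic factor above a power of ln 2; near 1 the fog density may
    tend to 0. *)
Lemma fog_density_lower : exists2 G : R, 0 < G & forall y0 y : R, 0 < y0 <= 2^-1 ->
  y0 / 2 <= y <= y0 -> G * expR ((v - 1) * ln y0) <= fog_density v k y.
Proof.
have l2 : 0 < ln 2 :> R by rewrite ln_gt0// ltr1n.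
have F0 : 0 < (k.-1)`!%:R :> R by rewrite ltr0n fact_gt0.
exists (v ^+ k / (k.-1)`!%:R * ln 2 ^+ k.-1 * expR (- (`|v - 1| * ln 2))).
  by rewrite !mulr_gt0 ?expR_gt0 ?invr_gt0 ?exprn_gt0.
move=> y0 y /andP[y00 y0h] /andP[h1 h2].
have yp : 0 < y by apply: lt_le_trans h1; rewrite divr_gt0.
have y1 : y <= 2^-1 by apply: le_trans y0h.
have h21 : (2^-1 : R) <= 1 by rewrite invf_le1// ler1n.
have Dy : D1 y by apply/itv0cP; rewrite yp (le_trans y1).
rewrite fog_densityE// /fog_weight -!mulrA ler_pM2l ?exprn_gt0// ler_pM2l ?invr_gt0//.
rewrite /fogk; apply: ler_pM; rewrite ?exprn_ge0 ?mulr_ge0 ?expR_ge0 ?(ltW l2)//.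
  apply: lerXn2r; rewrite ?nnegrE ?(ltW l2)//.
    by rewrite ln_ge0// -[1]invr1 lef_pV2 ?posrE// (le_trans y1).
  by rewrite ler_ln ?posrE ?invr_gt0// -[2]invrK lef_pV2 ?posrE ?invr_gt0.
apply: expR_ln_ge => //; rewrite h1 /=; lra.
Qed.

Lemma cdf_of_lower (b K x1 : R) : 0 < K -> 0 < x1 ->
  (forall x, 0 < x <= x1 -> K * expR ((b - 1) * ln x) <= f x) ->
  exists2 L : R, 0 < L & forall x, 0 < x <= x1 -> L * expR (b * ln x) <= cdf_of f x.
Proof.
move=> K0 x10 hf.
exists (K * expR (- (`|b - 1| * ln 2)) / 2); first by rewrite !mulr_gt0 ?expR_gt0 ?invr_gt0.
move=> x /andP[x0 xx1].
have mx : measurable (`]0, x]%classic : set R) by exact: measurable_itv.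
have h : (K * (expR (- (`|b - 1| * ln 2)) * expR ((b - 1) * ln x))) * (x - x / 2) <= cdf_of f x.
  apply: (Rintegral_box mx (integrable_density dX mx)).
  - by move=> y _; exact: fp.
  - lra.
  - by move=> y /andP[y1 y2]; apply/itv0cP; rewrite y2 andbT; lra.
  move=> y /andP[y1 y2]; have y0 : 0 < y by lra.
  apply: le_trans (hf y _); last by rewrite y0 (le_trans y2).
  by rewrite ler_pM2l//; apply: expR_ln_ge => //; rewrite y1 /=; lra.
apply: le_trans h; rewrite le_eqVlt; apply/orP; left; apply/eqP.
have -> : b * ln x = (b - 1) * ln x + ln x by ring.
by rewrite expRD lnK ?posrE//; field.
Qed.

(** For x > 0 this is the cdf of the fading coefficient, by [cdf_fading]. *)
Definition cdf_fog (x : R) : R := \int[mu]_(y in D1) (fog_density v k y * cdf_of f (x / y)).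

Lemma cdf_fog_box (x c y0 : R) : 0 < x -> 0 < y0 <= 2^-1 ->
  (forall y, y0 / 2 <= y <= y0 -> c <= fog_density v k y * cdf_of f (x / y)) ->
  c * (y0 - y0 / 2) <= cdf_fog x.
Proof.
move=> x0 /andP[y00 y0h] hc.
have gp y : 0 <= fog_density v k y by case: dY.
have [i _] := cdf_fading dX dY iXY f0 fog_density_out x0.
apply: (Rintegral_box mD1 i) => //.
- by move=> y _; rewrite mulr_ge0 ?gp ?(cdf_of_ge0 dX).
- lra.
- by move=> y /andP[y1 y2]; apply/itv0cP; apply/andP; split; lra.
Qed.

(** A small product caused by the turbulence: the fog gain stays in [1/4, 1/2], and the cdf at x / y
    is at least the one at x. *)
Lemma cdf_fog_lower_tp (b K x1 : R) : 0 < K -> 0 < x1 ->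
  (forall x, 0 < x <= x1 -> K * expR ((b - 1) * ln x) <= f x) ->
  exists2 L : R, 0 < L & forall x, 0 < x <= x1 -> L * expR (b * ln x) <= cdf_fog x.
Proof.
move=> K0 x10 hf; have [L L0 hL] := cdf_of_lower K0 x10 hf.
have [G G0 hG] := fog_density_lower.
have h20 : 0 < (2^-1 : R) by rewrite invr_gt0.
pose G' := G * expR ((v - 1) * ln 2^-1).
exists (G' * L / 4); first by rewrite !mulr_gt0 ?expR_gt0 ?invr_gt0.
move=> x xx1; have /andP[x0 _] := xx1.
have h : (G' * (L * expR (b * ln x))) * (2^-1 - 2^-1 / 2) <= cdf_fog x.
  apply: cdf_fog_box => // [|y yh]; first by rewrite h20 /=.
  have /andP[y1 y2] := yh.
  apply: ler_pM; rewrite ?mulr_ge0 ?expR_ge0 ?(ltW G0) ?(ltW L0)//.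
    by apply: hG => //; rewrite h20 /=.
  apply: (le_trans (hL x xx1)); apply: (cdf_of_le dX f0).
  have y0 : 0 < y by lra.
  by rewrite ler_pdivlMr// ler_piMr ?(ltW x0)//; lra.
by apply: le_trans h; rewrite le_eqVlt; apply/orP; left; apply/eqP; field.
Qed.

(** A small product caused by the fog: its gain lies in [x / (2B), x / B], which has mass of order
    x^v, while the other gain is only required to be at most B. *)
Lemma cdf_fog_lower_fog (B : R) : 0 < B -> 0 < cdf_of f B ->
  exists2 L : R, 0 < L & forall x, 0 < x <= B / 2 -> L * expR (v * ln x) <= cdf_fog x.
Proof.
move=> B0 FB; have [G G0 hG] := fog_density_lower.
exists (G * cdf_of f B / 2 * expR (- (v * ln B))).
  by rewrite !mulr_gt0 ?expR_gt0 ?invr_gt0.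
move=> x /andP[x0 xB]; have xB0 : 0 < x / B by rewrite divr_gt0.
have xBh : 0 < x / B <= 2^-1 by rewrite xB0 /= ler_pdivrMr// mulrC.
have h : (G * expR ((v - 1) * ln (x / B)) * cdf_of f B) * (x / B - x / B / 2) <= cdf_fog x.
  apply: cdf_fog_box => // y yh; have /andP[y1 y2] := yh.
  apply: ler_pM; rewrite ?mulr_ge0 ?expR_ge0 ?(ltW G0) ?(ltW FB)//.
    exact: hG.
  have y0 : 0 < y by apply: lt_le_trans y1; rewrite divr_gt0.
  by apply: (cdf_of_le dX f0); rewrite ler_pdivlMr// mulrC -ler_pdivlMr.
apply: le_trans h; rewrite le_eqVlt; apply/orP; left; apply/eqP.
have -> : v * ln x = (v - 1) * ln (x / B) + ln (x / B) + v * ln B.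
  by rewrite ln_div ?posrE//; ring.
rewrite expRD expRD lnK ?posrE// -mulrA [expR (- _) * _]mulrC -!mulrA.
rewrite -expRD addrN expR0 mulr1; field.
by rewrite gt_eqF.
Qed.

End FadingBounds.

(** * The average error rate as a sum of Mellin integrals *)

Section LinkFormula.
Context {R : realType} {d : measure_display} {T : measurableType d}.
Variable P : probability T R.
Local Notation mu := (@lebesgue_measure R).
Local Notation Dp := (`]0, +oo[%classic : set R).
Local Notation D1 := (`]0, 1]%classic : set R).

Lemma Rintegral_comb (D : set R) (s : seq nat) (a : nat -> R) (F : nat -> R -> R) :
  measurable D -> (forall l, l \in s -> mu.-integrable D (EFin \o F l)) ->
  mu.-integrable D (EFin \o (fun y => \sum_(l <- s) a l * F l y)) /\
  \int[mu]_(y in D) (\sum_(l <- s) a l * F l y) = \sum_(l <- s) a l * \int[mu]_(y in D) F l y.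
Proof.
move=> mD; elim: s => [|j s IH] iF.
  have e : (fun y : R => \sum_(l <- [::]) a l * F l y) = cst 0 by apply/funext => y; rewrite big_nil.
  rewrite e big_nil; split; last by rewrite Rintegral_cst// mul0r.
  exact: integrable0.
have [|i1 e1] := IH; first by move=> l ls; apply: iF; rewrite in_cons ls orbT.
have ij : mu.-integrable D (EFin \o (fun y => a j * F j y)).
  by apply: integrableZl_fin => //; apply: iF; rewrite mem_head.
have e : (fun y : R => \sum_(l <- j :: s) a l * F l y) =
    (fun y => a j * F j y + \sum_(l <- s) a l * F l y).
  by apply/funext => y; rewrite big_cons.
rewrite e big_cons -e1; split.
  exact: (@integrableD _ _ _ mu D mD _ _ ij i1).
rewrite RintegralD//; congr (_ + _); rewrite RintegralZl//.
by apply: iF; rewrite mem_head.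
Qed.

Variables (X Y : {RV P >-> R}) (f : R -> R) (v r c : R) (k n : nat).
Hypotheses (k0 : (0 < k)%N).
Hypotheses (dX : has_density P X f) (dY : has_density P Y (fog_density v k)).
Hypotheses (iXY : independent_RV P X Y).
Hypotheses (f0 : forall x, x <= 0 -> f x = 0).
Hypotheses (rv : r <= v) (c0 : 0 < c) (cr : c < r).

Variables (a C : nat -> R) (krn : nat -> R[i] -> R[i]).
Hypothesis C0 : forall l, (1 <= l <= n)%N -> 0 < C l.
Hypothesis skrn : forall l, (1 <= l <= n)%N -> slit_holomorphic 0 r (krn l).
Hypothesis dkrn : forall l, (1 <= l <= n)%N -> strip_decay (krn l).
Hypothesis im0 : forall l x, (1 <= l <= n)%N -> 0 < x ->
  complex.Im (mellin_line c (krn l) x) = 0.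
Hypothesis fE : forall x, 0 < x -> f x =
  \sum_(1 <= l < n.+1) a l * (x^-1 * complex.Re (mellin_line c (krn l) (C l * x))).

Let v0 : 0 < v := lt_trans c0 (lt_le_trans cr rv).

Let inP l : l \in index_iota 1 n.+1 -> (1 <= l <= n)%N.
Proof. by rewrite mem_index_iota ltnS. Qed.

Lemma cdf_of_mellin (x : R) : 0 < x -> cdf_of f x =
  \sum_(1 <= l < n.+1) a l * complex.Re (mellin_line c (cdf_kern (krn l)) (C l * x)).
Proof.
move=> x0; have mx : measurable (`]0, x]%classic : set R) by exact: measurable_itv.
pose F l (y : R) : R := y^-1 * complex.Re (mellin_line c (krn l) (C l * y)).
have [|_ e] := @Rintegral_comb `]0, x]%classic (index_iota 1 n.+1) a F mx.
  move=> l /inP hl.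
  by have [] := cdf_kern_value c0 cr (skrn hl) (dkrn hl) (fun x => im0 hl) (C0 hl) x0.
transitivity (\int[mu]_(y in `]0, x]) (\sum_(1 <= l < n.+1) a l * F l y)).
  by apply: eq_Rintegral => y /[!inE] /itv0cP /andP[y0 _]; exact: fE.
rewrite e; apply: eq_big_seq => l /inP hl; congr (_ * _).
by have [_ ->] := cdf_kern_value c0 cr (skrn hl) (dkrn hl) (fun x => im0 hl) (C0 hl) x0.
Qed.

Let s1 l : (1 <= l <= n)%N -> slit_holomorphic 0 r (cdf_kern (krn l)).
Proof. by move=> hl; apply: slit_cdf_kern; exact: skrn. Qed.

Let d1 l : (1 <= l <= n)%N -> strip_decay (cdf_kern (krn l)).
Proof. by move=> hl; apply: decay_cdf_kern; exact: dkrn. Qed.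

Let im1 l x : (1 <= l <= n)%N -> 0 < x ->
  complex.Im (mellin_line c (cdf_kern (krn l)) x) = 0.
Proof.
move=> hl x0.
have [_ _] := cdf_kern_value c0 cr (skrn hl) (dkrn hl) (fun x => im0 hl) (C0 hl)
  (divr_gt0 x0 (C0 hl)).
by rewrite mulrC divfK// gt_eqF// C0.
Qed.

Lemma cdf_fog_mellin (x : R) : 0 < x -> cdf_fog f v k x =
  \sum_(1 <= l < n.+1) (v ^+ k * a l) *
    complex.Re (mellin_line c (fog_kern v k (cdf_kern (krn l))) (C l * x)).
Proof.
move=> x0; have mD1 : measurable D1 by exact: measurable_itv.
pose F l (y : R) : R := fog_weight v k y *
  complex.Re (mellin_line c (cdf_kern (krn l)) (C l * x / y)).
have Cx l : (1 <= l <= n)%N -> 0 < C l * x by move=> hl; rewrite mulr_gt0// C0.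
have [|_ e] := @Rintegral_comb D1 (index_iota 1 n.+1) (fun l => v ^+ k * a l) F mD1.
  move=> l /inP hl.
  by have [] := fog_kern_value rv c0 cr (s1 hl) (d1 hl) (fun x => im1 hl) k0 (Cx l hl).
transitivity (\int[mu]_(y in D1) (\sum_(1 <= l < n.+1) (v ^+ k * a l) * F l y)).
  apply: eq_Rintegral => y /[!inE] Dy; have /itv0cP /andP[y0 _] := Dy.
  rewrite (fog_densityE v0 k0 dY Dy) (cdf_of_mellin (divr_gt0 x0 y0)) mulr_sumr.
  by apply: eq_bigr => l _; rewrite /F [C l * (x / y)]mulrA; ring.
rewrite e; apply: eq_big_seq => l /inP hl; congr (_ * _).
by have [_ ->] := fog_kern_value rv c0 cr (s1 hl) (d1 hl) (fun x => im1 hl) k0 (Cx l hl).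
Qed.

Let s2 l : (1 <= l <= n)%N -> slit_holomorphic 0 r (fog_kern v k (cdf_kern (krn l))).
Proof. by move=> hl; apply: slit_fog_kern => //; exact: s1. Qed.

Let d2 l : (1 <= l <= n)%N -> strip_decay (fog_kern v k (cdf_kern (krn l))).
Proof. by move=> hl; apply: decay_fog_kern; exact: d1. Qed.

Let im2 l x : (1 <= l <= n)%N -> 0 < x ->
  complex.Im (mellin_line c (fog_kern v k (cdf_kern (krn l))) x) = 0.
Proof.
move=> hl x0.
by have [] := fog_kern_value rv c0 cr (s1 hl) (d1 hl) (fun x => im1 hl) k0 x0.
Qed.

Variables (t : nat) (p q : R).
Hypotheses (t0 : (0 < t)%N) (p0 : 0 < p) (q0 : 0 < q).

Let tau0 : 0 < t%:R^-1 :> R. Proof. by rewrite invr_gt0 ltr0n. Qed.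

Definition link_kern (l : nat) : R[i] -> R[i] :=
  ber_kern p t%:R^-1 (fog_kern v k (cdf_kern (krn l))).

Lemma cdf_snr_fog (gamma0 x : R) : 0 < gamma0 -> 0 < x ->
  fine (cdf (snr t (fading X Y) gamma0 : {RV P >-> R}) x) =
  cdf_fog f v k (expR (t%:R^-1 * (ln x - ln gamma0))).
Proof.
move=> g0 x0.
have g0' : forall y, ~ D1 y -> fog_density v k y = 0 by exact: fog_density_out.
rewrite (cdf_snr dX dY f0 g0' t0 g0 x0) powR_expR ?divr_gt0// ln_div ?posrE//.
by have [_ ->] := cdf_fading dX dY iXY f0 g0' (expR_gt0 (t%:R^-1 * (ln x - ln gamma0))).
Qed.

(** Integrability is recorded because the lower bound restricts this very integral to a box; the
    vanishing imaginary parts allow the identity to be restated in the complex numbers. *)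
Lemma link_BER (gamma0 : R) : 0 < gamma0 ->
  [/\ mu.-integrable Dp (EFin \o (fun x => x `^ (p - 1) * expR (- (q * x)) *
        fine (cdf (snr t (fading X Y) gamma0 : {RV P >-> R}) x))),
    average_BER P p q (snr t (fading X Y) gamma0) =
      \sum_(1 <= l < n.+1) (v ^+ k * a l / (2 * rGamma p)) * complex.Re (mellin_line c
        (link_kern l) (C l * expR (- t%:R^-1 * ln gamma0) * expR (- t%:R^-1 * ln q))) &
    forall l, (1 <= l <= n)%N -> complex.Im (mellin_line c
        (link_kern l) (C l * expR (- t%:R^-1 * ln gamma0) * expR (- t%:R^-1 * ln q))) = 0].
Proof.
move=> g0; have mDp := @measurable_Dp R.
pose Z l : R := C l * expR (- t%:R^-1 * ln gamma0).
have Z0 l : (1 <= l <= n)%N -> 0 < Z l by move=> hl; rewrite mulr_gt0 ?expR_gt0 ?C0.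
pose K l := fog_kern v k (cdf_kern (krn l)).
pose F l (x : R) : R := ber_weight p q x *
  complex.Re (mellin_line c (K l) (Z l * expR (t%:R^-1 * ln x))).
have bv l hl := ber_kern_value c0 cr (s2 hl) (d2 hl) (fun x => im2 hl) p0 q0 tau0 (Z0 l hl).
have [|iG eG] := @Rintegral_comb Dp (index_iota 1 n.+1) (fun l => v ^+ k * a l) F mDp.
  by move=> l /inP hl; have [] := bv l hl.
pose G (x : R) : R := \sum_(1 <= l < n.+1) (v ^+ k * a l) * F l x.
have hG (x : R) : Dp x -> x `^ (p - 1) * expR (- (q * x)) *
    fine (cdf (snr t (fading X Y) gamma0 : {RV P >-> R}) x) = expR (- (p * ln q)) * G x.
  move=> /DpP x0; rewrite cdf_snr_fog// cdf_fog_mellin ?expR_gt0//.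
  have -> : x `^ (p - 1) * expR (- (q * x)) = expR (- (p * ln q)) * ber_weight p q x.
    by rewrite /ber_weight powR_expR// [RHS]mulrA -(expRD (- (p * ln q))) addNr expR0 mul1r mulrC.
  have eF l : C l * expR (t%:R^-1 * (ln x - ln gamma0)) = Z l * expR (t%:R^-1 * ln x).
    by rewrite /Z -mulrA -expRD; congr (_ * expR _); ring.
  rewrite -mulrA; apply: (congr1 (fun u => _ * u)); rewrite mulr_sumr.
  apply: eq_bigr => l _; rewrite eF; exact: mulrCA.
have iE := integrableZl_fin (expR (- (p * ln q))) mDp iG.
split.
- apply: eq_integrable iE => // x /[!inE] Dx.
  exact: (congr1 EFin (esym (hG x Dx))).
- rewrite /average_BER.
  have -> : \int[mu]_(x in Dp) (x `^ (p - 1) * expR (- (q * x)) *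
      fine (cdf (snr t (fading X Y) gamma0 : {RV P >-> R}) x)) =
      expR (- (p * ln q)) * \int[mu]_(x in Dp) G x.
    rewrite -RintegralZl//; apply: eq_Rintegral => x /[!inE] Dx; exact: hG.
  have ew (I : R) : q `^ p / (2 * rGamma p) * (expR (- (p * ln q)) * I) = (2 * rGamma p)^-1 * I.
    by rewrite powR_expR// mulrACA -expRD addrN expR0 mul1r.
  rewrite ew eG mulr_sumr.
  apply: eq_big_seq => l /inP hl; have [_ <- _] := bv l hl.
  by rewrite [v ^+ k * a l / _]mulrC; exact: mulrA.
- by move=> l hl; have [_ _ h] := bv l hl; exact: h.
Qed.

Lemma link_BER_complex (gamma0 : R) : 0 < gamma0 ->
  (average_BER P p q (snr t (fading X Y) gamma0))%:C =
  \sum_(1 <= l < n.+1) (v ^+ k * a l / (2 * rGamma p))%:C * mellin_line c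
    (link_kern l) (C l * expR (- t%:R^-1 * ln gamma0) * expR (- t%:R^-1 * ln q)).
Proof.
move=> g0; have [_ -> im] := link_BER g0.
rewrite rmorph_sum; apply: eq_big_seq => l /inP hl.
apply: etrans (realCM _ _) _; apply: (congr1 (fun u => _ * u)).
by apply: complex_eq => //; rewrite im.
Qed.

(** The l-th argument is C_l (q gamma0)^(-1/t), and the integral over Re s = c is at most a constant
    times its c-th power. The constant depends on c, which is fixed here. *)
Lemma link_BER_upper : exists2 K : R, 0 < K & forall gamma0, 0 < gamma0 ->
  average_BER P p q (snr t (fading X Y) gamma0) <= K * expR (- (c * t%:R^-1) * ln gamma0).
Proof.
have G0 := rGamma_gt0 p0.
pose w l : R := v ^+ k * a l / (2 * rGamma p).
have B l : exists B : R, (1 <= l <= n)%N -> 0 <= B /\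
    forall x, normc (mellin_line c (link_kern l) x) <= B * expR (c * ln x).
  have [hl|hl] := boolP ((1 <= l <= n)%N); last by exists 0.
  have cc : 0 < c < r by rewrite c0 cr.
  have [B B0 hB] := normc_mellin_line (vertical_integrable
    (slit_ber_kern (s2 hl) p0 tau0) (decay_ber_kern (d2 hl) p tau0) cc).
  by exists B.
have [B' hB] := boolp.choice B.
pose K : R := \sum_(1 <= l < n.+1) `|w l| * (B' l * expR (c * ln (C l) - c * t%:R^-1 * ln q)).
have K0 : 0 <= K.
  rewrite /K big_seq; apply: sumr_ge0 => l /inP hl; have [b0 _] := hB l hl.
  by rewrite !mulr_ge0 ?expR_ge0.
exists (K + 1) => [|g g0]; first by rewrite ltr_wpDl.
apply: (@le_trans _ _ (K * expR (- (c * t%:R^-1) * ln g))); last first.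
  by rewrite ler_pM2r ?expR_gt0// lerDl.
have [_ -> _] := link_BER g0; rewrite /K mulr_suml big_seq [leRHS]big_seq.
apply: ler_sum => l /inP hl; have [b0 hb] := hB l hl.
apply: (le_trans (ler_norm _)); rewrite normrM -/(w l) -(mulrA `|w l|).
apply: ler_wpM2l => //.
apply: (le_trans (ler_Re_normc _)); apply: (le_trans (hb _)).
rewrite -(mulrA (B' l)) ler_wpM2l// -expRD ler_expR !ln_mul_expR ?mulr_gt0 ?expR_gt0 ?C0//.
by rewrite le_eqVlt; apply/orP; left; apply/eqP; ring.
Qed.

(** Box [1, 2] in the integration variable: there the weight is bounded below and, as b >= 0, the
    factor x^(b/t) is at least 1. *)
Lemma link_BER_lower (b x1 L : R) : 0 <= b -> 0 < L -> 0 < x1 ->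
  (forall x, 0 < x <= x1 -> L * expR (b * ln x) <= cdf_fog f v k x) ->
  exists2 K : R, 0 < K & exists g1 : R, forall gamma0, 0 < gamma0 -> g1 <= ln gamma0 ->
    K * expR (- (b * t%:R^-1) * ln gamma0) <=
    average_BER P p q (snr t (fading X Y) gamma0).
Proof.
move=> b0 L0 x10 hL; have mDp := @measurable_Dp R.
have G0 := rGamma_gt0 p0.
pose m : R := expR (- (`|p - 1| * ln 2)) * expR (- (2 * q)).
pose w : R := q `^ p / (2 * rGamma p).
have w0 : 0 < w by rewrite divr_gt0 ?powR_gt0// mulr_gt0.
have m0 : 0 < m by rewrite mulr_gt0 ?expR_gt0.
exists (w * (m * L)); first exact: mulr_gt0 w0 (mulr_gt0 m0 L0).
(* From this threshold on (2 / gamma0)^(1/t) <= x1, so the bound near 0 applies on the whole box. *)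
exists (ln 2 - t%:R * ln x1) => g g0 gg; have [i _ _] := link_BER g0.
have tp : 0 < t%:R :> R by rewrite ltr0n.
rewrite /average_BER -/w -(mulrA w); apply: (ler_wpM2l (ltW w0)).
set e := expR _; have -> : m * L * e = m * (L * e) * (2 - 1) by ring.
apply: (Rintegral_box mDp i).
- move=> x _; rewrite !mulr_ge0 ?powR_ge0 ?expR_ge0//.
  by apply: fine_ge0; exact: cdf_ge0.
- lra.
- by move=> x /andP[x1' _]; apply/DpP; lra.
move=> x /andP[xl xu]; have x0 : 0 < x by lra.
apply: ler_pM; rewrite ?mulr_ge0 ?expR_ge0 ?(ltW L0)//.
  apply: ler_pM; rewrite ?expR_ge0//.
    rewrite powR_expR//; have := @expR_ln_ge R (p - 1) x 1 ltr01.
    by rewrite ln1 mulr0 expR0 !mulr1; apply; apply/andP; split; lra.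
  by rewrite ler_expR lerN2 mulrC ler_wpM2r ?(ltW q0).
rewrite cdf_snr_fog//; apply: le_trans (hL _ _); last first.
  rewrite expR_gt0 /= -[leRHS]lnK ?posrE// ler_expR.
  have l2 : ln x <= ln 2 by rewrite ler_ln ?posrE.
  by rewrite mulrC ler_pdivrMr//; lra.
rewrite ler_pM2l// ler_expR expRK.
have lx : 0 <= ln x by rewrite ln_ge0.
have -> : b * (t%:R^-1 * (ln x - ln g)) = - (b * t%:R^-1) * ln g + b * t%:R^-1 * ln x by ring.
by rewrite lerDl !mulr_ge0 ?(ltW tau0).
Qed.

End LinkFormula.

(** * From power bounds to the diversity order *)

Section DiversityLimit.
Context {R : realType}.

(** The upper bound is asked only strictly below b: coinciding exponents may bring in logarithms of
    g, which the limit does not see. *)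
Lemma diversity_limit (F : R -> R) (b : R) : 0 < b ->
  (forall c, 0 < c < b -> exists2 K : R, 0 < K &
     forall g, 0 < g -> F g <= K * expR (- c * ln g)) ->
  (exists2 K : R, 0 < K & exists g1 : R,
     forall g, 0 < g -> g1 <= ln g -> K * expR (- b * ln g) <= F g) ->
  - (ln (F g) / ln g) @[g --> +oo] --> b.
Proof.
move=> b0 hU [k k0 [g1 hL]].
apply/cvgrPdist_le => e e0.
(* Within e/2 of b and still positive. *)
pose c := b - Num.min (b / 2) (e / 2).
have mc : 0 < Num.min (b / 2) (e / 2) by rewrite lt_min !divr_gt0.
have m1 : Num.min (b / 2) (e / 2) <= b / 2 by rewrite ge_min lexx.
have m2 : Num.min (b / 2) (e / 2) <= e / 2 by rewrite ge_min lexx orbT.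
have c0 : 0 < c < b by apply/andP; split; rewrite /c; lra.
have [K K0 hK] := hU c c0.
(* Beyond exp B the logarithm is positive and past [g1], and the constants [K] and [k] contribute at
   most e/2 to the ratio. *)
pose B := 1 + `|g1| + 2 * (`|ln K| + `|ln k|) / e.
exists (expR B); split; first exact: num_real.
move=> g /= gB; have g0 : 0 < g by apply: lt_trans gB; exact: expR_gt0.
have LB : B < ln g by rewrite -[B]expRK ltr_ln ?posrE ?expR_gt0.
set L := ln g in LB *.
have n1 := ler_norm g1; have n2 := ler_norm (ln K); have n3 := ler_norm (- ln k).
rewrite normrN in n3.
have q0 : 0 <= 2 * (`|ln K| + `|ln k|) / e by rewrite divr_ge0 ?(ltW e0)// mulr_ge0// addr_ge0.
have L0 : 0 < L by rewrite /B in LB; have := normr_ge0 g1; lra.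
have LE : 2 * (`|ln K| + `|ln k|) <= e * L.
  rewrite -ler_pdivrMl// mulrC; apply: le_trans (ltW LB); rewrite /B.
  have := normr_ge0 g1; lra.
have lo : k * expR (- b * L) <= F g by apply: hL => //; rewrite -/L; rewrite /B in LB; lra.
have up : F g <= K * expR (- c * L) by exact: hK.
have F0 : 0 < F g by apply: lt_le_trans lo; rewrite mulr_gt0 ?expR_gt0.
have u1 : ln (F g) <= ln K - c * L.
  rewrite -mulNr -(expRK (- c * L)) -lnM ?posrE ?expR_gt0// ler_ln ?posrE ?mulr_gt0 ?expR_gt0//.
have l1 : ln k - b * L <= ln (F g).
  rewrite -mulNr -(expRK (- b * L)) -lnM ?posrE ?expR_gt0// ler_ln ?posrE ?mulr_gt0 ?expR_gt0//.
have -> : b - - (ln (F g) / L) = (b * L + ln (F g)) / L by field; rewrite gt_eqF.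
rewrite normrM (gtr0_norm (_ : 0 < L^-1)) ?invr_gt0// ler_pdivrMr// ler_norml.
have N1 := normr_ge0 (ln K); have N2 := normr_ge0 (ln k).
have bc : (b - c) * L <= e / 2 * L by rewrite ler_pM2r// /c; lra.
apply/andP; split; lra.
Qed.

End DiversityLimit.

(** * Fox's H-function as an integral over a vertical line *)

Section FoxEvaluation.
Context {R : realType}.
Local Notation mu := (@lebesgue_measure R).
Local Notation ii := (@Complex R 0 1).

(** The left end [l] may depend on the contour: when no pole lies to the left, admissible contours
    can cross the real axis arbitrarily far out. The integrand has to agree with the kernel only off
    the slits, which no admissible contour meets. *)
Lemma foxH_mellin (m n : nat) (A B : seq (R * R)) (x r c0 : R) (K : R[i] -> R[i]) :
  strip_decay K -> separates m n A B (fun=> c0) ->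
  (forall c, contour c -> separates m n A B c -> exists l : R,
    [/\ l < c0 < r, l < c 0 < r, slit_holomorphic l r K &
        forall s, complex.Im s <> 0 \/ l < complex.Re s < r ->
          foxH_integrand m n A B x s = K s * cpow x s]) ->
  foxH m n A B x = mellin_line c0 K x.
Proof.
move=> dK sep0 hK.
pose f s := K s * cpow x s.
have df : strip_decay f := decayM dK (bounded_cpow x).
have ii0 : ii != 0 by apply/eqP => /(congr1 (@complex.Im R)) /= /eqP; rewrite oner_eq0.
have inv : forall I : R[i], ((2 * pi)%:C * ii)^-1 * (ii * I) = (2 * pi)^-1%:C * I.
  by move=> I; rewrite invfM realCV -mulrA mulKf.
have ct0 : contour (fun=> c0).
  have d0 : derive1 (fun=> c0 : R) = cst 0.
    by apply/funext => t; rewrite derive1E derive_cst.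
  split.
  - by move=> t; exact: derivable_cst.
  - by rewrite d0 => t; exact: cvg_cst.
  - by exists `|c0|.
have gE (c : R -> R) l : l < c 0 < r ->
    (forall s, complex.Im s <> 0 \/ l < complex.Re s < r ->
      foxH_integrand m n A B x s = f s) ->
    forall t, foxH_integrand m n A B x (contour_point c t) = f (c t +i* t).
  move=> lc h t; apply: h => /=; have [->|t0] := eqVneq t 0; first by right.
  by left; apply/eqP.
have val w : is_foxH m n A B x w -> w = mellin_line c0 K x.
  move=> [c [hc sc ig ->]]; have [l [lc0 lc sK hI]] := hK c hc sc.
  have sf : slit_holomorphic l r f := slitM sK (slit_cpow x).
  have e : (fun t => foxH_integrand m n A B x (contour_point c t) * (derive1 c t +i* 1)) =
      (fun t => f (c t +i* t) * (derive1 c t +i* 1)).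
    by apply/funext => t; rewrite (gE c l lc hI).
  by rewrite e in ig *; rewrite (contour_integral_eq sf df hc lc0 lc ig) inv.
have ex : is_foxH m n A B x (mellin_line c0 K x).
  have [l [lc0 _ sK hI]] := hK _ ct0 sep0.
  have sf : slit_holomorphic l r f := slitM sK (slit_cpow x).
  have iv := vertical_integrable sf df lc0.
  have mT : measurable ([set: R]) by exact: measurableT.
  exists (fun=> c0).
  have e : (fun t => foxH_integrand m n A B x (contour_point (fun=> c0) t) *
      (derive1 (fun=> c0) t +i* 1)) = (fun t => ii * f (c0 +i* t)).
    apply/funext => t; rewrite (gE _ l lc0 hI) mulrC; congr (_ * _).
    by rewrite derive1E derive_cst.
  split => //; first by rewrite e; exact: (cintegrableZ _ mT iv).
  by rewrite e (cintegralZ _ mT iv) inv.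
(* [xget] picks some value of the relation, and all values have been shown equal; it remains that
   one exists. *)
rewrite /foxH; apply: val.
have := @xgetPex _ 0 [set w | is_foxH m n A B x w]; apply.
by exists (mellin_line c0 K x).
Qed.

End FoxEvaluation.

(** * Evaluation of the H-functions *)

Section FoxKernels.
Context {R : realType}.

Lemma separates_cat (m n : nat) (A1 A2 B1 B2 : seq (R * R)) (c : R -> R) :
  size B1 = m -> size A1 = n ->
  separates m n (A1 ++ A2) (B1 ++ B2) c <->
  (forall b, b \in B1 -> forall nu : nat, c 0 < (b.1 + nu%:R) / b.2) /\
  (forall a, a \in A1 -> forall nu : nat, (a.1 - 1 - nu%:R) / a.2 < c 0).
Proof. by move=> sB sA; rewrite /separates !take_size_cat. Qed.

Lemma separates_lower (m n : nat) (A1 A2 B1 B2 : seq (R * R)) (c : R -> R) (b : R) :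
  size B1 = m -> size A1 = n -> separates m n (A1 ++ A2) (B1 ++ B2) c ->
  (b, 1) \in B1 -> c 0 < b.
Proof.
by move=> sB sA /(separates_cat _ _ _ sB sA)[h _] /h /(_ 0%N) /=; rewrite addr0 divr1.
Qed.

Lemma separates_upper (m n : nat) (A1 A2 B1 B2 : seq (R * R)) (c : R -> R) (a : R) :
  size B1 = m -> size A1 = n -> separates m n (A1 ++ A2) (B1 ++ B2) c ->
  (a, 1) \in A1 -> a - 1 < c 0.
Proof.
by move=> sB sA /(separates_cat _ _ _ sB sA)[_ h] /h /(_ 0%N) /=; rewrite subr0 divr1.
Qed.

(** In each sequence the pole with nu = 0 is the nearest to the line, so it alone has to be
    checked. *)
Lemma separates_cst (m n : nat) (A1 A2 B1 B2 : seq (R * R)) (c0 : R) :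
  size B1 = m -> size A1 = n ->
  all (fun b => (b.2 == 1) && (c0 < b.1)) B1 ->
  all (fun a => (0 < a.2) && (a.1 - 1 < c0 * a.2)) A1 ->
  separates m n (A1 ++ A2) (B1 ++ B2) (fun=> c0).
Proof.
move=> sB sA /allP hB /allP hA; apply/separates_cat => //; split.
  move=> b /hB /andP[/eqP -> h] nu; rewrite divr1 (lt_le_trans h)// lerDl//.
move=> a /hA /andP[a0 h] nu; rewrite ltr_pdivrMr//; apply: le_lt_trans h.
by rewrite gerBl.
Qed.

Lemma foxH_integrand_cat (m n : nat) (A1 A2 B1 B2 : seq (R * R)) (x : R) (s : R[i]) :
  size B1 = m -> size A1 = n ->
  foxH_integrand m n (A1 ++ A2) (B1 ++ B2) x s =
  (\prod_(b <- B1) cGamma (b.1%:C - b.2%:C * s)) *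
  (\prod_(a <- A1) cGamma (1 - a.1%:C + a.2%:C * s)) /
  ((\prod_(a <- A2) cGamma (a.1%:C - a.2%:C * s)) *
   (\prod_(b <- B2) cGamma (1 - b.1%:C + b.2%:C * s))) * cpow x s.
Proof. by move=> sB sA; rewrite /foxH_integrand !take_size_cat// !drop_size_cat. Qed.

Lemma prod_nseq (k : nat) (b : R * R) (F : R * R -> R[i]) :
  \prod_(a <- nseq k b) F a = F b ^+ k.
Proof. by rewrite big_nseq; elim: k => [|k IH] /=; rewrite ?expr0// IH exprS. Qed.

Lemma gamma_lower (b : R) (s : R[i]) : cGamma (b%:C - 1%:C * s) = gline b s.
Proof. by rewrite /gline realCN mulNr. Qed.

Lemma gamma_upper (a k : R) (s : R[i]) : cGamma (1 - (1 - a)%:C + k%:C * s) = cGamma (lin a k s).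
Proof. by rewrite /lin !(realCD, realCN) real1C; congr cGamma; ring. Qed.

Lemma gamma_upper1 (s : R[i]) : cGamma (1 - 1%:C + 1%:C * s) = cGamma s.
Proof. by rewrite !real1C subrr add0r mul1r. Qed.

Lemma gamma_lower0 (s : R[i]) : cGamma (1 - (0 : R)%:C + 1%:C * s) = cGamma (s + 1).
Proof. by rewrite !real1C subr0 mul1r addrC. Qed.

Lemma lin_ratio (b r l : R) (s : R[i]) : r <= b ->
  complex.Im s <> 0 \/ l < complex.Re s < r ->
  (lin b (-1) s)^-1 = gline b s / gline (b + 1) s.
Proof.
move=> rb h; rewrite -cGamma_ratio.
  by rewrite /gline /lin realCD real1C addrAC.
case: h => [h|/andP[_ h]]; [left|right]; rewrite /lin !cReImE /= ?mul0r ?mulN1r ?add0r ?subr0 ?addr0.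
  by move/eqP; rewrite oppr_eq0 => /eqP.
by rewrite subr_gt0 (lt_le_trans h).
Qed.

Lemma gline_lin (b : R) (s : R[i]) : gline b s = cGamma (lin b (-1) s).
Proof. by []. Qed.

Lemma lin_ratio0 (r : R) (s : R[i]) : complex.Im s <> 0 \/ 0 < complex.Re s < r ->
  (lin 0 1 s)^-1 = cGamma s / cGamma (s + 1).
Proof.
move=> h; rewrite /lin add0r real1C mul1r cGamma_ratio//.
by case: h => [h|/andP[h _]]; [left|right].
Qed.

(** With n = 0 there is no pole on the left, so the strip can start below both [c0] and the crossing
    point of the given contour. *)
Lemma meijer_kern (al be rho2 x c0 : R) : c0 < al -> c0 < be -> c0 < rho2 ->
  foxH 3 0 [:: (rho2 + 1, 1)] [:: (rho2, 1); (al, 1); (be, 1)] x =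
  mellin_line c0 (kern al be 1 rho2) x.
Proof.
move=> ca cb cr; pose r := Num.min (Num.min al be) rho2.
have [ra rb rr] : [/\ r <= al, r <= be & r <= rho2] by rewrite /r !ge_min !lexx !orbT.
rewrite -[[:: (rho2 + 1, 1)]]cat0s -[[:: (rho2, 1); _; _]]cats0.
apply: (@foxH_mellin _ _ _ _ _ _ r).
- by apply: decay_kern; rewrite oner_eq0.
- by apply: separates_cst => //=; rewrite !eqxx ca cb cr.
move=> c _ sc; exists (Num.min c0 (c 0) - 1).
have m1' : Num.min c0 (c 0) <= c0 by rewrite ge_min lexx.
have m2' : Num.min c0 (c 0) <= c 0 by rewrite ge_min lexx orbT.
have m1 : Num.min c0 (c 0) - 1 < c0 by lra.
have m2 : Num.min c0 (c 0) - 1 < c 0 by lra.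
have sl b : ((b, 1) : R * R) \in [:: (rho2, 1); (al, 1); (be, 1)] -> c 0 < b.
  by move=> h; apply: separates_lower _ _ sc h.
split.
- by rewrite m1 !lt_min ca cb cr.
- by rewrite m2 !lt_min !sl// !inE eqxx ?orbT.
- by apply: slit_kern => //; exact: pos_strip_gline.
move=> s hs; rewrite foxH_integrand_cat// !(big_cons, big_nil) /= !gamma_lower.
rewrite /kern /kern2 (lin_ratio rr hs) -(gline_lin be s).
move: (gline al s) (gline be s) (gline rho2 s) (gline (rho2 + 1) s) (cpow x s).
by move=> a1 a2 a3 a4 a5; rewrite !mulr1; ring.
Qed.

Lemma meijer_kernF (al be rho2 x c0 : R) : - be < c0 -> c0 < al -> c0 < rho2 ->
  foxH 2 1 [:: (1 - be, 1); (rho2 + 1, 1)] [:: (al, 1); (rho2, 1)] x =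
  mellin_line c0 (kern al be (-1) rho2) x.
Proof.
move=> bc ca cr; pose r := Num.min al rho2.
have [ra rr] : r <= al /\ r <= rho2 by rewrite /r !ge_min !lexx !orbT.
rewrite -[[:: (1 - be, 1); _]](cat1s (1 - be, 1)) -[[:: (al, 1); _]]cats0.
apply: (@foxH_mellin _ _ _ _ _ _ r).
- by apply: decay_kern; rewrite oppr_eq0 oner_eq0.
- apply: separates_cst => //=; first by rewrite !eqxx ca cr.
  by rewrite ltr01 mulr1 addrAC subrr add0r bc.
move=> c _ sc; exists (- be).
have sl b : ((b, 1) : R * R) \in [:: (al, 1); (rho2, 1)] -> c 0 < b.
  by move=> h; apply: separates_lower _ _ sc h.
have su : - be < c 0.
  have : 1 - be - 1 < c 0 by apply: separates_upper _ _ sc (mem_head ((1 - be, 1) : R * R) [::]).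
  by rewrite addrAC subrr add0r.
split.
- by rewrite bc !lt_min ca cr.
- by rewrite su !lt_min !sl// !inE eqxx ?orbT.
- apply: slit_kern; rewrite ?oppr_eq0 ?oner_eq0//.
  by move=> y /andP[y1 _]; rewrite opprK mul1r addrC -ltrBlDr sub0r.
move=> s hs; rewrite foxH_integrand_cat// !(big_cons, big_nil) /= !gamma_lower gamma_upper.
rewrite /kern /kern2 (lin_ratio rr hs) opprK.
move: (gline al s) (cGamma (lin be 1 s)) (gline rho2 s) (gline (rho2 + 1) s) (cpow x s).
by move=> a1 a2 a3 a4 a5; rewrite !mulr1; ring.
Qed.

Variables (al be rho2 v p tau x r c0 : R) (k : nat).
Hypotheses (p0 : 0 < p) (t0 : 0 < tau).
Hypotheses (ra : r <= al) (rr : r <= rho2) (rv : r <= v) (c00 : 0 < c0) (cr : c0 < r).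

Let cst_sep : all (fun a : R * R => (0 < a.2) && (a.1 - 1 < c0 * a.2)) [:: (1, 1); (1 - p, tau)].
Proof.
rewrite /= ltr01 t0 subrr mulr1 c00 andbT /= addrAC subrr add0r.
by rewrite (@lt_trans _ _ 0) ?oppr_lt0// mulr_gt0.
Qed.

Let cst_v : all (fun b : R * R => (b.2 == 1) && (c0 < b.1)) (nseq k (v, 1)).
Proof. by rewrite all_nseq eqxx (lt_le_trans cr rv) orbT. Qed.

(** An admissible contour is only known to cross the real axis to the left of every lower parameter;
    the second hypothesis makes this imply crossing below [r]. The strip starts at 0 because of the
    upper parameter (1, 1), that is, of the factor 1/s. *)
Lemma ber_foxH : r <= be ->
  (forall y, y < al -> y < be -> y < rho2 -> ((0 < k)%N -> y < v) -> y < r) ->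
  foxH (3 + k) 2 ([:: (1, 1); (1 - p, tau)] ++ ((rho2 + 1, 1) :: nseq k (v + 1, 1)))
    ([:: (rho2, 1); (al, 1); (be, 1)] ++ nseq k (v, 1) ++ [:: (0, 1)]) x =
  mellin_line c0 (ber_kern p tau (fog_kern v k (cdf_kern (kern al be 1 rho2)))) x.
Proof.
move=> rb hr; rewrite catA.
have sB : size ([:: (rho2, 1); (al, 1); (be, 1)] ++ nseq k (v, 1) : seq (R * R)) = (3 + k)%N.
  by rewrite size_cat size_nseq.
have ps : pos_strip 0 r be (- 1) by exact: pos_strip_gline.
have n1 : (1 : R) != 0 by rewrite oner_eq0.
apply: (@foxH_mellin _ _ _ _ _ _ r).
- by do 3!(apply: decay_ber_kern || apply: decay_fog_kern || apply: decay_cdf_kern) => //; exact: decay_kern.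
- apply: separates_cst => //; rewrite all_cat cst_v andbT /= !eqxx /=.
  by rewrite !(lt_le_trans cr).
move=> c _ sc; exists 0.
have sl b : ((b, 1) : R * R) \in [:: (rho2, 1); (al, 1); (be, 1)] ++ nseq k (v, 1) -> c 0 < b.
  by move=> h; apply: separates_lower _ _ sc h.
have su : 1 - 1 < c 0.
  by apply: separates_upper _ _ sc (mem_head ((1, 1) : R * R) [:: (1 - p, tau)]).
rewrite subrr in su.
split.
- by rewrite c00.
- rewrite su /=; apply: hr => [||| k0]; apply: sl; rewrite mem_cat ?inE ?eqxx ?orbT//.
  by rewrite mem_nseq k0 eqxx orbT.
- by apply: slit_ber_kern => //; apply: slit_fog_kern => //; apply: slit_cdf_kern; exact: slit_kern.
move=> s hs; rewrite foxH_integrand_cat// !(big_cat, big_cons, big_nil) /= !prod_nseq /=.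
rewrite !gamma_lower gamma_upper gamma_upper1 gamma_lower0.
rewrite /ber_kern /fog_kern /cdf_kern /kern /kern2 (lin_ratio rr hs) (lin_ratio rv hs) (lin_ratio0 hs).
rewrite -(gline_lin be s) (expr_div_n (gline v s) (gline (v + 1) s)).
move: (gline al s) (gline be s) (gline rho2 s) (gline (rho2 + 1) s) (cpow x s) => a1 a2 a3 a4 a5.
move: (gline v s ^+ k) (gline (v + 1) s ^+ k) (cGamma (lin p tau s)) => a6 a7 a8.
move: (cGamma s) (cGamma (s + 1)) => a9 a10; rewrite !mulr1 !invfM; ring.
Qed.

(** The additional upper parameter brings the poles of Gamma(be + s), at -be and further left, hence
    outside the strip that starts at 0. *)
Lemma ber_foxHF : 0 < be ->
  (forall y, y < al -> y < rho2 -> ((0 < k)%N -> y < v) -> y < r) ->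
  foxH (2 + k) 3 ([:: (1 - be, 1); (1, 1); (1 - p, tau)] ++ ((rho2 + 1, 1) :: nseq k (v + 1, 1)))
    ([:: (al, 1); (rho2, 1)] ++ nseq k (v, 1) ++ [:: (0, 1)]) x =
  mellin_line c0 (ber_kern p tau (fog_kern v k (cdf_kern (kern al be (-1) rho2)))) x.
Proof.
move=> b0 hr; rewrite [_ ++ nseq k (v, 1) ++ _]catA.
have sB : size ([:: (al, 1); (rho2, 1)] ++ nseq k (v, 1) : seq (R * R)) = (2 + k)%N.
  by rewrite size_cat size_nseq.
have ps : pos_strip 0 r be (- -1).
  by move=> y /andP[y0 _]; rewrite opprK mul1r addr_gt0.
have n1 : (-1 : R) != 0 by rewrite oppr_eq0 oner_eq0.
apply: (@foxH_mellin _ _ _ _ _ _ r).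
- by do 3!(apply: decay_ber_kern || apply: decay_fog_kern || apply: decay_cdf_kern) => //; exact: decay_kern.
- apply: separates_cst => //; first rewrite all_cat cst_v andbT /= !eqxx /=.
    by rewrite !(lt_le_trans cr).
  rewrite -cat1s all_cat cst_sep andbT /= ltr01 mulr1 addrAC subrr add0r andbT.
  by rewrite (lt_trans _ c00)// oppr_lt0.
move=> c _ sc; exists 0.
have sl b : ((b, 1) : R * R) \in [:: (al, 1); (rho2, 1)] ++ nseq k (v, 1) -> c 0 < b.
  by move=> h; apply: separates_lower _ _ sc h.
have su : 1 - 1 < c 0.
  by apply: separates_upper _ _ sc _ => //; rewrite !inE eqxx orbT.
rewrite subrr in su.
split.
- by rewrite c00.
- rewrite su /=; apply: hr => [|| k0]; apply: sl; rewrite mem_cat ?inE ?eqxx ?orbT//.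
  by rewrite mem_nseq k0 eqxx orbT.
- by apply: slit_ber_kern => //; apply: slit_fog_kern => //; apply: slit_cdf_kern; exact: slit_kern.
move=> s hs; rewrite foxH_integrand_cat// !(big_cat, big_cons, big_nil) /= !prod_nseq /=.
rewrite !gamma_lower !gamma_upper gamma_upper1 gamma_lower0.
rewrite /ber_kern /fog_kern /cdf_kern /kern /kern2 (lin_ratio rr hs) (lin_ratio rv hs) (lin_ratio0 hs).
rewrite opprK (expr_div_n (gline v s) (gline (v + 1) s)).
move: (gline al s) (cGamma (lin be 1 s)) (gline rho2 s) (gline (rho2 + 1) s) (cpow x s) => a1 a2 a3 a4 a5.
move: (gline v s ^+ k) (gline (v + 1) s ^+ k) (cGamma (lin p tau s)) => a6 a7 a8.
by move: (cGamma s) (cGamma (s + 1)) => a9 a10; rewrite !mulr1 !invfM; ring.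
Qed.

(** The substitution s -> s - phi. It reconciles the G-functions of the density, with parameters b,
    and the H-functions of the error rate, with parameters phi + b. *)
Lemma mellin_line_kern_shift (e phi c : R) : 0 < x ->
  cintegrable setT (fun t => kern al be e rho2 (c +i* t)) ->
  mellin_line (c - phi) (kern (al - phi) (be - e * phi) e (rho2 - phi)) x =
  (x `^ (- phi))%:C * mellin_line c (kern al be e rho2) x.
Proof.
move=> x0 ik; have mT : measurable ([set: R]) by exact: measurableT.
rewrite /mellin_line [RHS]mulrCA -(cintegralZ _ mT (mellin_line_integrable ik x)).
congr (_ * _); apply: eq_cintegral => t _.
have eS : (c - phi) +i* t = (c +i* t) - phi%:C.
  by apply: complex_eq; rewrite !cReImE /= ?oppr0 ?addr0.
have eL (b k' : R) : lin (b + k' * phi) k' ((c - phi) +i* t) = lin b k' (c +i* t).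
  by rewrite eS /lin realCD realCM; ring.
have eK : kern (al - phi) (be - e * phi) e (rho2 - phi) ((c - phi) +i* t) =
    kern al be e rho2 (c +i* t).
  rewrite /kern /kern2 !gline_lin -(eL al) -(eL be) -(eL rho2).
  by rewrite !mulN1r !mulNr.
rewrite eK eS cpowD -realCN cpow_real//.
by rewrite mulrA mulrC.
Qed.

End FoxKernels.

(** * The three turbulence models *)

Section KernelModel.
Context {R : realType}.
Local Notation mu := (@lebesgue_measure R).

Lemma bigmin_seq_le (I : eqType) (s : seq I) (F : I -> R) (x : R) :
  \big[Num.min/x]_(i <- s) F i <= x /\
  forall i, i \in s -> \big[Num.min/x]_(j <- s) F j <= F i.
Proof.
elim: s => [|i s [IH1 IH2]]; first by rewrite big_nil.
rewrite big_cons; split => [|j]; first by rewrite ge_min IH1 orbT.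
by rewrite in_cons ge_min => /orP[/eqP ->|/IH2 ->]; rewrite ?lexx ?orbT.
Qed.

Lemma bigmin_seq_attained (I : eqType) (s : seq I) (F : I -> R) (x : R) :
  \big[Num.min/x]_(i <- s) F i = x \/
  exists2 i, i \in s & \big[Num.min/x]_(j <- s) F j = F i.
Proof.
elim: s => [|i s IH]; first by left; rewrite big_nil.
rewrite big_cons minEle; case: ifP => _.
  by right; exists i; rewrite ?mem_head.
by case: IH => [->|[j js ->]]; [left|right; exists j; rewrite // in_cons js orbT].
Qed.

(* What the three turbulence models have in common: their G-functions are
   Mellin transforms of Gamma(al - s) Gamma(be - e s) / (rho2 - s), with e = 1,
   or e = -1 in the Fisher-Snedecor case. *)
Record kernel_model (M : tp_params R) (al rho2 e : R) (be : nat -> R) : Prop := {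
  km_e : e = 1 \/ e = -1;
  km_al : 0 < al;
  km_rho2 : 0 < rho2;
  km_be : forall l, (1 <= l <= tp_P M)%N -> 0 < be l;
  km_psi : 0 < tp_psi M;
  km_P : (0 < tp_P M)%N;
  km_zeta : forall l, (1 <= l <= tp_P M)%N -> 0 < tp_zeta M l;
  km_C : forall l, (1 <= l <= tp_P M)%N -> 0 < tp_C M l;
  km_meijer : forall l x c, (1 <= l <= tp_P M)%N -> 0 < x -> 0 < c ->
    c < al -> c < rho2 -> (e = 1 -> c < be l) ->
    meijerG (tp_m M) (tp_n M) (tp_a M l) (tp_b M l) x =
    (x `^ (- tp_phi M))%:C * mellin_line c (kern al (be l) e rho2) x;
  km_foxH : forall l x c v k t p, (1 <= l <= tp_P M)%N -> 0 < c ->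
    c < al -> c < rho2 -> (e = 1 -> c < be l) -> c < v -> (0 < k)%N -> (0 < t)%N -> 0 < p ->
    foxH (tp_m M + k) (tp_n M + 2) (ber_upper M v k t p l) (ber_lower M v k l) x =
    mellin_line c (ber_kern p t%:R^-1 (fog_kern v k (cdf_kern (kern al (be l) e rho2)))) x;
  km_exp : forall l b, (1 <= l <= tp_P M)%N ->
    (b \in [seq tp_phi M + y | y <- take (tp_m M) (tp_b M l)]) <->
    b = al \/ b = rho2 \/ (e = 1 /\ b = be l) }.

Variables (M : tp_params R) (al rho2 e : R) (be : nat -> R).
Hypothesis hM : kernel_model M al rho2 e be.

Let kr l := kern al (be l) e rho2.

Let e0 : e != 0.
Proof. by case: (km_e hM) => ->; rewrite ?oppr_eq0 oner_eq0. Qed.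

Let inP l : l \in index_iota 1 (tp_P M).+1 -> (1 <= l <= tp_P M)%N.
Proof. by rewrite mem_index_iota ltnS. Qed.

(** Up to [r] no pole of the kernels is met on the right of the line; for e = -1 the parameter
    [be l] gives poles on the left and imposes nothing. *)
Definition tp_strip (r : R) : Prop :=
  forall l b, (1 <= l <= tp_P M)%N -> b = al \/ b = rho2 \/ (e = 1 /\ b = be l) -> r <= b.

Variable r : R.
Hypothesis hr : tp_strip r.

Let l1 : (1 <= 1 <= tp_P M)%N. Proof. by rewrite (km_P hM). Qed.
Let ra : r <= al. Proof. by apply: (hr l1); left. Qed.
Let rr : r <= rho2. Proof. by apply: (hr l1); right; left. Qed.

Let ps l : (1 <= l <= tp_P M)%N -> pos_strip 0 r (be l) (- e).
Proof.
move=> hl; case: (km_e hM) => e1.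
  by rewrite e1; apply: pos_strip_gline; apply: (hr hl); right; right.
by rewrite e1 opprK => x /andP[x0 _]; rewrite mul1r addr_gt0// (km_be hM).
Qed.

Lemma slit_model l : (1 <= l <= tp_P M)%N -> slit_holomorphic 0 r (kr l).
Proof. by move=> hl; apply: slit_kern => //; exact: ps. Qed.

Lemma decay_model l : strip_decay (kr l).
Proof. exact: decay_kern. Qed.

Variable kappa : R.
Hypothesis hk : forall c x : R, c < al -> 0 < x ->
  gam al c x = (kappa * (expR (al * ln x) * expR (- x)))%:C.

Lemma model_value l c x : (1 <= l <= tp_P M)%N -> 0 < c -> c < r -> 0 < x ->
  mellin_line c (kr l) x = (kappa * kJ al (be l) e rho2 x)%:C.
Proof. by move=> hl c0 cr x0; have [-> _] := kern_value e0 ra rr (ps hl) c0 cr hk x0. Qed.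

Lemma model_im0 l c x : (1 <= l <= tp_P M)%N -> 0 < c -> c < r -> 0 < x ->
  complex.Im (mellin_line c (kr l) x) = 0.
Proof. by move=> hl c0 cr x0; rewrite (model_value hl c0 cr x0). Qed.

Definition tp_coef l : R := tp_psi M * (tp_zeta M l * tp_C M l `^ (- tp_phi M)).

Lemma tp_coef_gt0 l : (1 <= l <= tp_P M)%N -> 0 < tp_coef l.
Proof.
by move=> hl; rewrite !mulr_gt0 ?powR_gt0 ?(km_psi hM) ?(km_zeta hM) ?(km_C hM).
Qed.

Lemma tp_densityE c x : 0 < c -> c < r -> 0 < x -> tp_density M x =
  \sum_(1 <= l < (tp_P M).+1)
    tp_coef l * (x^-1 * complex.Re (mellin_line c (kr l) (tp_C M l * x))).
Proof.
move=> c0 cr x0; rewrite /tp_density x0 (big_morph (@complex.Re R) (@cReD R) (erefl (complex.Re (0 : R[i])))) mulr_sumr.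
apply: eq_big_seq => l /inP hl; have C0 := km_C hM hl.
have cb : e = 1 -> c < be l by move=> e1; apply: lt_le_trans cr _; apply: (hr hl); right; right.
rewrite (km_meijer hM hl (mulr_gt0 C0 x0) c0 (lt_le_trans cr ra) (lt_le_trans cr rr) cb).
rewrite 2!cRe_scale powRM ?(ltW C0) ?(ltW x0)//.
have -> : x `^ (tp_phi M - 1) = x^-1 * x `^ (tp_phi M).
  by rewrite powRD ?(gt_eqF x0) ?implybT// powR_inv1 ?(ltW x0)// mulrC.
have xx : x `^ (tp_phi M) * x `^ (- tp_phi M) = 1.
  by rewrite powRN mulfV// gt_eqF// powR_gt0.
rewrite /tp_coef -/(kr l); set Z := complex.Re _.
transitivity (tp_psi M * (tp_zeta M l * tp_C M l `^ (- tp_phi M)) * (x^-1 * Z) *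
  (x `^ (tp_phi M) * x `^ (- tp_phi M))).
  by ring.
by rewrite xx mulr1.
Qed.

Lemma tp_density_value x : 0 < r -> 0 < x -> tp_density M x =
  kappa * \sum_(1 <= l < (tp_P M).+1)
    tp_coef l * (x^-1 * kJ al (be l) e rho2 (tp_C M l * x)).
Proof.
move=> r0 x0; have c0 : 0 < r / 2 by rewrite divr_gt0.
have cr : r / 2 < r by lra.
rewrite (tp_densityE c0 cr x0) mulr_sumr; apply: eq_big_seq => l /inP hl.
rewrite (model_value hl c0 cr (mulr_gt0 (km_C hM hl) x0)).
by rewrite [RHS]mulrCA; apply: (congr1 (fun u => _ * u)); rewrite [RHS]mulrCA.
Qed.

(** All other factors of the density are nonnegative, so kappa <= 0 would force it to vanish
    identically, against its total mass 1. *)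
Lemma kappa_gt0 (d : measure_display) (T : measurableType d) (P : probability T R)
    (X : {RV P >-> R}) : 0 < r -> has_density P X (tp_density M) -> 0 < kappa.
Proof.
move=> r0 dX; rewrite ltNge; apply/negP => k0.
have [_ f0 _] := dX.
have f1 x : tp_density M x = 0.
  apply/le_anti; rewrite f0 andbT.
  have [x0|x0] := ltP 0 x; last by rewrite /tp_density ltNge x0.
  rewrite tp_density_value// mulr_le0_ge0// big_seq sumr_ge0// => l /inP hl.
  by apply: mulr_ge0; [exact: ltW (tp_coef_gt0 hl)|apply: mulr_ge0; [rewrite invr_ge0 ltW|exact: kJ_ge0]].
have := density_integral1 dX; rewrite integral0_eq; last by move=> x _; rewrite f1.
by move/eqP; rewrite eq_sym onee_eq0.
Qed.

Lemma tp_density_lower l b : 0 < r -> 0 < kappa -> (1 <= l <= tp_P M)%N ->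
  b = al \/ b = rho2 \/ (e = 1 /\ b = be l) ->
  exists K x1 : R, [/\ 0 < K, 0 < x1 &
    forall x, 0 < x <= x1 -> K * expR ((b - 1) * ln x) <= tp_density M x].
Proof.
move=> r0 k0 hl hb; have c0 : 0 < r / 2 by rewrite divr_gt0.
have cr : r / 2 < r by lra.
have kn0 : kappa != 0 by rewrite gt_eqF.
have [K K0 hK] := kJ_power_lower e0 ra rr (ps hl) c0 cr hk kn0 (km_e hM) hb.
have C0 := km_C hM hl; have a0 := tp_coef_gt0 hl.
exists (kappa * (tp_coef l * (K * expR (b * ln (tp_C M l))))), (2^-1 / tp_C M l).
split; first exact: mulr_gt0 k0 (mulr_gt0 a0 (mulr_gt0 K0 (expR_gt0 _))).
  by rewrite divr_gt0 ?invr_gt0.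
move=> x /andP[x0 xx1]; rewrite tp_density_value// -mulrA ler_pM2l//.
rewrite (bigD1_seq l) /=; first last.
- exact: iota_uniq.
- by rewrite mem_index_iota ltnS.
apply: (@le_trans _ _ (tp_coef l * (x^-1 * kJ al (be l) e rho2 (tp_C M l * x)))).
  rewrite -mulrA ler_pM2l//.
  have -> : K * expR (b * ln (tp_C M l)) * expR ((b - 1) * ln x) =
      x^-1 * (K * expR (b * ln (tp_C M l * x))).
    have -> : x^-1 = expR (- ln x) by rewrite expRN lnK ?posrE.
    rewrite mulrCA -mulrA -!expRD lnM ?posrE//; congr (_ * expR _); ring.
  rewrite ler_pM2l ?invr_gt0//; apply: hK; rewrite mulr_gt0//=.
  by rewrite mulrC -ler_pdivlMr.
rewrite lerDl big_seq_cond sumr_ge0// => j /andP[/inP hj _].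
by apply: mulr_ge0; [exact: ltW (tp_coef_gt0 hj)|apply: mulr_ge0; [rewrite invr_ge0 ltW|exact: kJ_ge0]].
Qed.

End KernelModel.

Lemma kernel_model_BER (R : realType) (d : measure_display)
    (T : measurableType d) (P : probability T R)
    (M : tp_params R) (al rho2 e : R) (be : nat -> R)
    (v : R) (k : nat) (htp hf : {RV P >-> R}) (t : nat) (pm qm : R) :
  kernel_model M al rho2 e be -> 0 < v -> (0 < k)%N ->
  has_density P htp (tp_density M) -> has_density P hf (fog_density v k) ->
  independent_RV P htp hf -> (0 < t)%N -> 0 < pm -> 0 < qm ->
  let Pe := fun gamma0 : R =>
    average_BER P pm qm (snr t (fading htp hf) gamma0) in
  (forall gamma0 : R, 0 < gamma0 ->
    (Pe gamma0)%:C =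
    (tp_psi M * v ^+ k / (2 * rGamma pm))%:C *
    \sum_(1 <= l < (tp_P M).+1)
      (tp_zeta M l * tp_C M l `^ (- tp_phi M))%:C *
      foxH (tp_m M + k) (tp_n M + 2)
        (ber_upper M v k t pm l) (ber_lower M v k l)
        (tp_C M l * (1 / (qm * gamma0)) `^ (1 / t%:R))) /\
  - (ln (Pe gamma0) / ln gamma0) @[gamma0 --> +oo] -->
    \big[Num.min/v / t%:R]_(1 <= l < (tp_P M).+1)
      \big[Num.min/v / t%:R]_(b <- take (tp_m M) (tp_b M l))
        ((tp_phi M + b) / t%:R).
Proof.
move=> hM v0 k0 dX dY iXY t0 p0 q0 Pe.
have tp : 0 < t%:R :> R by rewrite ltr0n.
have inP l : l \in index_iota 1 (tp_P M).+1 -> (1 <= l <= tp_P M)%N.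
  by rewrite mem_index_iota ltnS.
set D := \big[_/_]_(_ <= _ < _) _.
(* The smallest of v and the exponents phi + b: the first pole to the right of the strip. *)
pose r := t%:R * D.
have [Dv Dl] := bigmin_seq_le (index_iota 1 (tp_P M).+1)
  (fun l => \big[Num.min/v / t%:R]_(b <- take (tp_m M) (tp_b M l)) ((tp_phi M + b) / t%:R)) (v / t%:R).
have rv : r <= v by rewrite /r mulrC -ler_pdivlMr.
have rb : tp_strip M al rho2 e be r.
  move=> l b hl /(proj2 (km_exp hM b hl)) /mapP[y yb ->].
  rewrite /r mulrC -ler_pdivlMr//.
  have [_ h] := bigmin_seq_le (take (tp_m M) (tp_b M l))
    (fun b => (tp_phi M + b) / t%:R) (v / t%:R).
  by apply: le_trans (h y yb); apply: Dl; rewrite mem_index_iota ltnS.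
(* The minimum is attained, either by the fog or by a turbulence exponent; it yields both r > 0 and
   the matching lower bound. *)
have att : r = v \/ exists l, (1 <= l <= tp_P M)%N /\
    (r = al \/ r = rho2 \/ (e = 1 /\ r = be l)).
  case: (bigmin_seq_attained (index_iota 1 (tp_P M).+1)
    (fun l => \big[Num.min/v / t%:R]_(b <- take (tp_m M) (tp_b M l)) ((tp_phi M + b) / t%:R))
    (v / t%:R)) => [De|[l /inP hl De]].
    by left; rewrite /r /D De mulrC divfK// gt_eqF.
  case: (bigmin_seq_attained (take (tp_m M) (tp_b M l))
    (fun b => (tp_phi M + b) / t%:R) (v / t%:R)) => [De'|[y yb De']].
    by left; rewrite /r /D De De' mulrC divfK// gt_eqF.
  right; exists l; split => //; apply: (proj1 (km_exp hM r hl)).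
  by rewrite /r /D De De' mulrC divfK ?gt_eqF//; apply: map_f.
have r0 : 0 < r.
  case: att => [->//|[l [hl [->|[->|[_ ->]]]]]];
    [exact: km_al hM|exact: km_rho2 hM|exact: km_be hM _ hl].
have D0 : 0 < D by move: r0; rewrite /r pmulr_rgt0.
have rD : r * t%:R^-1 = D by rewrite /r mulrAC divff ?mul1r// gt_eqF.
have [kappa hk] := gam_value al.
have kap0 : 0 < kappa := kappa_gt0 hM rb hk r0 dX.
have f0 (x : R) : x <= 0 -> tp_density M x = 0.
  by move=> x0; rewrite /tp_density ltNge x0.
have C0 l (hl : (1 <= l <= tp_P M)%N) := km_C hM hl.
have sl l (hl : (1 <= l <= tp_P M)%N) := slit_model hM rb hl.
have dl l (hl : (1 <= l <= tp_P M)%N) := decay_model hM l.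
have im c (c0 : 0 < c) (cr : c < r) l (x : R) (hl : (1 <= l <= tp_P M)%N) (x0 : 0 < x) :=
  model_im0 hM rb hk hl c0 cr x0.
have fE c (c0 : 0 < c) (cr : c < r) x (x0 : 0 < x) := tp_densityE hM rb c0 cr x0.
split.
  (* Any abscissa in ]0, r[ would do for the exact formula. *)
  move=> g g0; have c0 : 0 < r / 2 by rewrite divr_gt0.
  have cr : r / 2 < r by lra.
  rewrite (link_BER_complex k0 dX dY iXY f0 rv c0 cr C0 sl dl (im _ c0 cr) (fE _ c0 cr)
    t0 p0 q0 g0) mulr_sumr.
  apply: eq_big_seq => l /inP hl.
  have bl b : b = al \/ b = rho2 \/ (e = 1 /\ b = be l) -> r / 2 < b.
    by move=> h; apply: lt_le_trans cr _; exact: rb hl h.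
  rewrite (km_foxH hM _ hl c0 (bl al _) (bl rho2 _) _ (lt_le_trans cr rv) k0 t0 p0); last 3 first.
  - by left.
  - by right; left.
  - by move=> e1; apply: bl; right; right.
  rewrite [RHS]mulrA -realCM; congr (_%:C * mellin_line _ _ _).
    by rewrite /tp_coef; ring.
  have qg : 0 < qm * g by rewrite mulr_gt0.
  rewrite !div1r powR_expR ?invr_gt0// lnV ?posrE// lnM ?posrE// -mulrA -expRD.
  by congr (_ * expR _); ring.
apply: (diversity_limit D0).
  (* The exponent c in gamma0 corresponds to the line Re s = c t, inside the strip because c < D. *)
  move=> c /andP[c0 cD]; have c0' : 0 < c * t%:R by rewrite mulr_gt0.
  have cr : c * t%:R < r by rewrite /r mulrC ltr_pM2l.
  have [K K0 hK] := link_BER_upper k0 dX dY iXY f0 rv c0' cr C0 sl dl (im _ c0' cr)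
    (fE _ c0' cr) t0 p0 q0.
  exists K => // g g0; apply: le_trans (hK g g0) _.
  by rewrite mulfK// gt_eqF.
have c0 : 0 < r / 2 by rewrite divr_gt0.
have cr : r / 2 < r by lra.
have [L [x1 [L0 x10 hL]]] : exists L x1 : R, [/\ 0 < L, 0 < x1 &
    forall x, 0 < x <= x1 -> L * expR (r * ln x) <= cdf_fog (tp_density M) v k x].
  case: att => [rv'|[l [hl hb]]].
    have l1 : (1 <= 1 <= tp_P M)%N by rewrite (km_P hM).
    (* When the fog dominates, the turbulence gain only needs positive mass near 0, for which the
       exponent [al] serves. *)
    have [K [x1 [K0 x10 h]]] := tp_density_lower hM rb hk r0 kap0 l1 (or_introl (erefl al)).
    have [L' L0' hL'] := cdf_of_lower dX K0 x10 h.
    have F0 : 0 < cdf_of (tp_density M) x1.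
      apply: lt_le_trans (hL' x1 _); first by rewrite mulr_gt0 ?expR_gt0.
      by rewrite x10 lexx.
    have [L L0 hL] := cdf_fog_lower_fog v0 k0 dX dY iXY f0 x10 F0.
    by exists L, (x1 / 2); rewrite rv'; split => //; rewrite divr_gt0.
  have [K [x1 [K0 x10 h]]] := tp_density_lower hM rb hk r0 kap0 hl hb.
  have [L L0 hL] := cdf_fog_lower_tp v0 k0 dX dY iXY f0 K0 x10 h.
  by exists L, x1.
have [K K0 [g1 hK]] := link_BER_lower k0 dX dY iXY f0 rv c0 cr C0 sl dl (im _ c0 cr)
  (fE _ c0 cr) t0 p0 q0 (ltW r0) L0 x10 hL.
exists K => //; exists g1 => g g0 gg.
by apply: le_trans (hK g g0 gg); rewrite rD.
Qed.

(** * Verification that each model has the common form *)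

Section Models.
Context {R : realType}.

(** The G-function is evaluated on the line Re s = c - phi and moved back to c; the factor x^-phi
    cancels x^phi in the density. *)
Lemma meijer_model (al be rho2 phi x c : R) : 0 < x -> c < al -> c < be -> c < rho2 ->
  meijerG 3 0 [:: rho2 + 1 - phi] [:: rho2 - phi; al - phi; be - phi] x =
  (x `^ (- phi))%:C * mellin_line c (kern al be 1 rho2) x.
Proof.
move=> x0 ca cb cr.
have ik : cintegrable setT (fun t => kern al be 1 rho2 (c +i* t)).
  pose r := Num.min (Num.min al be) rho2.
  have [ra rb rr] : [/\ r <= al, r <= be & r <= rho2] by rewrite /r !ge_min !lexx !orbT.
  have n1 : (1 : R) != 0 by rewrite oner_eq0.
  apply: (vertical_integrable (slit_kern n1 ra rr (pos_strip_gline (l := c - 1) rb))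
    (decay_kern al be rho2 n1)).
  by rewrite !lt_min ca cb cr andbT; lra.
have be1 : be - 1 * phi = be - phi by rewrite mul1r.
have := mellin_line_kern_shift phi x0 ik; rewrite be1 => <-.
have [ca' cb' cr'] : [/\ c - phi < al - phi, c - phi < be - phi & c - phi < rho2 - phi].
  by rewrite !ltrD2r.
rewrite -(meijer_kern x ca' cb' cr').
by have -> : rho2 + 1 - phi = rho2 - phi + 1 by ring.
Qed.

Lemma meijer_modelF (al be rho2 phi x c : R) : 0 < x -> - be < c -> c < al -> c < rho2 ->
  meijerG 2 1 [:: 1 - be - phi; rho2 + 1 - phi] [:: al - phi; rho2 - phi] x =
  (x `^ (- phi))%:C * mellin_line c (kern al be (-1) rho2) x.
Proof.
move=> x0 cb ca cr.
have ik : cintegrable setT (fun t => kern al be (-1) rho2 (c +i* t)).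
  pose r := Num.min al rho2.
  have [ra rr] : r <= al /\ r <= rho2 by rewrite /r !ge_min !lexx !orbT.
  have n1 : (-1 : R) != 0 by rewrite oppr_eq0 oner_eq0.
  have ps : pos_strip (- be) r be (- -1).
    by move=> y /andP[y1 _]; rewrite opprK mul1r; lra.
  apply: (vertical_integrable (slit_kern n1 ra rr ps) (decay_kern al be rho2 n1)).
  by rewrite !lt_min ca cb cr.
have be1 : be - -1 * phi = be + phi by rewrite mulN1r opprK.
have := mellin_line_kern_shift phi x0 ik; rewrite be1 => <-.
have [ca' cr'] : c - phi < al - phi /\ c - phi < rho2 - phi by rewrite !ltrD2r.
have cb' : - (be + phi) < c - phi by lra.
rewrite -(meijer_kernF x cb' ca' cr').
have -> : rho2 + 1 - phi = rho2 - phi + 1 by ring.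
by have -> : 1 - be - phi = 1 - (be + phi) by ring.
Qed.

Lemma ber_foxH_model (al be rho2 v p tau x c : R) (k : nat) :
  0 < c -> c < al -> c < be -> c < rho2 -> c < v -> (0 < k)%N -> 0 < tau -> 0 < p ->
  foxH (3 + k) 2 ([:: (1, 1); (1 - p, tau)] ++ ((rho2 + 1, 1) :: nseq k (v + 1, 1)))
    ([:: (rho2, 1); (al, 1); (be, 1)] ++ nseq k (v, 1) ++ [:: (0, 1)]) x =
  mellin_line c (ber_kern p tau (fog_kern v k (cdf_kern (kern al be 1 rho2)))) x.
Proof.
move=> c0 ca cb cr cv k0 t0 p0; pose r := Num.min (Num.min al be) (Num.min rho2 v).
apply: (@ber_foxH _ _ _ _ _ _ _ _ r) => //; rewrite ?/r ?ge_min ?lexx ?orbT//.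
  by rewrite !lt_min ca cb cr cv.
by move=> y h1 h2 h3 /(_ k0) h4; rewrite !lt_min h1 h2 h3 h4.
Qed.

Lemma ber_foxH_modelF (al be rho2 v p tau x c : R) (k : nat) :
  0 < c -> c < al -> 0 < be -> c < rho2 -> c < v -> (0 < k)%N -> 0 < tau -> 0 < p ->
  foxH (2 + k) 3 ([:: (1 - be, 1); (1, 1); (1 - p, tau)] ++ ((rho2 + 1, 1) :: nseq k (v + 1, 1)))
    ([:: (al, 1); (rho2, 1)] ++ nseq k (v, 1) ++ [:: (0, 1)]) x =
  mellin_line c (ber_kern p tau (fog_kern v k (cdf_kern (kern al be (-1) rho2)))) x.
Proof.
move=> c0 ca b0 cr cv k0 t0 p0; pose r := Num.min al (Num.min rho2 v).
apply: (@ber_foxHF _ _ _ _ _ _ _ _ r) => //; rewrite ?/r ?ge_min ?lexx ?orbT//.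
  by rewrite !lt_min ca cr cv.
by move=> y h1 h2 /(_ k0) h4; rewrite !lt_min h1 h2 h4.
Qed.

Lemma addK1 (x : R) : 1 + (x - 1) = x.
Proof. by rewrite addrC subrK. Qed.

Lemma gamma_gamma_kernel (rho A0 alpha beta : R) :
  0 < rho -> 0 < A0 -> 0 < alpha -> 0 < beta ->
  kernel_model (gamma_gamma rho A0 alpha beta) alpha (rho ^+ 2) 1 (fun=> beta).
Proof.
move=> r0 A00 a0 b0; have r20 : 0 < rho ^+ 2 by rewrite exprn_gt0.
split => //=.
- by left.
- by rewrite divr_gt0 ?mulr_gt0 ?rGamma_gt0.
- by move=> l _; rewrite divr_gt0 ?mulr_gt0.
- move=> l x c _ x0 c0 ca cr /(_ erefl) cb.
  have := meijer_model 1 x0 ca cb cr; rewrite addrK; exact.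
- move=> l x c v k t p _ c0 ca cr /(_ erefl) cb cv k0 t0 p0.
  have ti : 0 < (t%:R : R)^-1 by rewrite invr_gt0 ltr0n.
  rewrite -(ber_foxH_model x c0 ca cb cr cv k0 ti p0) /ber_upper /ber_lower /=.
  by rewrite !addK1 [1 + rho ^+ 2]addrC.
- move=> l b _; rewrite !addK1 !inE; split.
    by case/or3P => /eqP ->; [right; left|left|right; right].
  by case=> [->|[->|[_ ->]]]; rewrite eqxx ?orbT.
Qed.

Lemma malaga_kernel (rho A0 alpha : R) (beta : nat) (g Omega : R) :
  0 < rho -> 0 < A0 -> 0 < alpha -> (0 < beta)%N -> 0 < g -> 0 < Omega ->
  kernel_model (malaga rho A0 alpha beta g Omega) alpha (rho ^+ 2) 1 (fun l => l%:R).
Proof.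
move=> r0 A00 a0 b0 g0 O0; have r20 : 0 < rho ^+ 2 by rewrite exprn_gt0.
have b0' : 0 < beta%:R :> R by rewrite ltr0n.
have gb0 : 0 < g * beta%:R by rewrite mulr_gt0.
have gO : 0 < g * beta%:R + Omega by rewrite addr_gt0.
split => //=.
- by left.
- by move=> l /andP[l0 _]; rewrite ltr0n.
- apply: divr_gt0 => //; apply: mulr_gt0 => //; rewrite /malaga_A; apply: mulr_gt0.
    by apply: divr_gt0; apply: mulr_gt0; rewrite ?powR_gt0 ?rGamma_gt0.
  by rewrite powR_gt0 ?divr_gt0.
- move=> l /andP[l0 lb]; rewrite /malaga_b.
  have c0 : 0 < 'C(beta.-1, l.-1)%:R :> R by rewrite ltr0n bin_gt0; case: (l) (beta) lb => [|?] [|?].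
  apply: mulr_gt0; last by rewrite powR_gt0 ?divr_gt0 ?mulr_gt0.
  apply: mulr_gt0; last by rewrite powR_gt0 ?divr_gt0.
  apply: mulr_gt0; last by rewrite exprn_gt0 ?divr_gt0.
  by apply: mulr_gt0 => //; apply: divr_gt0; rewrite ?powR_gt0 ?ltr0n ?fact_gt0.
- by move=> l _; rewrite divr_gt0 ?mulr_gt0.
- move=> l x c _ x0 c0 ca cr /(_ erefl) cb.
  have := meijer_model 0 x0 ca cb cr; rewrite !subr0; exact.
- move=> l x c v k t p _ c0 ca cr /(_ erefl) cb cv k0 t0 p0.
  have ti : 0 < (t%:R : R)^-1 by rewrite invr_gt0 ltr0n.
  rewrite -(ber_foxH_model x c0 ca cb cr cv k0 ti p0) /ber_upper /ber_lower /=.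
  by rewrite !add0r.
- move=> l b _; rewrite !add0r !inE; split.
    by case/or3P => /eqP ->; [right; left|left|right; right].
  by case=> [->|[->|[_ ->]]]; rewrite eqxx ?orbT.
Qed.

Lemma fisher_snedecor_kernel (rho A0 alpha beta : R) :
  0 < rho -> 0 < A0 -> 0 < alpha -> 1 < beta ->
  kernel_model (fisher_snedecor rho A0 alpha beta) alpha (rho ^+ 2) (-1) (fun=> beta).
Proof.
move=> r0 A00 a0 b1; have r20 : 0 < rho ^+ 2 by rewrite exprn_gt0.
have b0 : 0 < beta by lra.
have bm : 0 < beta - 1 by rewrite subr_gt0.
(* Excludes [beta] from the exponents: here Gamma(beta + s) has its poles on the left. *)
have n1 : (-1 : R) <> 1 by move=> h; lra.
split => //=.
- by right.
- by rewrite divr_gt0 ?mulr_gt0 ?rGamma_gt0.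
- by move=> l _; rewrite divr_gt0 ?mulr_gt0.
- move=> l x c _ x0 c0 ca cr _.
  have cb : - beta < c by lra.
  have := meijer_modelF 1 x0 cb ca cr; rewrite addrK.
  by have -> : 1 - beta - 1 = - beta by ring.
- move=> l x c v k t p _ c0 ca cr _ cv k0 t0 p0.
  have ti : 0 < (t%:R : R)^-1 by rewrite invr_gt0 ltr0n.
  rewrite -(ber_foxH_modelF x c0 ca b0 cr cv k0 ti p0) /ber_upper /ber_lower /=.
  by rewrite !addK1 [1 + rho ^+ 2]addrC.
- move=> l b _; rewrite !addK1 !inE; split.
    by case/orP => /eqP ->; [left|right; left].
  by case=> [->|[->|[/n1]]]; rewrite ?eqxx ?orbT.
Qed.

End Models.

Theorem mainTheorem8 (R : realType) (d : measure_display)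
    (T : measurableType d) (P : probability T R)
    (M : tp_params R) (v : R) (k : nat) (htp hf : {RV P >-> R})
    (t : nat) (pm qm : R)
    (hM : tp_model M) (hv : 0 < v) (hk : (0 < k)%N)
    (dens_tp : has_density P htp (tp_density M))
    (dens_f : has_density P hf (fog_density v k))
    (indep : independent_RV P htp hf)
    (ht : t = 1%N \/ t = 2%N) (hp : 0 < pm) (hq : 0 < qm) :
  let Pe := fun gamma0 : R =>
    average_BER P pm qm (snr t (fading htp hf) gamma0) in
  (forall gamma0 : R, 0 < gamma0 ->
    (Pe gamma0)%:C =
    (tp_psi M * v ^+ k / (2 * rGamma pm))%:C *
    \sum_(1 <= l < (tp_P M).+1)
      (tp_zeta M l * tp_C M l `^ (- tp_phi M))%:C *
      foxH (tp_m M + k) (tp_n M + 2)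
        (ber_upper M v k t pm l) (ber_lower M v k l)
        (tp_C M l * (1 / (qm * gamma0)) `^ (1 / t%:R))) /\
  - (ln (Pe gamma0) / ln gamma0) @[gamma0 --> +oo] -->
    \big[Num.min/v / t%:R]_(1 <= l < (tp_P M).+1)
      \big[Num.min/v / t%:R]_(b <- take (tp_m M) (tp_b M l))
        ((tp_phi M + b) / t%:R).
Proof.
have t0 : (0 < t)%N by case: ht => ->.
by case: hM dens_tp => [*|*|*]; apply: kernel_model_BER => //;
  [exact: gamma_gamma_kernel|exact: malaga_kernel|exact: fisher_snedecor_kernel].
Qed.
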